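(* Let $\rho$ be a function norm over a finite measure space $(\Omega,\Sigma,\mu)$. Suppose that $L_\rho\subseteq L_2(\mu)$ and that $L_\rho$ has Rademacher type $2$. Let $\Psi$ be a semi-normalized subsymmetric basic sequence in $L_\rho$. Then $\Psi$ is equivalent to either the unit vector system of $\ell_2$ or a pairwise disjointly supported sequence in $L_\rho$ consisting of simple functions escaping to infinity.
   Context: Let $(\Omega,\Sigma,\mu)$ be a $\sigma$-finite measure space, $\mathbb F$ the real or complex field, $L_0(\mu)$ the space of $\mathbb F$-valued measurable functions and $L_0^+(\mu)$ the cone of measurable functions with values in $[0,\infty]$ (functions equal a.e. are identified). A function norm over $(\Omega,\Sigma,\mu)$ is a map $\rho\colon L_0^+(\mu)\to[0,\infty]$ such that: (a) $\rho(f)=0$ iff $f=0$ a.e.; (b) $\rho(f+g)\le\rho(f)+\rho(g)$; (c) $\rho(tf)=t\rho(f)$ for $t\ge 0$; (d) $\rho(f)\le\rho(g)$ if $f\le g$ a.e.; (e) $\rho(\chi_E)<\infty$ if $\mu(E)<\infty$; (f) $\rho(\lim_n f_n)=\lim_n\rho(f_n)$ for every non-decreasing sequence $(f_n)$ in $L_0^+(\mu)$; (g) for every $E$ with $\mu(E)<\infty$ there is a constant $C_E$ with $\int_E f\,d\mu\le C_E\rho(f)$ for all $f\in L_0^+(\mu)$. Put $L_\rho=\{f\in L_0(\mu):\rho(|f|)<\infty\}$, a Banach lattice with norm $\|f\|_\rho=\rho(|f|)$. A basic sequence is a sequence that is a Schauder basis of its closed linear span; it is unconditional if every rearrangement of it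 is a basic sequence; it is semi-normalized if its norms are bounded above and bounded away from $0$. Two sequences $(x_n)$, $(y_n)$ in Banach spaces are equivalent if there is a linear isomorphism between their closed linear spans with $x_n\mapsto y_n$ for all $n$. A basic sequence is spreading if it is equivalent to each of its subsequences, and subsymmetric if it is unconditional and spreading. Let $\operatorname{supp}(f)=\Omega\setminus f^{-1}(0)$. A sequence $(f_n)$ in $L_0(\mu)$ escapes to infinity if $\lim_n \operatorname{ess\,inf}\{|f_n(\omega)|:\omega\in\operatorname{supp}(f_n)\}=\infty$. *)

(* Defs.v *)
From HB Require Import structures.
From mathcomp Require Import all_boot all_order all_algebra.
From mathcomp Require Import all_classical all_reals all_analysis.
From mathcomp Require Import measurable_realfun ess_sup_inf complex.
Import Order.TTheory GRing.Theory Num.Theory.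
Import numFieldNormedType.Exports.

Set Implicit Arguments.
Unset Strict Implicit.
Unset Printing Implicit Defensive.

Local Open Scope classical_set_scope.
Local Open Scope ring_scope.

(* Sequences in a normed space over a field K. *)
Section basic_sequences.
Context {K : numFieldType} {E : normedModType K}.
Implicit Type x : nat -> E.

Definition linear_span x : set E :=
  [set v | exists (n : nat) (a : nat -> K), v = \sum_(i < n) a i *: x i].

Definition closed_span x : set E := closure (linear_span x).

Definition expansion x (a : nat -> K) (v : E) : Prop :=
  series (fun n => a n *: x n) @ \oo --> v.

Definition basic_sequence x : Prop :=
  forall v, closed_span x v -> exists! a : nat -> K, expansion x a v.

Definition unconditional x : Prop :=
  forall s : nat -> nat, bijective s -> basic_sequence (x \o s).

Definition semi_normalized x : Prop :=
  exists c C : K, 0 < c /\ forall n, c <= `|x n| <= C.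

End basic_sequences.

(* A linear homeomorphism between the closed spans, as a pair of mutually
   inverse maps; their values outside the closed spans are irrelevant. *)
Definition equivalent_sequences {K : numFieldType} {E G : normedModType K}
    (x : nat -> E) (y : nat -> G) : Prop :=
  let X := closed_span x in let Y := closed_span y in
  exists (S : E -> G) (S' : G -> E),
    (forall (a : K) u v, X u -> X v -> S (a *: u + v) = a *: S u + S v) /\
    (forall u, X u -> Y (S u)) /\
    (forall w, Y w -> X (S' w)) /\
    (forall u, X u -> S' (S u) = u) /\
    (forall w, Y w -> S (S' w) = w) /\
    {within X, continuous S} /\
    {within Y, continuous S'} /\
    (forall n, S (x n) = y n).

Section subsymmetric.
Context {K : numFieldType} {E : normedModType K}.
Implicit Type x : nat -> E.

Definition spreading x : Prop :=
  basic_sequence x /\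
  forall phi : nat -> nat, {homo phi : i j / (i < j)%N} ->
    equivalent_sequences x (x \o phi).

Definition subsymmetric x : Prop := unconditional x /\ spreading x.

End subsymmetric.

(* E ||sum_i eps_i x_i||^2 <= C^2 sum_i ||x_i||^2, the signs eps_i being
   independent and uniform on {-1, 1}. *)
Definition Rademacher_type2 {K : numFieldType} (E : normedModType K) : Prop :=
  exists C : K, 0 <= C /\ forall (n : nat) (x : 'I_n -> E),
    (\sum_(e : {ffun 'I_n -> bool}) `|\sum_(i < n) (-1) ^+ e i *: x i| ^+ 2)
      / 2 ^+ n <= C ^+ 2 * \sum_(i < n) `|x i| ^+ 2.

Variant scalar_kind := RealScalars | ComplexScalars.

Section scalars.
Context (R : realType).

(* numFieldType, so that normedModType applies uniformly to both fields. *)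
Definition scalars (k : scalar_kind) : numFieldType :=
  match k with RealScalars => R | ComplexScalars => R[i] end.

Definition re_part k : scalars k -> R :=
  match k return scalars k -> R with
  | RealScalars => fun z => z
  | ComplexScalars => fun z => complex.Re z
  end.

Definition im_part k : scalars k -> R :=
  match k return scalars k -> R with
  | RealScalars => fun=> 0
  | ComplexScalars => fun z => complex.Im z
  end.

Definition of_real k : R -> scalars k :=
  match k return R -> scalars k with
  | RealScalars => fun r => r
  | ComplexScalars => fun r => real_complex R r
  end.

(* The absolute value with values in R; the norm of a numFieldType takes its
   values in the field itself. *)
Definition modulus k : scalars k -> R :=
  match k return scalars k -> R with
  | RealScalars => fun z => `|z|
  | ComplexScalars => fun z => complex.Re `|z|
  end.

Lemma re_partD k (a b : scalars k) : re_part (a + b) = re_part a + re_part b.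
Proof. by case: k a b => //= -[a b] [c d]. Qed.

Lemma im_partD k (a b : scalars k) : im_part (a + b) = im_part a + im_part b.
Proof. by case: k a b => /= [_ _|[a b] [c d]//]; rewrite addr0. Qed.

Lemma re_partM k (a b : scalars k) :
  re_part (a * b) = re_part a * re_part b - im_part a * im_part b.
Proof. by case: k a b => /= [a b|[a b] [c d]//]; rewrite mulr0 subr0. Qed.

Lemma im_partM k (a b : scalars k) :
  im_part (a * b) = re_part a * im_part b + im_part a * re_part b.
Proof. by case: k a b => /= [a b|[a b] [c d]//]; rewrite mulr0 mul0r addr0. Qed.

Lemma re_part0 k : re_part (0 : scalars k) = 0. Proof. by case: k. Qed.

Lemma im_part0 k : im_part (0 : scalars k) = 0. Proof. by case: k. Qed.

Lemma of_realD k a b : of_real k (a + b) = of_real k a + of_real k b.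
Proof. by case: k => //=; rewrite rmorphD. Qed.

Lemma of_realM k a b : of_real k (a * b) = of_real k a * of_real k b.
Proof. by case: k => //=; rewrite rmorphM. Qed.

Lemma of_real_le k a b : (of_real k a <= of_real k b) = (a <= b).
Proof. by case: k => //=; rewrite lecR. Qed.

Lemma of_real_eq0 k a : of_real k a = 0 -> a = 0.
Proof. by case: k => //= -[]. Qed.

Lemma norm_modulus k (z : scalars k) : `|z| = of_real k (modulus z).
Proof. by case: k z => //= z; rewrite RRe_real// normr_real. Qed.

Lemma modulusE k (z : scalars k) :
  modulus z = Num.sqrt (re_part z ^+ 2 + im_part z ^+ 2).
Proof.
by case: k z => [z|[a b]] //=; rewrite expr0n addr0 sqrtr_sqr.
Qed.

Lemma modulus_ge0 k (z : scalars k) : 0 <= modulus z.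
Proof. by rewrite modulusE sqrtr_ge0. Qed.

Lemma modulusD k (a b : scalars k) :
  modulus (a + b) <= modulus a + modulus b.
Proof.
by rewrite -(of_real_le k) of_realD -!norm_modulus ler_normD.
Qed.

Lemma of_real_inj k : injective (of_real k).
Proof. by case: k => //= a b []. Qed.

Lemma modulusM k (a b : scalars k) : modulus (a * b) = modulus a * modulus b.
Proof.
by apply: (@of_real_inj k); rewrite of_realM -!norm_modulus normrM.
Qed.

Lemma modulus0_eq0 k (a : scalars k) : modulus a = 0 -> a = 0.
Proof.
move=> a0; apply/eqP; rewrite -normr_eq0 norm_modulus a0.
by case: k a a0 => //=.
Qed.

Lemma modulus0 k : modulus (0 : scalars k) = 0.
Proof. by rewrite modulusE re_part0 im_part0 expr0n addr0 sqrtr0. Qed.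

End scalars.

Section function_norms.
Context {R : realType} {d : measure_display} {T : measurableType d}.
Implicit Type mu : {measure set T -> \bar R}.
Local Open Scope ereal_scope.

Definition L0plus : set (T -> \bar R) :=
  [set f : T -> \bar R | measurable_fun setT f /\ forall w, 0 <= f w].

(* Values of the map outside L0plus are irrelevant; invariance under a.e.
   equality follows from fnorm_le. *)
Record function_norm mu := FunctionNorm {
  fnorm :> (T -> \bar R) -> \bar R ;
  fnorm_ge0 : forall f, L0plus f -> 0 <= fnorm f ;
  fnorm_eq0 : forall f, L0plus f ->
    (fnorm f = 0 <-> \forall w \ae mu, f w = 0) ;
  fnormD : forall f g, L0plus f -> L0plus g ->
    fnorm (f \+ g) <= fnorm f + fnorm g ;
  fnormZ : forall (t : R) f, (0 <= t)%R -> L0plus f ->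
    fnorm (fun w => t%:E * f w) = t%:E * fnorm f ;
  fnorm_le : forall f g, L0plus f -> L0plus g ->
    (\forall w \ae mu, f w <= g w) -> fnorm f <= fnorm g ;
  fnorm_indic : forall A, measurable A -> mu A < +oo ->
    fnorm (EFin \o \1_A) < +oo ;
  fnorm_cvg : forall (f_ : nat -> T -> \bar R) f,
    (forall n, L0plus (f_ n)) -> L0plus f ->
    (forall n, \forall w \ae mu, f_ n w <= f_ n.+1 w) ->
    (\forall w \ae mu, f_ n w @[n --> \oo] --> f w) ->
    fnorm (f_ n) @[n --> \oo] --> fnorm f ;
  fnorm_integral : forall A, measurable A -> mu A < +oo ->
    exists C : R, forall f, L0plus f ->
      \int[mu]_(w in A) f w <= C%:E * fnorm f }.

End function_norms.

Section L2_norm.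
Context {R : realType} {d : measure_display} {T : measurableType d}.
Variable mu : {measure set T -> \bar R}.
Implicit Types f g : T -> \bar R.
Local Open Scope ereal_scope.

Let N := Lnorm mu 2%:E.
Let I2 (f : T -> \bar R) := \int[mu]_w (f w * f w).

Let I2_ge0 f : L0plus f -> 0 <= I2 f.
Proof. by move=> [_ f0]; apply: integral_ge0 => w _; rewrite mule_ge0. Qed.

Let measurable_sqr (f : T -> \bar R) :
  L0plus f -> measurable_fun setT (fun w => f w * f w).
Proof. by move=> [mf _]; exact: emeasurable_funM. Qed.

Let NE f : L0plus f -> N f = sqrte (I2 f).
Proof.
move=> Lf; rewrite /N unlock -poweR12_sqrt ?I2_ge0//; congr (_ `^ _).
apply: eq_integral => w _; rewrite gee0_abs ?Lf.2//.
case: (f w) (Lf.2 w) => [r r0|_|//]; last by rewrite poweRyr ?mulyy.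
by rewrite poweR_EFin -EFinM -expr2 powR_mulrn.
Qed.

Let I2_le f g : L0plus f -> L0plus g ->
  (\forall w \ae mu, f w <= g w) -> I2 f <= I2 g.
Proof.
move=> Lf Lg fg; apply: ae_ge0_le_integral => //.
- by move=> w _; rewrite mule_ge0 ?Lf.2.
- exact: measurable_sqr.
- by move=> w _; rewrite mule_ge0 ?Lg.2.
- exact: measurable_sqr.
- by apply: filterS fg => w fgw _; rewrite lee_pmul ?Lf.2.
Qed.

Let N_le f g : L0plus f -> L0plus g ->
  (\forall w \ae mu, f w <= g w) -> N f <= N g.
Proof. by move=> Lf Lg fg; rewrite !NE// lee_sqrt ?I2_ge0// I2_le. Qed.

Let N_ae f g : L0plus f -> L0plus g ->
  (\forall w \ae mu, f w = g w) -> N f = N g.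
Proof.
move=> Lf Lg fg; apply/eqP; rewrite eq_le !N_le//.
- by apply: filterS fg => w ->.
- by apply: filterS fg => w ->.
Qed.

Let N_eq0 f : L0plus f -> (N f = 0 <-> \forall w \ae mu, f w = 0).
Proof.
move=> Lf; split=> [/(Lnorm_eq0_eq0 Lf.1)|f0].
  by move=> /(_ (ltr0n _ 2)); apply: filterS => w; exact.
have L0 : L0plus (cst 0 : T -> \bar R) by split => //; exact: measurable_cst.
by rewrite (N_ae Lf L0 f0) /N Lnorm0// eqe pnatr_eq0.
Qed.

Let fin_ae f : L0plus f -> N f < +oo -> \forall w \ae mu, f w \is a fin_num.
Proof.
move=> Lf; rewrite NE// => If.
have {}If : I2 f < +oo.
  have := sqrte_fin_num (I2_ge0 Lf).
  by rewrite !ge0_fin_numE ?sqrte_ge0 ?I2_ge0// If => /esym.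
have : mu.-integrable setT (fun w => f w * f w).
  apply/integrableP; split; first exact: measurable_sqr.
  by under eq_integral do rewrite gee0_abs ?mule_ge0 ?Lf.2//.
move=> /(integrable_ae measurableT); apply: filterS => w /(_ I).
by case: (f w) (Lf.2 w).
Qed.

Let fineL f : L0plus f -> L0plus (EFin \o (fine \o f)).
Proof.
move=> [mf f0]; split => [|w /=]; last by rewrite lee_fin fine_ge0.
by apply/measurable_EFinP; exact: measurableT_comp.
Qed.

Let fine_ae f : L0plus f -> N f < +oo ->
  \forall w \ae mu, f w = (EFin \o (fine \o f)) w.
Proof.
by move=> Lf /(fin_ae Lf); apply: filterS => w fw /=; rewrite fineK.
Qed.

Let L0plusD f g : L0plus f -> L0plus g -> L0plus (f \+ g).
Proof.
move=> [mf f0] [mg g0]; split; first exact: emeasurable_funD.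
by move=> w; rewrite adde_ge0.
Qed.

Let ND f g : L0plus f -> L0plus g -> N (f \+ g) <= N f + N g.
Proof.
move=> Lf Lg.
have [fy|fy] := eqVneq (N f) +oo.
  by rewrite fy addye ?leey// -ltNye (lt_le_trans _ (Lnorm_ge0 _ _ _)).
have [gy|gy] := eqVneq (N g) +oo.
  by rewrite gy addey ?leey// -ltNye (lt_le_trans _ (Lnorm_ge0 _ _ _)).
have {}fy : N f < +oo by rewrite ltey.
have {}gy : N g < +oo by rewrite ltey.
rewrite (N_ae Lf (fineL Lf) (fine_ae Lf fy)).
rewrite (N_ae Lg (fineL Lg) (fine_ae Lg gy)).
rewrite (@N_ae (f \+ g) (EFin \o ((fine \o f) \+ (fine \o g))%R)).
- by apply: eminkowski;
    [exact: measurableT_comp Lf.1|exact: measurableT_comp Lg.1|rewrite lee1n].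
- exact: L0plusD.
- exact: (L0plusD (fineL Lf) (fineL Lg)).
- by apply: filterS2 (fin_ae Lf fy) (fin_ae Lg gy) => w fw gw /=;
    rewrite EFinD !fineK.
Qed.

Let NZ (t : R) f : (0 <= t)%R -> L0plus f ->
  N (fun w => t%:E * f w) = t%:E * N f.
Proof.
move=> t0 Lf.
have Ltf : L0plus (fun w => t%:E * f w).
  split; last by move=> w; rewrite mule_ge0 ?Lf.2.
  by apply: emeasurable_funM; [exact: measurable_cst|exact: Lf.1].
rewrite !NE// (_ : I2 (fun w => _) = (t * t)%:E * I2 f).
  rewrite sqrteM ?lee_fin ?mulr_ge0//; congr (_ * _).
  by have := sqrte_sqr t%:E; rewrite expe2 gee0_abs ?lee_fin.
rewrite /I2 -ge0_integralZl ?lee_fin ?mulr_ge0//; last 2 first.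
- exact: measurable_sqr.
- by move=> w _; rewrite mule_ge0 ?Lf.2.
by apply: eq_integral => w _; rewrite EFinM muleACA.
Qed.

Let L0plus_indic A : measurable A -> L0plus (EFin \o \1_A : T -> \bar R).
Proof.
by move=> mA; split => [|w]; [apply/measurable_EFinP; exact: measurable_indic|
  rewrite /= lee_fin].
Qed.

Let N_indic A : measurable A -> N (EFin \o \1_A) = sqrte (mu A).
Proof.
move=> mA; rewrite NE; last exact: L0plus_indic.
congr sqrte; rewrite -[A in RHS]setIT -integral_indic//.
apply: eq_integral => w _ /=.
by rewrite -EFinM indicE; case: (w \in A); rewrite ?mulr1 ?mulr0.
Qed.

Let N_indic_lty A : measurable A -> mu A < +oo -> N (EFin \o \1_A) < +oo.
Proof.
move=> mA muA; rewrite N_indic//.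
by rewrite -ge0_fin_numE ?sqrte_ge0// sqrte_fin_num// ge0_fin_numE.
Qed.

Let N_cvg (f_ : nat -> T -> \bar R) f :
  (forall n, L0plus (f_ n)) -> L0plus f ->
  (forall n, \forall w \ae mu, f_ n w <= f_ n.+1 w) ->
  (\forall w \ae mu, f_ n w @[n --> \oo] --> f w) ->
  N (f_ n) @[n --> \oo] --> N f.
Proof.
move=> Lf_ Lf f_S f_f.
have {}f_S : \forall w \ae mu, forall n, f_ n w <= f_ n.+1 w.
  exact: ae_foralln.
have [A [mA A0 HA]] : mu.-negligible
    (~` [set w | (forall n, f_ n w <= f_ n.+1 w) /\
                 f_ n w @[n --> \oo] --> f w]).
  exact: (filterI f_S f_f).
have {}HA w : ~ A w -> (forall n, f_ n w <= f_ n.+1 w) /\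
                 f_ n w @[n --> \oo] --> f w.
  by move=> nAw; apply: contrapT => H; apply: nAw; exact: HA.
have nd w : ~ A w -> {homo f_ ^~ w : m n / (m <= n)%N >-> m <= n}.
  by move=> nAw; apply/nondecreasing_seqP => n; apply: (HA _ nAw).1.
have ID g : L0plus g -> I2 g = \int[mu]_(w in ~` A) (g w * g w).
  move=> Lg; rewrite /I2 (ge0_negligible_integral mA)//; last first.
  - by move=> w _; rewrite mule_ge0 ?Lg.2.
  - exact: measurable_sqr.
  by rewrite setTD.
have Ile g n : L0plus g -> (forall w, ~ A w -> f_ n w <= g w) ->
    I2 (f_ n) <= I2 g.
  move=> Lg h; apply: I2_le => //; exists A; split => // w /= ngw.
  by apply: contrapT => nAw; apply: ngw; exact: h.
have If_f : I2 (f_ n) @[n --> \oo] --> I2 f.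
  have -> : (fun n => I2 (f_ n)) =
      (fun n => \int[mu]_(w in ~` A) (f_ n w * f_ n w)).
    by apply/funext => n; exact: ID.
  have -> : I2 f = \int[mu]_(w in ~` A) limn (fun n => f_ n w * f_ n w).
    rewrite ID//; apply: eq_integral => w; rewrite inE => nAw.
    apply/esym/cvg_lim => //; apply: cvgeM; [|exact: (HA _ nAw).2..].
    by case: (f w) (Lf.2 w) => //= r r0; rewrite mule_def_fin.
  apply: cvg_monotone_convergence.
  - exact: measurableC.
  - by move=> n; apply: measurable_funTS; exact: measurable_sqr.
  - by move=> n w _; rewrite mule_ge0 ?(Lf_ n).2.
  - by move=> w nAw m n mn; rewrite lee_pmul ?(Lf_ m).2 ?nd.
have ndI : {homo (fun n => I2 (f_ n)) : m n / (m <= n)%N >-> m <= n}.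
  by move=> m n mn; apply: Ile => // w nAw; exact: nd.
have ndN : {homo (fun n => N (f_ n)) : m n / (m <= n)%N >-> m <= n}.
  by move=> m n mn; rewrite !NE// lee_sqrt ?I2_ge0//; exact: ndI.
have If_le n : I2 (f_ n) <= I2 f.
  have := ereal_nondecreasing_cvgn ndI => h.
  rewrite -(cvg_unique _ h If_f)//.
  by apply: ereal_sup_ubound; exists n.
suff -> : N f = ereal_sup (range (fun n => N (f_ n))).
  exact: ereal_nondecreasing_cvgn.
apply/eqP; rewrite eq_le; apply/andP; split; last first.
  by apply: ge_ereal_sup => _ [n _ <-]; rewrite !NE// lee_sqrt ?I2_ge0.
set s := ereal_sup _.
have s0 : 0 <= s.
  by apply: (@le_trans _ _ (N (f_ 0%N))); [rewrite NE ?sqrte_ge0|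
    apply: ereal_sup_ubound; exists 0%N].
rewrite NE// -(gee0_abs s0) -sqrte_sqr lee_sqrt; last first.
  by rewrite expe2 mule_ge0.
have -> : I2 f = ereal_sup (range (fun n => I2 (f_ n))).
  exact: (cvg_unique _ If_f (ereal_nondecreasing_cvgn ndI)).
apply: ge_ereal_sup => _ [n _ <-].
rewrite -[leLHS](sqr_sqrte (I2_ge0 (Lf_ n))) -NE// !expe2.
have Ns : N (f_ n) <= s by apply: ereal_sup_ubound; exists n.
by rewrite lee_pmul ?Lnorm_ge0.
Qed.

Let N_integral A : measurable A -> mu A < +oo ->
  exists C : R, forall f, L0plus f -> \int[mu]_(w in A) f w <= C%:E * N f.
Proof.
move=> mA muA; exists (fine (sqrte (mu A)) + 1)%R => f Lf.
have m0 : (0 <= fine (sqrte (mu A)))%R by rewrite fine_ge0// sqrte_ge0.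
have [fy|fy] := eqVneq (N f) +oo.
  by rewrite fy gt0_muley ?leey// lte_fin ltr_wpDl.
have {}fy : N f < +oo by rewrite ltey.
have -> : \int[mu]_(w in A) f w = 'N[mu]_1[EFin \o (\1_A \* (fine \o f))%R].
  rewrite Lnorm1 integral_mkcond; apply: ae_eq_integral => //.
  - apply/(measurable_restrictT _ mA).
    exact: (measurable_funS measurableT (subsetT A) Lf.1).
  - apply: measurableT_comp => //; apply/measurable_EFinP.
    apply: measurable_funM; first exact: measurable_indic.
    exact: measurableT_comp Lf.1.
  - apply: filterS (fin_ae Lf fy) => w fw _.
    rewrite patchE /= indicE; case: ifPn => _ /=.
      by rewrite mul1r ger0_norm ?fine_ge0 ?Lf.2// fineK.
    by rewrite mul0r normr0.
apply: (@le_trans _ _ (N (EFin \o \1_A) * N (EFin \o (fine \o f)))).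
  apply: (@hoelder _ _ _ mu _ _ 2 2) => //.
  - exact: measurableT_comp Lf.1.
  - by rewrite [RHS]splitr mul1r.
rewrite -(N_ae Lf (fineL Lf) (fine_ae Lf fy)) N_indic//.
rewrite lee_wpmul2r ?Lnorm_ge0//.
rewrite EFinD fineK ?leeDl//.
by rewrite sqrte_fin_num// ge0_fin_numE.
Qed.

Definition L2_norm : function_norm mu :=
  FunctionNorm (fun f _ => Lnorm_ge0 mu 2%:E f) N_eq0 ND NZ N_le N_indic_lty
    N_cvg N_integral.

End L2_norm.

Section function_space.
Context {R : realType} (k : scalar_kind).
Context {d : measure_display} {T : measurableType d}.
Context {mu : {measure set T -> \bar R}} (rho : function_norm mu).
Local Notation K := (scalars R k).
Implicit Types f g : T -> K.

Definition L0 : set (T -> K) :=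
  [set f : T -> K | measurable_fun setT (fun w => re_part (f w)) /\
                    measurable_fun setT (fun w => im_part (f w))].

Definition abs_fun f : T -> \bar R := fun w => (modulus (f w))%:E.

Definition Lrho_set : set (T -> K) :=
  [set f : T -> K | L0 f /\ (rho (abs_fun f) < +oo)%E].

Definition Lrho_pred : {pred T -> K} := fun f => `[< Lrho_set f >].

Lemma L0plus_abs f : L0 f -> L0plus (abs_fun f).
Proof.
move=> [mre mim]; split; last by move=> w; rewrite lee_fin modulus_ge0.
apply/measurable_EFinP.
rewrite (_ : (fun w => _) =
  Num.sqrt \o (fun w => re_part (f w) ^+ 2 + im_part (f w) ^+ 2)); last first.
  by apply/funext => w; rewrite modulusE.
apply: measurableT_comp.
  by apply: continuous_measurable_fun; exact: sqrt_continuous.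
by apply: measurable_funD; exact: measurable_funX.
Qed.

Lemma L0_linear (a : K) f g : L0 f -> L0 g -> L0 (a *: f + g).
Proof.
move=> [fre fim] [gre gim]; split.
- rewrite (_ : (fun=> _) = (fun w => re_part a * re_part (f w)
      - im_part a * im_part (f w) + re_part (g w))); last first.
    by apply/funext => w /=; rewrite re_partD re_partM.
  by apply: measurable_funD => //; apply: measurable_funB;
    apply: measurable_funM => //; exact: measurable_cst.
- rewrite (_ : (fun=> _) = (fun w => re_part a * im_part (f w)
      + im_part a * re_part (f w) + im_part (g w))); last first.
    by apply/funext => w /=; rewrite im_partD im_partM.
  by apply: measurable_funD => //; apply: measurable_funD;
    apply: measurable_funM => //; exact: measurable_cst.
Qed.

Lemma L0_0 : L0 0.
Proof.
by split; [rewrite (_ : (fun=> _) = cst 0)|rewrite (_ : (fun=> _) = cst 0)];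
  try exact: measurable_cst; apply/funext => w /=; rewrite ?re_part0 ?im_part0.
Qed.

Lemma L0Z (a : K) f : L0 f -> L0 (a *: f).
Proof. by move=> Lf; rewrite -[_ *: _]addr0; apply: L0_linear L0_0. Qed.

Lemma L0D f g : L0 f -> L0 g -> L0 (f + g).
Proof. by move=> Lf Lg; rewrite -[f]scale1r; exact: L0_linear. Qed.

Lemma abs_fun0 : rho (abs_fun 0) = 0%E.
Proof.
apply/(fnorm_eq0 _ (L0plus_abs L0_0)).
by apply: aeW => w; rewrite /abs_fun modulus0.
Qed.

Lemma fnorm_absD f g : L0 f -> L0 g ->
  (rho (abs_fun (f + g)%R) <= rho (abs_fun f) + rho (abs_fun g))%E.
Proof.
move=> Lf Lg; apply: (le_trans _ (fnormD _ (L0plus_abs Lf) (L0plus_abs Lg))).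
have [[mf f0] [mg g0]] := (L0plus_abs Lf, L0plus_abs Lg).
apply: fnorm_le; first exact/L0plus_abs/L0D.
  by split; [exact: emeasurable_funD|move=> w; exact: adde_ge0].
by apply: aeW => w; rewrite lee_fin modulusD.
Qed.

Lemma fnorm_absZ (a : K) f : L0 f ->
  rho (abs_fun (a *: f)) = ((modulus a)%:E * rho (abs_fun f))%E.
Proof.
move=> Lf; rewrite -fnormZ ?modulus_ge0//; last exact: L0plus_abs.
by congr (fnorm rho _); apply/funext => w; rewrite /abs_fun modulusM EFinM.
Qed.

Lemma Lrho_submod_closed : submod_closed Lrho_pred.
Proof.
split=> [|a f g /asboolP[Lf rf] /asboolP[Lg rg]]; apply/asboolP.
  by split; [exact: L0_0|rewrite abs_fun0].
split; first exact: L0_linear.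
apply: (le_lt_trans (fnorm_absD (L0Z a Lf) Lg)).
rewrite fnorm_absZ// lte_add_pinfty//.
by rewrite lte_mul_pinfty ?lee_fin ?modulus_ge0.
Qed.

HB.instance Definition _ :=
  GRing.isSubmodClosed.Build K (T -> K) Lrho_pred Lrho_submod_closed.

(* Lrho_fun is the space of representatives, Lrho its quotient by the
   functions that vanish almost everywhere. *)
Record Lrho_fun := MkLrhoFun {
  Lrho_fun_val :> T -> K ;
  _ : Lrho_fun_val \in Lrho_pred }.

HB.instance Definition _ := [isSub for Lrho_fun_val].
HB.instance Definition _ := gen_eqMixin Lrho_fun.
HB.instance Definition _ := gen_choiceMixin Lrho_fun.
HB.instance Definition _ := [SubChoice_isSubLmodule of Lrho_fun by <:].

Local Notation Lf := Lrho_fun.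

Lemma Lrho_funP (f : Lf) : Lrho_set f.
Proof. by case: f => f /= /asboolP. Qed.

Lemma Lrho_fun_linear (a : K) (f g : Lf) w :
  (a *: f + g : Lf) w = a * f w + g w.
Proof. by []. Qed.

Definition ae_null : {pred Lf} :=
  fun f : Lf => `[< \forall w \ae mu, f w = 0 >].

Lemma ae_null_submod_closed : submod_closed ae_null.
Proof.
split=> [|a f g /asboolP f0 /asboolP g0]; apply/asboolP; first exact: aeW.
apply: filterS2 f0 g0 => w; rewrite Lrho_fun_linear => -> ->.
by rewrite mulr0 addr0.
Qed.

HB.instance Definition _ :=
  GRing.isSubmodClosed.Build K Lf ae_null ae_null_submod_closed.

Local Open Scope quotient_scope.

Definition Lrho : Type := Quotient.quot ae_null.

HB.instance Definition _ := GRing.Zmodule.on Lrho.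
HB.instance Definition _ := EqQuotient.on Lrho.

Definition Lrho_class (f : Lf) : Lrho := \pi_Lrho f.

Lemma Lrho_classP (f g : Lf) :
  Lrho_class f = Lrho_class g <-> \forall w \ae mu, f w = g w.
Proof.
rewrite /Lrho_class; split.
  move=> /eqquotP; rewrite Quotient.equivE => /asboolP.
  by apply: filterS => w /eqP; rewrite subr_eq0 => /eqP.
move=> fg; apply/eqquotP; rewrite Quotient.equivE; apply/asboolP.
by apply: filterS fg => w fgw; apply/eqP; rewrite subr_eq0; apply/eqP.
Qed.

Lemma Lrho_classE (x : Lrho) : Lrho_class (repr x) = x.
Proof. exact: reprK. Qed.

Lemma Lrho_classD (f g : Lf) : Lrho_class (f + g) = Lrho_class f + Lrho_class g.
Proof. exact: Quotient.pi_add. Qed.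

Lemma Lrho_classZ_subproof (a : K) (f g : Lf) :
  Lrho_class f = Lrho_class g -> Lrho_class (a *: f) = Lrho_class (a *: g).
Proof.
move=> /Lrho_classP fg; apply/Lrho_classP; apply: filterS fg => w fgw.
by rewrite -[a *: f]addr0 -[a *: g]addr0 !Lrho_fun_linear fgw.
Qed.

Definition Lscale (a : K) (x : Lrho) : Lrho := Lrho_class (a *: repr x).

Let LscaleE (a : K) (f : Lf) : Lscale a (Lrho_class f) = Lrho_class (a *: f).
Proof. by apply: Lrho_classZ_subproof; rewrite Lrho_classE. Qed.

Let LscaleA (a b : K) (x : Lrho) : Lscale a (Lscale b x) = Lscale (a * b) x.
Proof. by rewrite -(Lrho_classE x) !LscaleE scalerA. Qed.

Let Lscale1 : left_id (1 : K) Lscale.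
Proof. by move=> x; rewrite -(Lrho_classE x) LscaleE scale1r. Qed.

Let LscaleDr : right_distributive Lscale +%R.
Proof.
move=> a x y; rewrite -(Lrho_classE x) -(Lrho_classE y).
by rewrite -Lrho_classD !LscaleE scalerDr Lrho_classD.
Qed.

Let LscaleDl (x : Lrho) : {morph Lscale^~ x : a b / a + b}.
Proof.
by move=> a b; rewrite -(Lrho_classE x) !LscaleE scalerDl Lrho_classD.
Qed.

HB.instance Definition _ :=
  GRing.Zmodule_isLmodule.Build K Lrho LscaleA Lscale1 LscaleDr LscaleDl.

Lemma Lrho_classZ (a : K) (f : Lf) : Lrho_class (a *: f) = a *: Lrho_class f.
Proof. by rewrite -LscaleE. Qed.

Definition Lrho_norm (x : Lrho) : K :=
  of_real k (fine (rho (abs_fun (repr x)))).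

Let rho_fin (f : Lf) : rho (abs_fun f) \is a fin_num.
Proof.
have [Lf0 Lfy] := Lrho_funP f.
by rewrite ge0_fin_numE//; apply: fnorm_ge0; exact: L0plus_abs.
Qed.

Let Lrho_normE (f : Lf) :
  Lrho_norm (Lrho_class f) = of_real k (fine (rho (abs_fun f))).
Proof.
have /Lrho_classP fr : Lrho_class (repr (Lrho_class f)) = Lrho_class f.
  by rewrite Lrho_classE.
have [Lf0 _] := Lrho_funP f; have [Lr0 _] := Lrho_funP (repr (Lrho_class f)).
congr (of_real k (fine _)); apply/eqP.
by rewrite eq_le; apply/andP; split; apply: fnorm_le;
  try exact: L0plus_abs; apply: filterS fr => w fw; rewrite /abs_fun fw.
Qed.

Let Lrho_normD (x y : Lrho) : Lrho_norm (x + y) <= Lrho_norm x + Lrho_norm y.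
Proof.
rewrite -(Lrho_classE x) -(Lrho_classE y) -Lrho_classD !Lrho_normE.
rewrite -of_realD of_real_le.
rewrite -fineD// fine_le//; first by rewrite fin_numD !rho_fin.
by apply: fnorm_absD; apply: (Lrho_funP _).1.
Qed.

Let Lrho_normZ (a : K) (x : Lrho) : Lrho_norm (a *: x) = `|a| * Lrho_norm x.
Proof.
rewrite -(Lrho_classE x) -Lrho_classZ !Lrho_normE norm_modulus -of_realM.
by rewrite fnorm_absZ ?fineM//; apply: (Lrho_funP _).1.
Qed.

Let Lrho_norm0 (x : Lrho) : Lrho_norm x = 0 -> x = 0.
Proof.
rewrite -(Lrho_classE x) Lrho_normE => /of_real_eq0 r0.
have -> : 0 = Lrho_class 0 :> Lrho.
  by rewrite -(scale0r (Lrho_class 0)) -Lrho_classZ scale0r.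
apply/Lrho_classP.
have : rho (abs_fun (repr x)) = 0%E by rewrite -(fineK (rho_fin _)) r0.
move/(fnorm_eq0 _ (L0plus_abs (Lrho_funP (repr x)).1)).
by apply: filterS => w [] /modulus0_eq0 ->.
Qed.

HB.instance Definition _ :=
  @Lmodule_isNormed.Build K Lrho Lrho_norm Lrho_normD Lrho_normZ Lrho_norm0.

Lemma Lrho_norm_class (f : Lf) :
  `|Lrho_class f| = of_real k (fine (rho (abs_fun f))).
Proof. exact: Lrho_normE. Qed.

End function_space.

Arguments L0 {R} k {d T} _.
Arguments Lrho_set {R} k {d T mu} rho _.
Arguments Lrho_pred {R} k {d T mu} rho _.

Section disjoint_simple_escaping.
Context {R : realType} {k : scalar_kind}.
Context {d : measure_display} {T : measurableType d}.
Local Notation K := (scalars R k).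

Definition supp (f : T -> K) : set T := ~` (f @^-1` [set 0]).

Definition disjointly_supported (f : nat -> T -> K) : Prop :=
  forall m n, m != n -> supp (f m) `&` supp (f n) = set0.

Definition finitely_valued (f : T -> K) : Prop := finite_set (range f).

(* The value +oo off the support makes ess_inf the essential infimum of |f|
   over supp f. *)
Definition ess_inf_supp (mu : {measure set T -> \bar R}) (f : T -> K)
    : \bar R :=
  ess_inf mu (fun w => if w \in supp f then abs_fun f w else +oo%E).

Definition escapes_to_infinity (mu : {measure set T -> \bar R})
    (f : nat -> T -> K) : Prop :=
  ess_inf_supp mu (f n) @[n --> \oo] --> +oo%E.

End disjoint_simple_escaping.

(* l_2 is L_rho for the L_2 norm of the counting measure on nat. *)
Section ell2.
Context (R : realType) (k : scalar_kind).

Definition ell2_norm : function_norm (@counting nat R) := L2_norm counting.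

Definition ell2 : normedModType (scalars R k) := Lrho k ell2_norm.

Definition unit_seq (n : nat) : nat -> scalars R k := fun i => (i == n)%:R.

Lemma unit_seq_Lrho n : unit_seq n \in Lrho_pred k ell2_norm.
Proof.
apply/asboolP; split; first by split.
have -> : abs_fun (unit_seq n) = EFin \o \1_[set n].
  apply/funext => i; rewrite /abs_fun/= /unit_seq indicE.
  have -> : (i \in [set n]) = (i == n).
    by apply/idP/eqP => [|->]; rewrite inE.
  case: (i == n); last by rewrite modulus0.
  by apply/congr1/(@of_real_inj _ k); rewrite -norm_modulus normr1; case: (k).
apply: fnorm_indic => //.
suff : (@counting nat R [set n] < +oo)%E by [].
by rewrite /counting asboolT// ltry.
Qed.

Definition unit_vector (n : nat) : ell2 :=
  Lrho_class (MkLrhoFun (unit_seq_Lrho n)).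

End ell2.

(* Main.v *)
Require Import Defs.
From mathcomp Require Import all_boot all_order all_algebra.
From mathcomp Require Import all_classical all_reals all_analysis.
From mathcomp Require Import measurable_realfun ess_sup_inf complex.
From mathcomp Require Import ring lra zify.
Import Order.TTheory GRing.Theory Num.Theory.
Import numFieldNormedType.Exports.

(** The proof is the dichotomy of Kadec and Pelczynski. Write |.|_rho for the
    norm of L_rho and |.|_2 for that of L_2.

    A basic sequence of a Banach space has a basis constant, and an
    unconditional one an unconditional constant (basis_constant,
    unconditional_constant): its linear combinations change by at most a
    bounded factor when signs are changed. The space L_rho is a Banach space by
    the Riesz-Fischer argument (Lrho_fast_complete). Two sequences of Banach
    spaces whose finite combinations have comparable norms are equivalent
    (equivalent_of_dominated); this holds in particular for two sequences that
    are close to each other in the sense of perturbation_dominated.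

    Suppose first that the numbers |psi_n|_2 are bounded below. Averaging
    |sum_i eps_i a_i psi_i|_rho over the signs, type 2 gives the upper estimate
    |sum_i a_i psi_i|_rho <= C (sum_i |a_i|^2)^(1/2). For the lower estimate,
    the parallelogram law in L_2 provides signs for which
    |sum_i eps_i a_i psi_i|_2^2 >= sum_i |a_i|^2 |psi_i|_2^2, and the inclusion of
    L_rho in L_2 is bounded (Lrho_inclusion_bounded). So psi is equivalent to
    the unit vectors (equivalent_to_unit_vectors).

    Otherwise |psi_n|_2 comes arbitrarily close to 0 at arbitrarily large n.
    Type 2 prevents L_rho from containing the spaces l_infty^n uniformly, and
    this makes its norm absolutely continuous: the norm of f 1_A is small when
    the measure of A is small (absolutely_continuous_norm). A subsequence
    psi_(phi j) can therefore be chosen such that it is small where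
    |psi_(phi j)| < j + 1, while the sets where |psi_(phi j)| >= j + 1 are so
    small
    that they become disjoint after a negligible change; replacing functions
    by simple ones costs arbitrarily little
    (disjoint_escaping_subsequence, simple_approximation). The subsequence is a
    small perturbation of the resulting disjoint sequence, and psi, being
    spreading, is equivalent to its subsequence. *)

Set Implicit Arguments.
Unset Strict Implicit.
Unset Printing Implicit Defensive.

Local Open Scope classical_set_scope.
Local Open Scope ring_scope.

(** * Scalars and the real-valued norm *)

Section scalar_facts.
Context {R : realType} {k : scalar_kind}.
Local Notation K := (scalars R k).
Implicit Types (z : K) (r : R).

Lemma of_real1 : of_real k 1 = 1 :> K. Proof. by case: k. Qed.

Lemma of_real_0 : of_real k 0 = 0 :> K. Proof. by case: k. Qed.

Lemma of_realN r : of_real k (- r) = - of_real k r.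
Proof. by apply/eqP; rewrite -addr_eq0 -of_realD addNr of_real_0. Qed.

Lemma of_real_lt (a b : R) : (of_real k a < of_real k b :> K) = (a < b).
Proof. by rewrite !lt_def of_real_le (inj_eq (@of_real_inj _ k)). Qed.

Lemma of_realX r n : of_real k (r ^+ n) = of_real k r ^+ n :> K.
Proof. by elim: n => [|n IH]; rewrite ?expr0 ?of_real1// !exprS of_realM IH. Qed.

Lemma of_real_sum (I : Type) (s : seq I) (P : pred I) (F : I -> R) :
  of_real k (\sum_(i <- s | P i) F i) = \sum_(i <- s | P i) of_real k (F i) :> K.
Proof.
apply: (big_morph (of_real k : R -> K)); [exact: of_realD|exact: of_real_0].
Qed.

Lemma real_of_ge0 z : 0 <= z -> z = of_real k (re_part z).
Proof.
case: k z => //= -[a b]; rewrite lecE /= => /andP[/eqP b0 _].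
by rewrite b0.
Qed.

Lemma modulus_of_real r : 0 <= r -> modulus (of_real k r) = r.
Proof.
move=> r0; apply: (@of_real_inj _ k); rewrite -norm_modulus ger0_norm//.
by rewrite -of_real_0 of_real_le.
Qed.

Lemma re_part_of_real r : re_part (of_real k r) = r.
Proof. by case: k. Qed.

Lemma modulusN z : modulus (- z) = modulus z.
Proof. by apply: (@of_real_inj _ k); rewrite -!norm_modulus normrN. Qed.

Lemma re_partN z : re_part (- z) = - re_part z.
Proof. by apply/eqP; rewrite -addr_eq0 -re_partD addNr re_part0. Qed.

Lemma im_partN z : im_part (- z) = - im_part z.
Proof. by apply/eqP; rewrite -addr_eq0 -im_partD addNr im_part0. Qed.

Lemma modulus1 : modulus (1 : K) = 1.
Proof. by apply: (@of_real_inj _ k); rewrite -norm_modulus normr1 of_real1. Qed.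

Lemma modulus_sqr z : modulus z ^+ 2 = re_part z ^+ 2 + im_part z ^+ 2.
Proof. by rewrite modulusE sqr_sqrtr// addr_ge0 ?sqr_ge0. Qed.

Lemma re_part_le z : `|re_part z| <= modulus z.
Proof. by rewrite modulusE -sqrtr_sqr ler_wsqrtr// lerDl sqr_ge0. Qed.

Lemma im_part_le z : `|im_part z| <= modulus z.
Proof. by rewrite modulusE -sqrtr_sqr ler_wsqrtr// lerDr sqr_ge0. Qed.

Lemma modulus_le z : modulus z <= `|re_part z| + `|im_part z|.
Proof.
rewrite -(@ler_pXn2r _ 2)// ?nnegrE ?modulus_ge0 ?addr_ge0//.
rewrite modulus_sqr -(real_normK (num_real (re_part z))).
rewrite -(real_normK (num_real (im_part z))) sqrrD -addrA lerD2l lerDr.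
by rewrite mulrn_wge0// mulr_ge0.
Qed.

(** The scalar with given real and imaginary parts; over the reals the second
    argument is dropped. *)
Definition mk_scalar (p q : R) : K :=
  match k return scalars R k with
  | RealScalars => p
  | ComplexScalars => Complex p q
  end.

Lemma re_mk_scalar p q : re_part (mk_scalar p q) = p.
Proof. by rewrite /mk_scalar; case: k. Qed.

Lemma im_mk_scalar_sub p q z :
  `|im_part (mk_scalar p q) - im_part z| <= `|q - im_part z|.
Proof. by rewrite /mk_scalar; case: k z => //= z; rewrite subrr normr0. Qed.

Lemma modulus_mk_scalar_sub p q z :
  modulus (mk_scalar p q - z) <= `|p - re_part z| + `|q - im_part z|.
Proof.
apply: (le_trans (modulus_le _)).
by rewrite re_partD im_partD re_partN im_partN re_mk_scalar lerD2l
  im_mk_scalar_sub.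
Qed.

(** The limit is the supremum of the increasing sequence u_n - 2 B / 2^n, which
    lies below the decreasing sequence u_n + 2 B / 2^n. *)
Lemma real_fast_cauchy (u : nat -> R) (B : R) :
  (forall n, `|u n.+1 - u n| <= B * 2^-1 ^+ n) ->
  exists l, forall n, `|l - u n| <= 2 * B * 2^-1 ^+ n.
Proof.
move=> uB.
have step n : u n.+1 - u n <= B * 2^-1 ^+ n /\ u n - u n.+1 <= B * 2^-1 ^+ n.
  have := uB n; rewrite ler_norml => /andP[h1 h2]; split => //.
  by rewrite -opprB lerNl.
pose w n := u n - 2 * B * 2^-1 ^+ n.
pose v n := u n + 2 * B * 2^-1 ^+ n.
have wS n : w n <= w n.+1 by rewrite /w exprS; have := step n; lra.
have vS n : v n.+1 <= v n by rewrite /v exprS; have := step n; lra.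
have B0 : 0 <= B by have := le_trans (normr_ge0 _) (uB 0%N); rewrite expr0 mulr1.
have p0 n : 0 <= 2^-1 ^+ n :> R by rewrite exprn_ge0.
have wv m n : w m <= v n.
  have Hw : {homo w : i j / (i <= j)%N >-> i <= j}.
    exact: (homo_leq (@lexx _ R) (@le_trans _ R)).
  have Hv : {homo v : i j / (i <= j)%N >-> j <= i}.
    apply: (@homo_leq _ v (fun x y => y <= x)) => //.
    by move=> y x z /[swap]; apply: le_trans.
  apply: (le_trans (Hw _ _ (leq_maxl m n))).
  apply: le_trans (Hv _ _ (leq_maxr m n)).
  rewrite /w /v; set N := maxn m n.
  by have := mulr_ge0 B0 (p0 N); rewrite -mulrA; lra.
exists (sup (range w)) => n.
have hs : has_sup (range w).
  by split; [exists (w 0%N), 0%N|exists (v 0%N) => _ [m _ <-]; exact: wv].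
have h1 : w n <= sup (range w) by apply: (ub_le_sup hs.2); exists n.
have h2 : sup (range w) <= v n by apply: (ge_sup hs.1) => _ [m _ <-]; exact: wv.
by rewrite ler_norml; move: h1 h2; rewrite /w /v; lra.
Qed.

Lemma scalar_fast_cauchy (u : nat -> K) (B : R) :
  (forall n, modulus (u n.+1 - u n) <= B * 2^-1 ^+ n) ->
  exists l, forall n, modulus (l - u n) <= 4 * B * 2^-1 ^+ n.
Proof.
move=> uB.
have [|p pP] := @real_fast_cauchy (fun n => re_part (u n)) B.
  by move=> n; rewrite -re_partN -re_partD; exact: le_trans (re_part_le _) (uB n).
have [|q qP] := @real_fast_cauchy (fun n => im_part (u n)) B.
  by move=> n; rewrite -im_partN -im_partD; exact: le_trans (im_part_le _) (uB n).
exists (mk_scalar p q) => n; apply: (le_trans (modulus_mk_scalar_sub _ _ _)).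
by have := pP n; have := qP n; lra.
Qed.

End scalar_facts.

Section real_norm.
Context {R : realType} {k : scalar_kind}.
Local Notation K := (scalars R k).
Context {E : normedModType K}.
Implicit Types (u v w : E) (a : K).

(** The norm of a space over K takes its values in K; estimates are carried out
    with this real number instead. *)
Definition rnorm v : R := modulus `|v|.

Lemma rnormE v : `|v| = of_real k (rnorm v).
Proof. by rewrite /rnorm -norm_modulus normr_id. Qed.

Lemma rnorm_ge0 v : 0 <= rnorm v.
Proof. exact: modulus_ge0. Qed.

Lemma rnormD u v : rnorm (u + v) <= rnorm u + rnorm v.
Proof. by rewrite -(of_real_le k) of_realD -!rnormE ler_normD. Qed.

Lemma rnormN v : rnorm (- v) = rnorm v.
Proof. by rewrite /rnorm normrN. Qed.

Lemma rdistC u v : rnorm (u - v) = rnorm (v - u).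
Proof. by rewrite -rnormN opprB. Qed.

Lemma rdist_triangle w u v : rnorm (u - v) <= rnorm (u - w) + rnorm (w - v).
Proof. by rewrite -[u - v](subrKA w) rnormD. Qed.

Lemma rnormB u v : rnorm (u - v) <= rnorm u + rnorm v.
Proof. by rewrite -(rnormN v) rnormD. Qed.

Lemma rnormZ a v : rnorm (a *: v) = modulus a * rnorm v.
Proof.
by apply: (@of_real_inj _ k); rewrite of_realM -!rnormE normrZ norm_modulus.
Qed.

Lemma rnorm0 : rnorm 0 = 0.
Proof. by rewrite /rnorm normr0 modulus0. Qed.

Lemma rnorm0_eq0 v : rnorm v = 0 -> v = 0.
Proof. by move=> v0; apply/normr0_eq0; rewrite rnormE v0 of_real_0. Qed.

Lemma rnorm_gt0 v : v != 0 -> 0 < rnorm v.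
Proof.
move=> v0; rewrite lt_def rnorm_ge0 andbT; apply: contra v0 => /eqP.
by move/rnorm0_eq0 => ->.
Qed.

Lemma rnorm_sum (I : Type) (s : seq I) (P : pred I) (F : I -> E) :
  rnorm (\sum_(i <- s | P i) F i) <= \sum_(i <- s | P i) rnorm (F i).
Proof.
elim/big_ind2 : _ => [|x1 x2 y1 y2 h1 h2|//]; first by rewrite rnorm0.
by apply: le_trans (rnormD _ _) _; rewrite lerD.
Qed.

Lemma pos_scalarE (e : K) : 0 < e -> exists2 r : R, 0 < r & e = of_real k r.
Proof.
move=> e0; exists (re_part e); last exact/real_of_ge0/ltW.
by rewrite -(of_real_lt (k := k)) of_real_0 -real_of_ge0 ?ltW.
Qed.

Lemma cvg_rnormP (u : nat -> E) l :
  u @ \oo --> l <-> forall e : R, 0 < e ->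
    exists N, forall n, (N <= n)%N -> rnorm (l - u n) < e.
Proof.
split=> [/cvgrPdist_lt ul e e0|ul].
  have [|N _ NP] := ul (of_real k e); first by rewrite -of_real_0 of_real_lt.
  by exists N => n /NP /=; rewrite rnormE of_real_lt.
apply/cvgrPdist_lt => _ /pos_scalarE[e e0 ->].
have [N NP] := ul e e0.
by exists N => // n /= /NP; rewrite rnormE of_real_lt.
Qed.

Lemma closure_rnormP (A : set E) v :
  closure A v <-> forall e : R, 0 < e -> exists2 w, A w & rnorm (v - w) < e.
Proof.
split=> [Av e e0|Av B].
  have [|w [Aw]] := Av (ball v (of_real k e)).
    by apply: nbhsx_ballx; rewrite -of_real_0 of_real_lt.
  by rewrite -ball_normE /= rnormE of_real_lt; exists w.
move=> /nbhs_ballP[_ /= /pos_scalarE[e e0 ->]] eB.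
have [w Aw vw] := Av e e0; exists w; split => //.
by apply: eB; rewrite -ball_normE /= rnormE of_real_lt.
Qed.

End real_norm.

(** * Finite combinations, expansions and closed spans *)

Section linear_combinations.
Context {R : realType} {k : scalar_kind}.
Local Notation K := (scalars R k).
Context {E : normedModType K}.
Implicit Types (x : nat -> E) (a b : nat -> K) (F : pred nat).

Definition lincomb x a n : E := \sum_(i < n) a i *: x i.

Definition restrict_coef F a : nat -> K := fun i => if F i then a i else 0.

Lemma eq_lincomb x a b n : (forall i, (i < n)%N -> a i = b i) ->
  lincomb x a n = lincomb x b n.
Proof. by move=> ab; apply: eq_bigr => i _; rewrite ab. Qed.

Lemma lincomb0 x n : lincomb x (fun=> 0) n = 0.
Proof. by rewrite /lincomb big1// => i _; rewrite scale0r. Qed.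

Lemma lincombP x (c : K) a b n :
  lincomb x (fun i => c * a i + b i) n = c *: lincomb x a n + lincomb x b n.
Proof.
rewrite /lincomb scaler_sumr -big_split/=; apply: eq_bigr => i _.
by rewrite scalerDl scalerA.
Qed.

Lemma lincombB x a b n :
  lincomb x (fun i => a i - b i) n = lincomb x a n - lincomb x b n.
Proof.
rewrite -scaleN1r addrC -lincombP; apply: eq_lincomb => i _.
by rewrite mulN1r addrC.
Qed.

Lemma lincombS x a n : lincomb x a n.+1 = lincomb x a n + a n *: x n.
Proof. by rewrite /lincomb big_ord_recr. Qed.

Lemma lincomb_restrict x a m n : (m <= n)%N ->
  lincomb x (restrict_coef (fun i => (i < m)%N) a) n = lincomb x a m.
Proof.
move=> mn; rewrite /lincomb (big_ord_widen n (fun i => a i *: x i) mn).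
rewrite [RHS]big_mkcond/=; apply: eq_bigr => i _; rewrite /restrict_coef.
by case: ifP => // _; rewrite scale0r.
Qed.

Lemma lincomb_le x a n :
  rnorm (lincomb x a n) <= \sum_(i < n) modulus (a i) * rnorm (x i).
Proof.
by apply: le_trans (rnorm_sum _ _ _) _; rewrite ler_sum// => i _; rewrite rnormZ.
Qed.

Lemma expansionP x a v : expansion x a v <-> forall e : R, 0 < e ->
  exists N, forall n, (N <= n)%N -> rnorm (v - lincomb x a n) < e.
Proof.
rewrite /expansion (_ : series _ = lincomb x a); first exact: cvg_rnormP.
by apply/funext => n; rewrite /series/= big_mkord.
Qed.

Lemma expansion_lincomb x a n :
  expansion x (restrict_coef (fun i => (i < n)%N) a) (lincomb x a n).
Proof.
apply/expansionP => e e0; exists n => m nm.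
by rewrite lincomb_restrict// subrr rnorm0.
Qed.

Lemma expansion0 x : expansion x (fun=> 0) 0.
Proof.
by apply/expansionP => e e0; exists 0%N => n _; rewrite lincomb0 subrr rnorm0.
Qed.

Lemma expansion_linear x (c : K) a b u v : expansion x a u -> expansion x b v ->
  expansion x (fun i => c * a i + b i) (c *: u + v).
Proof.
move=> /expansionP au /expansionP bv; apply/expansionP => e e0.
have c0 : 0 < modulus c + 1 by rewrite ltr_wpDl ?modulus_ge0.
have [N1 P1] := au (e / 2 / (modulus c + 1)) ltac:(by rewrite !divr_gt0).
have [N2 P2] := bv (e / 2) ltac:(by rewrite divr_gt0).
exists (maxn N1 N2) => n; rewrite geq_max => /andP[/P1 h1 /P2 h2].
rewrite lincombP opprD addrACA -scalerBr.
apply: (le_lt_trans (rnormD _ _)); rewrite rnormZ.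
rewrite ltr_pdivlMr// in h1.
by have := rnorm_ge0 (u - lincomb x a n); lra.
Qed.

Lemma closed_spanP x v : closed_span x v <->
  forall e : R, 0 < e -> exists n a, rnorm (v - lincomb x a n) < e.
Proof.
rewrite /closed_span closure_rnormP; split => Xv e /Xv.
  by move=> [_ [n [a ->]] ve]; exists n, a.
by move=> [n [a ve]]; exists (lincomb x a n) => //; exists n, a.
Qed.

Lemma closed_span_lincomb x a n : closed_span x (lincomb x a n).
Proof. by apply/closed_spanP => e e0; exists n, a; rewrite subrr rnorm0. Qed.

Lemma closed_span0 x : closed_span x 0.
Proof. by rewrite -(lincomb0 x 0); exact: closed_span_lincomb. Qed.

Lemma closed_span_expansion x a v : expansion x a v -> closed_span x v.
Proof.
move=> /expansionP av; apply/closed_spanP => e /av[N NP].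
by exists N, a; exact: NP.
Qed.

Lemma closed_span_linear x (c : K) u v :
  closed_span x u -> closed_span x v -> closed_span x (c *: u + v).
Proof.
move=> /closed_spanP Xu /closed_spanP Xv; apply/closed_spanP => e e0.
have c0 : 0 < modulus c + 1 by rewrite ltr_wpDl ?modulus_ge0.
have [n1 [a1 P1]] := Xu (e / 2 / (modulus c + 1)) ltac:(by rewrite !divr_gt0).
have [n2 [a2 P2]] := Xv (e / 2) ltac:(by rewrite divr_gt0).
exists (maxn n1 n2), (fun i => c * restrict_coef (fun i => (i < n1)%N) a1 i +
  restrict_coef (fun i => (i < n2)%N) a2 i).
rewrite lincombP !lincomb_restrict ?leq_maxl ?leq_maxr//.
rewrite opprD addrACA -scalerBr.
apply: (le_lt_trans (rnormD _ _)); rewrite rnormZ.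
rewrite ltr_pdivlMr// in P1.
by have := rnorm_ge0 (u - lincomb x a1 n1); lra.
Qed.

Lemma closed_span_lim x (u : nat -> E) v : (forall n, closed_span x (u n)) ->
  u @ \oo --> v -> closed_span x v.
Proof.
move=> Xu /cvg_rnormP uv; apply/closed_spanP => e e0.
have e2 : 0 < e / 2 by rewrite divr_gt0.
have [N /(_ N (leqnn N)) NP] := uv _ e2.
have /closed_spanP/(_ _ e2)[n [a P]] := Xu N.
exists n, a; apply: le_lt_trans (rdist_triangle (u N) _ _) _.
by rewrite [e]splitr ltrD.
Qed.

(** Completeness, tested on the geometrically fast Cauchy sequences only, for
    which it is proved and to which it is applied. *)
Definition fast_complete : Prop :=
  forall u : nat -> E, (forall n, rnorm (u n.+1 - u n) <= 2^-1 ^+ n) ->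
    exists l : E, u @ \oo --> l.

Lemma fast_completeZ (B : R) (u : nat -> E) : fast_complete ->
  (forall n, rnorm (u n.+1 - u n) <= B * 2^-1 ^+ n) ->
  exists l : E, u @ \oo --> l.
Proof.
move=> cE uB.
have B0 : 0 <= B by have := le_trans (rnorm_ge0 _) (uB 0%N); rewrite expr0 mulr1.
have B1 : 0 < B + 1 by rewrite ltr_wpDl.
pose c : K := of_real k (B + 1).
have mc : modulus c = B + 1 by rewrite modulus_of_real// ltW.
have c0 : c != 0 by apply/eqP => /of_real_eq0 h; rewrite h ltxx in B1.
have mcV : modulus c^-1 = (B + 1)^-1.
  apply: (@mulIf _ (B + 1)); first by rewrite gt_eqF.
  by rewrite mulVf ?gt_eqF// -mc -modulusM mulVf// modulus1.
have [n|l /cvg_rnormP lP] := cE (fun n => c^-1 *: u n).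
  rewrite -scalerBr rnormZ mcV mulrC ler_pdivrMr//.
  apply: (le_trans (uB n)); rewrite mulrC ler_wpM2l ?exprn_ge0//.
  by rewrite lerDl.
exists (c *: l); apply/cvg_rnormP => e e0.
have [N NP] := lP (e / (B + 1)) ltac:(by rewrite divr_gt0).
exists N => n /NP; rewrite ltr_pdivlMr// -mc mulrC -rnormZ scalerBr scalerA.
by rewrite mulfV// scale1r.
Qed.

End linear_combinations.

Arguments fast_complete {R k} E.

(** * Basis constants *)

Section basis_constant.
Context {R : realType} {k : scalar_kind}.
Local Notation K := (scalars R k).
Context {E : normedModType K}.
Implicit Types (x : nat -> E) (a b : nat -> K).

Lemma expansion_unique x a b v : basic_sequence x ->
  expansion x a v -> expansion x b v -> a = b.
Proof.
move=> bx av bv; have [c [_ uc]] := bx v (closed_span_expansion av).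
by rewrite -(uc a av) -(uc b bv).
Qed.

Lemma basic_sequence_neq0 x n : basic_sequence x -> x n != 0.
Proof.
move=> bx; apply/eqP => xn0.
have h c : expansion x (fun i => if i == n then c else 0) (0 : E).
  apply/expansionP => e e0; exists 0%N => m _.
  rewrite /lincomb big1 ?subrr ?rnorm0// => i _.
  by case: eqP => [->|]; rewrite ?xn0 ?scaler0 ?scale0r.
have := expansion_unique bx (h 0) (h 1) => /(congr1 (fun f => f n)).
by rewrite eqxx => /esym/eqP; rewrite oner_eq0.
Qed.

Definition bounded_expansion x (M : R) v : Prop :=
  exists a, expansion x a v /\ forall n, rnorm (lincomb x a n) <= M.

Lemma bounded_expansionZ x M (t : R) v : 0 <= t ->
  bounded_expansion x M v -> bounded_expansion x (t * M) (of_real k t *: v).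
Proof.
move=> t0 [a [av aM]].
exists (fun i => of_real k t * a i + 0); split.
  by rewrite -[_ *: v]addr0; apply: expansion_linear => //; exact: expansion0.
move=> n; rewrite lincombP lincomb0 addr0 rnormZ modulus_of_real//.
exact: ler_wpM2l.
Qed.

Lemma bounded_expansionB x M N u v :
  bounded_expansion x M u -> bounded_expansion x N v ->
  bounded_expansion x (M + N) (u - v).
Proof.
move=> [a [au aM]] [b [bv bN]].
exists (fun i => -1 * b i + a i); split.
  by rewrite addrC -(scaleN1r v); exact: expansion_linear.
move=> n; rewrite lincombP scaleN1r addrC; apply: (le_trans (rnormB _ _)).
exact: lerD.
Qed.

Lemma expansion_bounded x a v : expansion x a v ->
  exists m : nat, bounded_expansion x m%:R v.
Proof.
move=> av; have /expansionP/(_ 1 ltr01)[N NP] := av.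
pose B := \sum_(i < N) modulus (a i) * rnorm (x i) + (1 + rnorm v).
have B0 : 0 <= \sum_(i < N) modulus (a i) * rnorm (x i).
  by apply: sumr_ge0 => i _; rewrite mulr_ge0 ?modulus_ge0 ?rnorm_ge0.
exists (Num.truncn B).+1, a; split => // n.
apply: le_trans (ltW (truncnS_gt _)).
have v0 := rnorm_ge0 v.
have [/NP h|nN] := leqP N n.
  have := rnormB v (v - lincomb x a n).
  rewrite opprB addrC subrK /B; lra.
apply: (le_trans (lincomb_le _ _ _)).
rewrite (big_ord_widen N (fun i => modulus (a i) * rnorm (x i)) (ltnW nN)).
rewrite big_mkcond/=; apply: (@le_trans _ _ (B - (1 + rnorm v))); last by lra.
rewrite /B addrK; apply: ler_sum => i _; case: ifP => // _.
by rewrite mulr_ge0 ?modulus_ge0 ?rnorm_ge0.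
Qed.

(** The Baire category argument: otherwise nested balls, the (m+1)-st one
    staying away from all vectors with an expansion bounded by m, would shrink
    to a vector of the closed span without a bounded expansion. *)
Lemma bounded_expansion_dense_ball x : fast_complete E -> basic_sequence x ->
  exists (M : R) v0 (r : R), 0 < M /\ 0 < r /\ closed_span x v0 /\
    forall v, closed_span x v -> rnorm (v - v0) < r -> forall e : R, 0 < e ->
      exists2 g, bounded_expansion x M g & rnorm (v - g) < e.
Proof.
move=> cE bx; apply: contrapT => noball.
have avoid (s : nat * (E * R)) : exists t : E * R,
    0 < s.2.2 -> closed_span x s.2.1 ->
    [/\ 0 < t.2, closed_span x t.1, rnorm (t.1 - s.2.1) <= s.2.2 / 2,
        t.2 <= s.2.2 / 2 &
        forall g, bounded_expansion x s.1%:R g -> t.2 < rnorm (t.1 - g)].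
  case: s => m [v r] /=; have [r0|r0] := ltP 0 r; last by exists (0, 0).
  have [Xv|nXv] := pselect (closed_span x v); last by exists (0, 0).
  apply: contrapT => nt; apply: noball; exists (m%:R + 1), v, (r / 2).
  rewrite ltr_wpDl// divr_gt0//; do 3!split => //.
  move=> w Xw wv e e0; apply: contrapT => ng; apply: nt.
  (* Half of e, so that no such g lies in the closed ball. *)
  exists (w, Num.min (r / 2) (e / 2)) => _ _.
  split => //=; first by rewrite lt_min !divr_gt0.
  - exact: ltW.
  - by rewrite ge_min lexx.
  move=> g [a [ag am]]; rewrite gt_min; apply/orP; right.
  rewrite ltNge; apply/negP => wg; apply: ng; exists g.
    by exists a; split => // n; apply: le_trans (am n) _; rewrite lerDl.
  by apply: le_lt_trans wg _; rewrite ltr_pdivrMr// ltr_pMr// ltr1n.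
have [f fP] := choice avoid.
pose st := fix st n : E * R := if n is m.+1 then f (m, st m) else (0, 1).
have st_ok n : 0 < (st n).2 /\ closed_span x (st n).1.
  elim: n => [|n [h1 h2]] /=; last by have [] := fP (n, st n) h1 h2.
  by split => //; exact: closed_span0.
have stS n : [/\ rnorm ((st n.+1).1 - (st n).1) <= (st n).2 / 2,
    (st n.+1).2 <= (st n).2 / 2 &
    forall g, bounded_expansion x n%:R g ->
      (st n.+1).2 < rnorm ((st n.+1).1 - g)].
  by have [h1 h2] := st_ok n; have [] := fP (n, st n) h1 h2.
have r2 n : (st n).2 <= 2^-1 ^+ n.
  elim: n => [|n IH]; first by rewrite expr0.
  by have [_ h _] := stS n; apply: (le_trans h); rewrite exprSr ler_wpM2r.
have [|l lP] := cE (fun n => (st n).1).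
  move=> n; have [h _ _] := stS n; apply: (le_trans h).
  by have := r2 n; have [h0 _] := st_ok n; lra.
have Xl : closed_span x l by apply: closed_span_lim lP => n; exact: (st_ok n).2.
have [a [la _]] := bx l Xl.
(* The limit l has an expansion bounded by some m, although it lies in the ball
   that avoids these vectors. *)
have [m [b [lb bm]]] := expansion_bounded la.
have near i : rnorm ((st (i + m.+1)).1 - (st m.+1).1) <=
    (st m.+1).2 - (st (i + m.+1)).2.
  elim: i => [|i IH]; first by rewrite !subrr rnorm0.
  apply: (le_trans (rdist_triangle (st (i + m.+1)).1 _ _)).
  by have [h1 h2 _] := stS (i + m.+1)%N; lra.
have [_ _ /(_ l (ex_intro _ b (conj lb bm)))] := stS m.
apply/negP; rewrite -leNgt; apply/ler_addgt0Pl => e e0.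
move/cvg_rnormP : lP => /(_ e e0)[N NP].
have := NP (N + m.+1)%N (leq_addr _ _) => h1.
have h2 := near N; have [h3 _] := st_ok (N + m.+1)%N.
rewrite rdistC; apply: (le_trans (rdist_triangle (st (N + m.+1)).1 _ _)).
lra.
Qed.

(** The successive approximations of the open mapping theorem: a vector that is
    approximated, at every scale, by vectors with bounded expansions is the sum
    of a rapidly convergent series of such vectors, and adding up their
    coefficients gives a bounded expansion of it. *)
Lemma bounded_expansion_of_dense x (M r : R) : fast_complete E ->
  (forall n, x n != 0) -> 0 < M -> 0 < r ->
  (forall (t : R) v, 0 < t -> closed_span x v -> rnorm v < r * t ->
    forall e : R, 0 < e ->
      exists2 g, bounded_expansion x (M * t) g & rnorm (v - g) < e) ->
  forall v, closed_span x v -> rnorm v < r -> bounded_expansion x (2 * M) v.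
Proof.
move=> cE xN0 M0 r0 dense v Xv vr.
have p0 n : 0 < 2^-1 ^+ n :> R by rewrite exprn_gt0.
have step (s : nat * E) : exists ga : E * (nat -> K),
    closed_span x s.2 -> rnorm s.2 < r * 2^-1 ^+ s.1 ->
    [/\ expansion x ga.2 ga.1,
        forall n, rnorm (lincomb x ga.2 n) <= M * 2^-1 ^+ s.1 &
        rnorm (s.2 - ga.1) < r * 2^-1 ^+ s.1.+1].
  case: s => j u /=; have [Xu|] := pselect (closed_span x u); last first.
    by exists (0, fun=> 0).
  have [ur|] := ltP (rnorm u) (r * 2^-1 ^+ j); last by exists (0, fun=> 0).
  have [g [a [ag aM]] ug] := dense _ _ (p0 j) Xu ur _ (mulr_gt0 r0 (p0 j.+1)).
  by exists (g, a).
have [f fP] := choice step.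
pose u := fix u n : E := if n is m.+1 then u m - (f (m, u m)).1 else v.
pose g n := (f (n, u n)).1.
pose b n := (f (n, u n)).2.
have u_ok n : closed_span x (u n) /\ rnorm (u n) < r * 2^-1 ^+ n.
  elim: n => [|n [h1 h2]]; first by rewrite expr0 mulr1.
  have [h3 h4 h5] := fP (n, u n) h1 h2; split => //=.
  rewrite addrC -scaleN1r; apply: closed_span_linear => //.
  exact: closed_span_expansion h3.
have gb n : [/\ expansion x (b n) (g n),
    forall i, rnorm (lincomb x (b n) i) <= M * 2^-1 ^+ n &
    rnorm (u n - g n) < r * 2^-1 ^+ n.+1].
  by have [h1 h2] := u_ok n; exact: (fP (n, u n)).
pose A := fix A n : nat -> K := if n is m.+1 then
  (fun i => 1 * A m i + b m i) else (fun=> 0).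
have Aexp n : expansion x (A n) (v - u n).
  elim: n => [|n IH]; rewrite /= ?subrr.
    exact: expansion0.
  rewrite opprB addrCA addrC -[v - u n]scale1r.
  by have [h _ _] := gb n; exact: expansion_linear.
(* The i-th coefficient of the n-th summand is a difference of two partial sums,
   each at most M / 2^n. *)
have coef i : exists l, forall n,
    modulus (l - A n i) <= 4 * (2 * M / rnorm (x i)) * 2^-1 ^+ n.
  apply: (@scalar_fast_cauchy _ _ (fun n => A n i)) => n /=.
  rewrite mul1r addrC addKr.
  rewrite mulrAC ler_pdivlMr ?rnorm_gt0// -rnormZ.
  have -> : b n i *: x i = lincomb x (b n) i.+1 - lincomb x (b n) i.
    by rewrite lincombS addrC addKr.
  apply: (le_trans (rnormB _ _)).
  by have [_ h _] := gb n; have := h i; have := h i.+1; lra.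
have [a aP] := choice coef.
have AB n j i : rnorm (lincomb x (A (j + n)%N) i - lincomb x (A n) i) <=
    2 * M * 2^-1 ^+ n - 2 * M * 2^-1 ^+ (j + n)%N.
  elim: j => [|j IH]; first by rewrite add0n !subrr rnorm0.
  rewrite addSn /= lincombP scale1r addrAC.
  apply: (le_trans (rnormD _ _)); rewrite exprS.
  by have [_ h _] := gb (j + n)%N; have := h i; lra.
have close n i : rnorm (lincomb x a i - lincomb x (A n) i) <= 2 * M * 2^-1 ^+ n.
  apply/ler_addgt0Pr => e e0.
  pose D := \sum_(j < i) 4 * (2 * M / rnorm (x j)) * rnorm (x j).
  have D0 : 0 <= D.
    by apply: sumr_ge0 => j _; rewrite !mulr_ge0 ?invr_ge0 ?rnorm_ge0// ltW.
  have [j je] : exists j, D * 2^-1 ^+ j < e.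
    have D1 : 0 < e / (D + 1) by rewrite divr_gt0// ltr_wpDl.
    have [j _ jP] := near_infty_natSinv_expn_lt (PosNum D1).
    exists j; have /= := jP j (leqnn j).
    rewrite ltr_pdivlMr ?ltr_wpDl// mul1r -exprVn => h.
    by apply: le_lt_trans h; rewrite mulrC ler_wpM2l ?lerDl// ltW.
  apply: (le_trans (rdist_triangle (lincomb x (A (j + n)%N) i) _ _)).
  have h1 := AB n j i; have h3 := mulr_gt0 M0 (p0 (j + n)%N).
  suff h2 : rnorm (lincomb x a i - lincomb x (A (j + n)%N) i) <= D * 2^-1 ^+ j.
    by rewrite -!mulrA in h1 *; lra.
  rewrite -lincombB; apply: (le_trans (lincomb_le _ _ _)).
  rewrite /D mulr_suml; apply: ler_sum => m _.
  rewrite [leRHS]mulrAC ler_wpM2r ?rnorm_ge0//; apply: (le_trans (aP m _)).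
  rewrite ler_wpM2l ?exprD ?ler_piMr// ?(ltW (p0 _))//.
    by rewrite !mulr_ge0 ?invr_ge0 ?rnorm_ge0// ltW.
  by rewrite exprn_ile1// invf_le1// ler1n.
exists a; split; last first.
  by move=> n; have := close 0%N n; rewrite lincomb0 subr0 expr0 mulr1.
apply/expansionP => e e0.
have e3 : 0 < e / 3 by rewrite divr_gt0.
have [n ne] : exists n, (2 * M + r) * 2^-1 ^+ n < e / 3.
  have D0 : 0 < 2 * M + r by rewrite addr_gt0// mulr_gt0.
  have D1 : 0 < (e / 3) / (2 * M + r) by rewrite divr_gt0.
  have [j _ jP] := near_infty_natSinv_expn_lt (PosNum D1).
  exists j; have /= := jP j (leqnn j).
  by rewrite mul1r -exprVn ltr_pdivlMr// mulrC.
have /expansionP/(_ _ e3)[N NP] := Aexp n.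
exists N => i /NP h1; have h2 := close n i; have [_ h3] := u_ok n.
have := mulr_gt0 M0 (p0 n); have := mulr_gt0 r0 (p0 n).
rewrite mulrDl in ne => h4 h5.
apply: (le_lt_trans (rdist_triangle (v - u n) _ _)).
have -> : v - (v - u n) = u n by rewrite opprB addrC subrK.
have := rdist_triangle (lincomb x (A n) i) (v - u n) (lincomb x a i).
rewrite (rdistC (lincomb x (A n) i)) => h6.
by rewrite -!mulrA in ne h2 *; lra.
Qed.

(** The set of vectors with a bounded expansion is closed under differences and
    scaling, so density in one ball gives density in all balls around 0; then
    every vector of norm less than r has an expansion with a common bound, and
    this expansion is the only one. *)
Lemma basis_constant x : fast_complete E -> basic_sequence x ->
  exists2 M : R, 0 < M & forall a m n, (m <= n)%N ->
    rnorm (lincomb x a m) <= M * rnorm (lincomb x a n).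
Proof.
move=> cE bx.
have [M [v0 [r [M0 [r0 [Xv0 dense]]]]]] := bounded_expansion_dense_ball cE bx.
have bounded : forall v, closed_span x v -> rnorm v < r ->
    bounded_expansion x (2 * (2 * M)) v.
  apply: bounded_expansion_of_dense => //.
  - by move=> n; exact: basic_sequence_neq0.
  - by rewrite mulr_gt0.
  move=> t v t0 Xv vrt e e0.
  have tN0 : of_real k t != 0.
    by apply/eqP => /of_real_eq0 h; rewrite h ltxx in t0.
  have tV : of_real k t * of_real k t^-1 = 1.
    by rewrite -of_realM mulfV ?of_real1// gt_eqF.
  pose w := of_real k t^-1 *: v.
  have tw : of_real k t *: w = v by rewrite scalerA tV scale1r.
  have wr : rnorm w < r.
    rewrite rnormZ modulus_of_real ?invr_ge0 ?ltW//.
    by rewrite mulrC ltr_pdivrMr.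
  have e2 : 0 < e / t / 2 by rewrite !divr_gt0.
  (* w is the difference of two points of the ball around v0. *)
  have Xw : closed_span x (v0 + w).
    rewrite addrC; apply: closed_span_linear => //.
  have [|g1 G1 h1] := dense (v0 + w) Xw _ _ e2; first by rewrite addrC addKr.
  have [|g2 G2 h2] := dense v0 Xv0 _ _ e2; first by rewrite subrr rnorm0.
  exists (of_real k t *: (g1 - g2)).
    have -> : 2 * M * t = t * (M + M) by lra.
    by apply: bounded_expansionZ; [exact: ltW|exact: bounded_expansionB].
  rewrite -tw -scalerBr rnormZ modulus_of_real ?ltW//.
  rewrite mulrC -ltr_pdivlMr//.
  have -> : w - (g1 - g2) = (v0 + w - g1) - (v0 - g2).
    rewrite (addrC v0) !opprB [w + v0 - g1]addrAC addrACA subrr addr0.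
    by rewrite addrA addrAC.
  by apply: (le_lt_trans (rnormB _ _)); lra.
exists (4 * M / r); first by rewrite divr_gt0// mulr_gt0.
move=> a m n mn; apply/ler_addgt0Pr => e e0.
(* v is scaled to have norm less than r; the term d is added because v may
   vanish. *)
pose v := lincomb x a n.
pose d := e / (4 * M / r).
have c0 : 0 < 4 * M / r by rewrite divr_gt0// mulr_gt0.
have d0 : 0 < d by rewrite divr_gt0.
have v0d : 0 < rnorm v + d by rewrite ltr_wpDl ?rnorm_ge0.
pose t := r / (rnorm v + d).
have t0 : 0 < t by rewrite divr_gt0.
have [||c [cv cM]] := bounded (of_real k t *: v).
- by rewrite -[_ *: v]addr0; apply: closed_span_linear;
    [exact: closed_span_lincomb|exact: closed_span0].
- rewrite rnormZ modulus_of_real ?ltW// /t mulrAC ltr_pdivrMr//.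
  by rewrite ltr_pM2l// ltrDl.
have := expansion_linear (c := of_real k t) (@expansion_lincomb _ _ _ x a n)
  (@expansion0 _ _ _ x).
rewrite addr0 => tv; have ct := expansion_unique bx cv tv.
have := cM m; rewrite ct lincombP lincomb0 addr0 rnormZ.
rewrite modulus_of_real; last exact: ltW.
rewrite (_ : lincomb x (restrict_coef _ a) m = lincomb x a m); last first.
  by apply: eq_lincomb => i im; rewrite /restrict_coef (leq_trans im mn).
have -> : 4 * M / r * rnorm v + e = 4 * M / r * (rnorm v + d).
  by rewrite mulrDr (mulrC _ d) /d divfK// gt_eqF.
rewrite /t => h; rewrite (_ : _ * (_ + d) = 2 * (2 * M) / (r / (rnorm v + d))).
  by rewrite ler_pdivlMr// mulrC.
by field; rewrite !gt_eqF.
Qed.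

End basis_constant.

(** * Unconditional constants *)

Section block_permutation.
Local Open Scope nat_scope.

Let blk (N : nat -> nat) k := index_iota (N k) (N k.+1).

(** In a series rearranged by this permutation, the sum over a prescribed subset
    of a block is the difference of two partial sums. *)
Lemma block_permutation (N : nat -> nat) (F : nat -> pred nat) :
  N 0 = 0 -> (forall k, N k < N k.+1) ->
  exists2 s : nat -> nat, bijective s & forall k,
    [seq s i | i <- index_iota (N k) (N k.+1)] =
    [seq i <- index_iota (N k) (N k.+1) | F k i] ++
    [seq i <- index_iota (N k) (N k.+1) | ~~ F k i].
Proof.
move=> N0 NS.
pose l k := [seq i <- blk N k | F k i] ++ [seq i <- blk N k | ~~ F k i].
have lP k : perm_eq (l k) (blk N k) by rewrite /l perm_filterC.
have ls k : size (l k) = N k.+1 - N k by rewrite (perm_size (lP k)) size_iota.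
have lu k : uniq (l k) by rewrite (perm_uniq (lP k)) iota_uniq.
have lm k i : (i \in l k) = (N k <= i < N k.+1).
  by rewrite (perm_mem (lP k)) mem_index_iota.
have Nmono : {homo N : i j / i <= j}.
  by apply: homo_leq => // [? ? ?|i]; [exact: leq_trans|exact: ltnW].
have Nge i : i <= N i by elim: i => // i IH; exact: leq_ltn_trans IH (NS i).
have bex i : exists k, N k <= i < N k.+1.
  elim: i => [|i [k /andP[h1 h2]]].
    by exists 0; have := NS 0; rewrite N0.
  move: h2; rewrite leq_eqVlt => /orP[/eqP h2|h2].
    by exists k.+1; rewrite h2 leqnn NS.
  by exists k; rewrite h2 andbT (leq_trans h1).
have [b bP] := choice bex.
have b_uniq i k : N k <= i < N k.+1 -> b i = k.
  move=> /andP[h1 h2]; have /andP[h3 h4] := bP i; apply/eqP.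
  rewrite eqn_leq; apply/andP; split; rewrite leqNgt; apply/negP => /Nmono h.
    by have := leq_trans h2 (leq_trans h h3); rewrite ltnn.
  by have := leq_trans h4 (leq_trans h h1); rewrite ltnn.
pose s i := nth 0 (l (b i)) (i - N (b i)).
pose t i := N (b i) + index i (l (b i)).
have s_blk i k : N k <= i < N k.+1 -> s i = nth 0 (l k) (i - N k).
  by move=> /b_uniq <-.
have t_blk i k : N k <= i < N k.+1 -> t i = N k + index i (l k).
  by move=> /b_uniq <-.
have s_in i k : N k <= i < N k.+1 -> N k <= s i < N k.+1.
  move=> h; rewrite (s_blk _ _ h) -lm mem_nth// ls.
  by case/andP: h => h1 h2; rewrite ltn_sub2r// (leq_ltn_trans h1).
have t_in i k : N k <= i < N k.+1 -> N k <= t i < N k.+1.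
  move=> h; rewrite (t_blk _ _ h) leq_addr/=.
  by move: h; rewrite -lm -index_mem ls -ltn_subRL.
exists s.
  exists t => i; have h := bP i.
    rewrite (t_blk _ _ (s_in _ _ h)) (s_blk _ _ h) index_uniq//.
      by rewrite subnKC//; case/andP: h.
    by case/andP: h => h1 h2; rewrite ls ltn_sub2r// (leq_ltn_trans h1).
  rewrite (s_blk _ _ (t_in _ _ h)) (t_blk _ _ h) addKn nth_index//.
  by rewrite lm.
move=> k; rewrite -/(blk N k) -/(l k); apply: (@eq_from_nth _ 0).
  by rewrite size_map size_iota ls.
move=> i; rewrite size_map size_iota => iN.
rewrite (nth_map 0) ?size_iota// nth_iota// (s_blk _ k) ?addKn//.
by rewrite leq_addr/= -ltn_subRL.
Qed.

End block_permutation.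

Section unconditional_constant.
Context {R : realType} {k : scalar_kind}.
Local Notation K := (scalars R k).
Context {E : normedModType K}.
Implicit Types (x : nat -> E) (a b : nat -> K) (F : pred nat).

Lemma unconditional_basic x : unconditional x -> basic_sequence x.
Proof. by move=> ux; apply: (ux id); exists id. Qed.

Lemma coefficient_bound x (M : R) :
  (forall a m n, (m <= n)%N ->
    rnorm (lincomb x a m) <= M * rnorm (lincomb x a n)) ->
  forall a i n, (i < n)%N ->
    modulus (a i) * rnorm (x i) <= 2 * M * rnorm (lincomb x a n).
Proof.
move=> xM a i n im; rewrite -rnormZ.
have -> : a i *: x i = lincomb x a i.+1 - lincomb x a i.
  by rewrite lincombS addrC addKr.
apply: (le_trans (rnormB _ _)).
by have := xM a _ _ im; have := xM a _ _ (ltnW im); lra.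
Qed.

Lemma index_iota_cat n m p : (m <= n)%N -> (n <= p)%N ->
  index_iota m n ++ index_iota n p = index_iota m p.
Proof.
move=> mn np; rewrite /index_iota (_ : (p - m = (n - m) + (p - n))%N).
  by rewrite iotaD subnKC.
lia.
Qed.

Definition unconditional_bound x (U : R) : Prop := forall F a n,
  rnorm (lincomb x (restrict_coef F a) n) <= U * rnorm (lincomb x a n).

Lemma lincomb_big_nat x a n : lincomb x a n = \sum_(0 <= i < n) a i *: x i.
Proof. by rewrite /lincomb big_mkord. Qed.

(** The coefficients before index m are controlled by the basis constant, so
    that an unconditional bound need only hold far out. *)
Lemma unconditional_bound_of_tail x (M U : R) (m : nat) : 0 < M -> 0 <= U ->
  (forall a j n, (j <= n)%N ->
    rnorm (lincomb x a j) <= M * rnorm (lincomb x a n)) ->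
  (forall F a n, (m < n)%N -> (forall i, (i < m)%N -> a i = 0) ->
    rnorm (lincomb x (restrict_coef F a) n) <= U * rnorm (lincomb x a n)) ->
  unconditional_bound x (2 * M * m%:R + U * (1 + M)).
Proof.
move=> M0 U0 xM tail F a n; set L := rnorm (lincomb x a n).
have L0 : 0 <= L := rnorm_ge0 _.
pose c := restrict_coef (fun i => (i < n)%N) a.
pose c1 := restrict_coef (fun i => (i < m)%N) c.
pose c2 i := c i - c1 i.
have c2E i : c2 i = if (i < m)%N then 0 else c i.
  by rewrite /c2 /c1 /restrict_coef; case: ifP; rewrite ?subrr ?subr0.
have nm : (n <= n + m.+1)%N by rewrite leq_addr.
have cE : lincomb x c (n + m.+1) = lincomb x a n by rewrite lincomb_restrict.
have c1M : forall i, (i < m)%N -> modulus (c i) * rnorm (x i) <= 2 * M * L.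
  move=> i im; rewrite /L -cE; apply: coefficient_bound => //.
  by rewrite ltn_addl// ltnS ltnW.
have FE : lincomb x (restrict_coef F a) n =
    lincomb x (restrict_coef F c) m + lincomb x (restrict_coef F c2) (n + m.+1).
  have -> : lincomb x (restrict_coef F c) m =
      lincomb x (restrict_coef F c1) (n + m.+1).
    rewrite -(@lincomb_restrict _ _ _ _ _ m (n + m.+1)); last first.
      by rewrite (leq_trans (leqnSn m)) ?leq_addl.
    apply: eq_lincomb => i _; rewrite /c1 /restrict_coef.
    by case: (F i); case: ifP.
  rewrite -(@lincomb_restrict _ _ _ _ _ n (n + m.+1))//.
  rewrite -[lincomb x (restrict_coef F c1) _]scale1r -lincombP.
  apply: eq_lincomb => i _; rewrite mul1r [restrict_coef F c2 i]/restrict_coef.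
  rewrite c2E /c1 /c /restrict_coef.
  by case: (F i); case: (i < m)%N; case: (i < n)%N; rewrite ?addr0 ?add0r.
rewrite FE mulrDl; apply: (le_trans (rnormD _ _)); apply: lerD.
  apply: (le_trans (lincomb_le _ _ _)).
  apply: (@le_trans _ _ (\sum_(i < m) 2 * M * L)).
    apply: ler_sum => i _; rewrite /restrict_coef; case: ifP => _; last first.
      by rewrite modulus0 mul0r !mulr_ge0// ltW.
    exact: c1M.
  by rewrite sumr_const card_ord -mulr_natr; lra.
apply: (le_trans (tail _ _ _ _ _)) => [|i im|].
- by rewrite ltn_addl.
- by rewrite c2E im.
rewrite -mulrA ler_wpM2l// /c2 lincombB cE.
apply: (le_trans (rnormB _ _)); rewrite mulrDl mul1r lerD//.
rewrite /c1 lincomb_restrict; last by rewrite (leq_trans (leqnSn m)) ?leq_addl.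
by rewrite -/L /L -cE; apply: xM; rewrite (leq_trans (leqnSn m)) ?leq_addl.
Qed.

(** If no bound held, finite combinations of consecutive blocks with larger and
    larger gain could be found, and the permutation that lists in each block
    the badly behaved indices first would turn x into a basic sequence without
    basis constant. *)
Lemma unconditional_constant x : fast_complete E -> unconditional x ->
  exists2 U : R, 0 < U & unconditional_bound x U.
Proof.
move=> cE ux.
have [M M0 xM] := basis_constant cE (unconditional_basic ux).
apply: contrapT => noU.
have bad (mk : nat * nat) : exists nFa : nat * (pred nat * (nat -> K)),
    [/\ (mk.1 < nFa.1)%N, forall i, (i < mk.1)%N -> nFa.2.2 i = 0 &
      mk.2%:R * rnorm (lincomb x nFa.2.2 nFa.1) <
      rnorm (lincomb x (restrict_coef nFa.2.1 nFa.2.2) nFa.1)].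
  case: mk => m j /=; apply: contrapT => good; apply: noU.
  exists (2 * M * m%:R + (j%:R + 1) * (1 + M)).
    have j1 : 0 < j%:R + 1 :> R by rewrite ltr_wpDl.
    have M1 : 0 < 1 + M by lra.
    by rewrite ltr_wpDl ?mulr_gt0// !mulr_ge0// ltW.
  apply: unconditional_bound_of_tail => // F a n mn a0.
  rewrite leNgt; apply/negP => h; apply: good; exists (n, (F, a)); split => //=.
  by apply: le_lt_trans h; rewrite ler_wpM2r ?rnorm_ge0// lerDl.
have [f fP] := choice bad.
pose N := fix N i : nat := if i is j.+1 then (f (N j, j)).1 else 0%N.
have NS i : (N i < N i.+1)%N by have [] := fP (N i, i).
have [s bs sP] := @block_permutation N (fun i => (f (N i, i)).2.1) erefl NS.
have [Ms Ms0 xs] := basis_constant cE (ux s bs).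
(* In block j the gain exceeds the basis constant of the rearranged sequence. *)
pose j := (Num.truncn Ms).+1.
have Mj : Ms < j%:R by exact: truncnS_gt.
have [_ a0] := fP (N j, j); rewrite /= -/(N j.+1).
move: a0 => /=; set a := (f (N j, j)).2.2; set F := (f (N j, j)).2.1 => a0.
apply/negP; rewrite -leNgt.
have map0 i : [seq s i | i <- index_iota 0 (N i)] =i index_iota 0 (N i).
  elim: i => [//|i IH] y.
  rewrite -(@index_iota_cat (N i))// ?(ltnW (NS i))// map_cat !mem_cat IH sP.
  by congr (_ || _); rewrite mem_cat !mem_filter -andb_orl orbN.
have s0 i : (i < N j)%N -> (s i < N j)%N.
  move=> ij; have := map0 j (s i); rewrite mem_index_iota => /= <-.
  by apply: map_f; rewrite mem_index_iota.
pose p := size [seq i <- index_iota (N j) (N j.+1) | F i].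
have pN : (N j + p <= N j.+1)%N.
  rewrite -leq_subRL ?(ltnW (NS j))// /p size_filter.
  by apply: (leq_trans (count_size _ _)); rewrite size_iota.
have blockE (G : nat -> K) : \sum_(N j <= i < N j.+1) G (s i) *: x (s i) =
    \sum_(N j <= i < N j.+1) G i *: x i.
  rewrite -(big_map s xpredT (fun i => G i *: x i)) sP.
  by apply: perm_big; rewrite perm_filterC.
have headE : \sum_(N j <= i < (N j + p)%N) a (s i) *: x (s i) =
    \sum_(N j <= i < N j.+1) restrict_coef F a i *: x i.
  rewrite -(big_map s xpredT (fun i => a i *: x i)).
  have -> : [seq s i | i <- index_iota (N j) (N j + p)] =
      [seq i <- index_iota (N j) (N j.+1) | F i].
    have := sP j; rewrite -{1}(@index_iota_cat (N j + p)%N) ?leq_addr//.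
    rewrite map_cat => /(congr1 (take p)).
    rewrite take_size_cat; last by rewrite size_map size_iota addKn.
    by rewrite take_size_cat.
  rewrite big_filter big_mkcond/=; apply: eq_bigr => i _.
  by rewrite /restrict_coef; case: ifP => // _; rewrite scale0r.
have split0 (G : nat -> K) (y : nat -> E) n : (N j <= n)%N ->
    (forall i, (i < N j)%N -> G i = 0) ->
    lincomb y G n = \sum_(N j <= i < n) G i *: y i.
  move=> jn G0; rewrite lincomb_big_nat (@big_cat_nat _ _ _ (N j))//=.
  rewrite big_nat big1 ?add0r// => i /andP[_ iN].
  by rewrite G0// scale0r.
have := xs (a \o s) _ _ pN.
have as0 i : (i < N j)%N -> (a \o s) i = 0 by move=> ij /=; rewrite a0// s0.
rewrite !split0 ?leq_addr ?(ltnW (NS j))//=; last first.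
  by move=> i ij; rewrite /restrict_coef a0// if_same.
rewrite headE blockE => h; apply: (le_trans h).
by rewrite ler_wpM2r ?rnorm_ge0// ltW.
Qed.

(** A combination with changed signs is the original one minus twice its part
    over the indices of negative sign. *)
Lemma sign_change_bound x (U : R) : unconditional_bound x U ->
  forall (e : nat -> bool) a n,
    rnorm (lincomb x (fun i => (-1) ^+ e i * a i) n) <=
      (1 + 2 * U) * rnorm (lincomb x a n).
Proof.
move=> xU e a n.
have -> : lincomb x (fun i => (-1) ^+ e i * a i) n =
    (- 2) *: lincomb x (restrict_coef e a) n + lincomb x a n.
  rewrite -lincombP; apply: eq_lincomb => i _; rewrite /restrict_coef.
  by case: (e i); rewrite ?expr1 ?expr0; ring.
apply: (le_trans (rnormD _ _)); rewrite rnormZ modulusN.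
have -> : modulus (2 : K) = 2.
  by rewrite -[2]/(1 + 1 : K) -of_real1 -of_realD modulus_of_real.
by have := xU e a n; lra.
Qed.

End unconditional_constant.

(** * Equivalence of sequences, small perturbations, type 2 *)

Section equivalence.
Context {R : realType} {k : scalar_kind}.
Local Notation K := (scalars R k).

Definition dominated {E G : normedModType K} (x : nat -> E) (y : nat -> G)
    (C : R) : Prop :=
  forall a n, rnorm (lincomb y a n) <= C * rnorm (lincomb x a n).

(** The closure of the graph of the map that sends each finite combination of x
    to the one of y with the same coefficients. *)
Definition graph_closure {E G : normedModType K} (x : nat -> E) (y : nat -> G)
    (v : E) (w : G) : Prop :=
  forall e : R, 0 < e -> exists n a,
    rnorm (v - lincomb x a n) < e /\ rnorm (w - lincomb y a n) < e.

Section graph.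
Context {E G : normedModType K}.
Implicit Types (x : nat -> E) (y : nat -> G).

Lemma graph_closure_sym x y v w : graph_closure x y v w -> graph_closure y x w v.
Proof. by move=> vw e /vw[n [a []]]; exists n, a. Qed.

Lemma graph_closure_span x y v w : graph_closure x y v w -> closed_span x v.
Proof. by move=> vw; apply/closed_spanP => e /vw[n [a []]]; exists n, a. Qed.

Lemma graph_closure_lincomb x y a n :
  graph_closure x y (lincomb x a n) (lincomb y a n).
Proof. by move=> e e0; exists n, a; rewrite !subrr !rnorm0. Qed.

Lemma graph_closure_linear x y (c : K) v w v' w' :
  graph_closure x y v w -> graph_closure x y v' w' ->
  graph_closure x y (c *: v + v') (c *: w + w').
Proof.
move=> vw vw' e e0.
have c0 : 0 < modulus c + 1 by rewrite ltr_wpDl ?modulus_ge0.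
have [n1 [a1 [p1 q1]]] := vw (e / 2 / (modulus c + 1))
  ltac:(by rewrite !divr_gt0).
have [n2 [a2 [p2 q2]]] := vw' (e / 2) ltac:(by rewrite divr_gt0).
exists (maxn n1 n2), (fun i => c * restrict_coef (fun i => (i < n1)%N) a1 i +
  restrict_coef (fun i => (i < n2)%N) a2 i).
rewrite !lincombP !lincomb_restrict ?leq_maxl ?leq_maxr//.
rewrite ltr_pdivlMr// in p1; rewrite ltr_pdivlMr// in q1.
split; rewrite opprD addrACA -scalerBr; apply: (le_lt_trans (rnormD _ _)).
  by rewrite rnormZ; have := rnorm_ge0 (v - lincomb x a1 n1); lra.
by rewrite rnormZ; have := rnorm_ge0 (w - lincomb y a1 n1); lra.
Qed.

Lemma graph_closure_le x y C v w : 0 < C -> dominated x y C ->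
  graph_closure x y v w -> rnorm w <= C * rnorm v.
Proof.
move=> C0 xyC vw; apply/ler_addgt0Pr => e e0.
have [n [a [p q]]] := vw (e / (1 + C)) ltac:(by rewrite divr_gt0// ltr_wpDl).
set d := e / (1 + C) in p q.
have -> : e = d + C * d by rewrite /d; field; rewrite gt_eqF// ltr_wpDl.
have h1 : rnorm w <= rnorm (w - lincomb y a n) + rnorm (lincomb y a n).
  by have := rnormD (w - lincomb y a n) (lincomb y a n); rewrite subrK.
have h2 : rnorm (lincomb x a n) <= rnorm v + d.
  have := rnormB v (v - lincomb x a n); rewrite opprB addrC subrK; lra.
have h3 : C * rnorm (lincomb x a n) <= C * (rnorm v + d) by rewrite ler_pM2l.
by have := xyC a n; lra.
Qed.

(** Finite combinations of x that converge fast to v have images that form a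
    Cauchy sequence. *)
Lemma graph_closure_total x y C v : fast_complete G -> 0 < C ->
  dominated x y C -> closed_span x v -> exists w, graph_closure x y v w.
Proof.
move=> cG C0 xyC /closed_spanP Xv.
have p0 n : 0 < 2^-1 ^+ n :> R by rewrite exprn_gt0.
have ex_na i : exists na : nat * (nat -> K),
    rnorm (v - lincomb x na.2 na.1) < 2^-1 ^+ i.
  by have [n [a h]] := Xv _ (p0 i); exists (n, a).
have [na naP] := choice ex_na.
pose u i := lincomb y (na i).2 (na i).1.
pose t i := lincomb x (na i).2 (na i).1.
have ut i j : rnorm (u i - u j) <= C * rnorm (t i - t j).
  pose N := maxn (na i).1 (na j).1.
  have E1 (F : normedModType K) (z : nat -> F) := @lincomb_restrict _ _ _ z
    (na i).2 _ N (leq_maxl _ _).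
  have E2 (F : normedModType K) (z : nat -> F) := @lincomb_restrict _ _ _ z
    (na j).2 _ N (leq_maxr _ _).
  by rewrite /u /t -!E1 -!E2 -!lincombB.
have [n|w wP] := @fast_completeZ _ _ _ (2 * C) u cG.
  apply: (le_trans (ut _ _)); rewrite -[leRHS]mulrA [leRHS]mulrCA ler_pM2l//.
  apply: (le_trans (rdist_triangle v _ _)); rewrite (rdistC (t _) v).
  have := naP n; have := naP n.+1; rewrite -/(t n) -/(t n.+1) exprS.
  by have := p0 n; lra.
exists w => e e0.
have [N1 P1] := (cvg_rnormP _ _).1 wP e e0.
have [N2 _ P2] := near_infty_natSinv_expn_lt (PosNum e0).
pose N := maxn N1 N2; exists (na N).1, (na N).2; split.
  apply: lt_trans (naP N) _.
  by have := P2 N (leq_maxr _ _); rewrite /= mul1r -exprVn.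
exact: P1 (leq_maxl _ _).
Qed.

Lemma graph_closure_unique x y C v w w' : 0 < C -> dominated x y C ->
  graph_closure x y v w -> graph_closure x y v w' -> w = w'.
Proof.
move=> C0 xyC vw vw'.
have := graph_closure_linear (-1) vw vw'.
rewrite !scaleN1r addNr => /(graph_closure_le C0 xyC); rewrite rnorm0 mulr0.
move=> h; have /rnorm0_eq0/eqP : rnorm (- w + w') = 0.
  by apply/eqP; rewrite eq_le h rnorm_ge0.
by rewrite addrC subr_eq0 => /eqP.
Qed.

Lemma lipschitz_within (A : set E) (S : E -> G) (C : R) : 0 < C ->
  (forall u v, A u -> A v -> rnorm (S u - S v) <= C * rnorm (u - v)) ->
  {within A, continuous S}.
Proof.
move=> C0 SC; apply/subspace_continuousP => u Au.
apply/cvgrPdist_lt => _ /pos_scalarE[e e0 ->].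
have : nbhs u (ball u (of_real k (e / C))).
  by apply: nbhsx_ballx; rewrite -of_real_0 of_real_lt divr_gt0.
rewrite /within/=; apply: filterS => v uv Av.
rewrite rnormE of_real_lt; apply: (le_lt_trans (SC _ _ Au Av)).
by move: uv; rewrite -ball_normE /= rnormE of_real_lt ltr_pdivlMr// mulrC.
Qed.

End graph.

(** A linear map given by bounded finite sums extends to the closed span, its
    graph being the closure of the graph on finite combinations; the relation
    is symmetric in the two sequences, which yields the inverse map. *)
Lemma equivalent_of_dominated {E G : normedModType K} (x : nat -> E)
    (y : nat -> G) (C : R) : fast_complete E -> fast_complete G -> 0 < C ->
  dominated x y C -> dominated y x C -> equivalent_sequences x y.
Proof.
move=> cE cG C0 xy yx.
pose S v := xget 0 [set w | graph_closure x y v w].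
pose S' w := xget 0 [set v | graph_closure y x w v].
have SP v : closed_span x v -> graph_closure x y v (S v).
  by move=> Xv; have [w vw] := graph_closure_total cG C0 xy Xv; exact: xgetI vw.
have S'P w : closed_span y w -> graph_closure y x w (S' w).
  by move=> Yw; have [v wv] := graph_closure_total cE C0 yx Yw; exact: xgetI wv.
have SY v : closed_span x v -> closed_span y (S v).
  by move=> /SP/graph_closure_sym/graph_closure_span.
have S'X w : closed_span y w -> closed_span x (S' w).
  by move=> /S'P/graph_closure_sym/graph_closure_span.
have lin (c : K) u v : closed_span x u -> closed_span x v ->
    S (c *: u + v) = c *: S u + S v.
  move=> Xu Xv; apply: (graph_closure_unique C0 xy (SP _ _)).
    exact: closed_span_linear.
  by apply: graph_closure_linear; exact: SP.
have lin' (c : K) u v : closed_span y u -> closed_span y v ->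
    S' (c *: u + v) = c *: S' u + S' v.
  move=> Xu Xv; apply: (graph_closure_unique C0 yx (S'P _ _)).
    exact: closed_span_linear.
  by apply: graph_closure_linear; exact: S'P.
have subE (F : normedModType K) (a b : F) : a - b = -1 *: b + a.
  by rewrite scaleN1r addrC.
exists S, S'; do 3!split => //; split.
  move=> u Xu; apply: (graph_closure_unique C0 yx (S'P _ _)); first exact: SY.
  exact/graph_closure_sym/SP.
split.
  move=> w Yw; apply: (graph_closure_unique C0 xy (SP _ _)); first exact: S'X.
  exact/graph_closure_sym/S'P.
split.
  apply: (lipschitz_within C0) => u v Xu Xv.
  rewrite (subE _ (S u)) (subE _ u) -lin//.
  by apply: (graph_closure_le C0 xy); apply: SP; exact: closed_span_linear.
split.
  apply: (lipschitz_within C0) => u v Yu Yv.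
  rewrite (subE _ (S' u)) (subE _ u) -lin'//.
  by apply: (graph_closure_le C0 yx); apply: S'P; exact: closed_span_linear.
move=> n.
have single (F : normedModType K) (z : nat -> F) :
    lincomb z (fun i => (i == n)%:R) n.+1 = z n.
  rewrite lincombS eqxx scale1r /lincomb big1 ?add0r// => i _.
  by rewrite ltn_eqF// scale0r.
apply: (graph_closure_unique C0 xy (SP _ _)).
  by rewrite -(single _ x); exact: closed_span_lincomb.
by rewrite -(single _ x) -(single _ y); exact: graph_closure_lincomb.
Qed.

Lemma equivalent_trans {E G H : normedModType K} (x : nat -> E) (y : nat -> G)
    (z : nat -> H) :
  equivalent_sequences x y -> equivalent_sequences y z ->
  equivalent_sequences x z.
Proof.
move=> [S [S' [Sl [SY [S'X [S'S [SS' [Sc [S'c Sx]]]]]]]]].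
move=> [T [T' [Tl [TZ [T'Y [T'T [TT' [Tc [T'c Ty]]]]]]]]].
have comp (E1 E2 E3 : normedModType K) (A : set E1) (B : set E2)
    (f : E1 -> E2) (g : E2 -> E3) : (forall u, A u -> B (f u)) ->
    {within A, continuous f} -> {within B, continuous g} ->
    {within A, continuous (g \o f)}.
  move=> AB /subspace_continuousP fc /subspace_continuousP gc.
  apply/subspace_continuousP => u Au V gV.
  have := fc u Au _ (gc (f u) (AB u Au) V gV).
  rewrite /within/= /nbhs/=; apply: filterS => v h Av.
  exact: h Av (AB v Av).
exists (T \o S), (S' \o T'); rewrite /comp /=; split.
  by move=> a u v Xu Xv; rewrite Sl// Tl//; exact: SY.
split; first by move=> u /SY/TZ.
split; first by move=> w /T'Y/S'X.
split; first by move=> u Xu; rewrite T'T ?S'S//; exact: SY.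
split; first by move=> w Zw; rewrite SS' ?TT'//; exact: T'Y.
split; first exact: comp SY Sc Tc.
split; first exact: comp T'Y T'c S'c.
by move=> n; rewrite Sx Ty.
Qed.

(** Coefficients being at most B times the norm of the combination L of x, the
    combination of y with the same coefficients is at distance at most
    sum_i B |L| theta_i <= |L| / 2 from L. *)
Lemma perturbation_dominated {E : normedModType K} (x y : nat -> E) (B : R)
    (theta : nat -> R) : 0 < B ->
  (forall a i n, (i < n)%N -> modulus (a i) <= B * rnorm (lincomb x a n)) ->
  (forall i, rnorm (x i - y i) <= theta i) ->
  (forall n, \sum_(i < n) theta i <= (2 * B)^-1) ->
  dominated x y 2 /\ dominated y x 2.
Proof.
move=> B0 xB xy thetaB.
have half a n : rnorm (lincomb x a n - lincomb y a n) <=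
    2^-1 * rnorm (lincomb x a n).
  have -> : lincomb x a n - lincomb y a n = lincomb (fun i => x i - y i) a n.
    by rewrite /lincomb -sumrB; apply: eq_bigr => i _; rewrite scalerBr.
  set L := rnorm (lincomb x a n).
  apply: (le_trans (lincomb_le _ _ _)).
  apply: (@le_trans _ _ (\sum_(i < n) B * L * theta i)).
    apply: ler_sum => i _; apply: ler_pM; rewrite ?modulus_ge0 ?rnorm_ge0//.
    exact: xB.
  rewrite -mulr_sumr (le_trans (ler_wpM2l _ (thetaB n)))//.
    by rewrite mulr_ge0 ?rnorm_ge0// ltW.
  by rewrite le_eqVlt; apply/orP; left; apply/eqP; field; rewrite gt_eqF.
split=> a n; have h := half a n; have L0 := rnorm_ge0 (lincomb x a n).
  have := rnormB (lincomb x a n) (lincomb x a n - lincomb y a n).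
  by rewrite opprB addrC subrK; lra.
have := rnormD (lincomb x a n - lincomb y a n) (lincomb y a n).
by rewrite subrK; lra.
Qed.

End equivalence.

Section type2.
Context {R : realType} {k : scalar_kind}.
Local Notation K := (scalars R k).
Context {E : normedModType K}.

Lemma Rademacher_type2_real : Rademacher_type2 E ->
  exists2 C : R, 0 <= C & forall n (x : 'I_n -> E),
    \sum_(e : {ffun 'I_n -> bool}) rnorm (\sum_(i < n) (-1) ^+ e i *: x i) ^+ 2
      <= 2 ^+ n * (C * \sum_(i < n) rnorm (x i) ^+ 2).
Proof.
move=> [C0 [/real_of_ge0 CE ineq]].
exists (re_part C0 ^+ 2); first exact: sqr_ge0.
move=> n x; have := ineq n x.
rewrite ler_pdivrMr ?exprn_gt0// mulrC CE.
under eq_bigr do rewrite rnormE -of_realX.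
under [X in _ <= _ * (_ * X)]eq_bigr do rewrite rnormE -of_realX.
have -> : 2 = of_real k 2 :> K by rewrite -[2]/(1 + 1) of_realD of_real1.
by rewrite -!of_real_sum -!of_realX -!of_realM of_real_le re_part_of_real.
Qed.

End type2.

(** * Function norms and the space of a function norm *)

Section fnorm_facts.
Context {R : realType} {d : measure_display} {T : measurableType d}.
Context {mu : {measure set T -> \bar R}} (rho : function_norm mu).
Local Open Scope ereal_scope.
Implicit Types (f g : T -> \bar R) (h : nat -> T -> \bar R).

Lemma L0plus_indic (A : set T) : measurable A ->
  L0plus (fun w => (\1_A w : R)%:E).
Proof.
move=> mA; split=> [|w]; last by rewrite lee_fin.
by apply/measurable_EFinP; exact: measurable_indic.
Qed.

Lemma L0plusZ (t : R) f : (0 <= t)%R -> L0plus f -> L0plus (fun w => t%:E * f w).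
Proof.
move=> t0 [mf f0]; split=> [|w]; last by rewrite mule_ge0.
by apply: emeasurable_funM => //; exact: measurable_cst.
Qed.

Lemma L0plusD f g : L0plus f -> L0plus g -> L0plus (f \+ g).
Proof.
move=> [mf f0] [mg g0]; split; first exact: emeasurable_funD.
by move=> w; rewrite adde_ge0.
Qed.

Lemma L0plus_sum h n : (forall i, L0plus (h i)) ->
  L0plus (fun w => \sum_(i < n) h i w).
Proof.
move=> Lh; split=> [|w]; last by apply: sume_ge0 => i _; exact: (Lh i).2.
by apply: emeasurable_sum => i; exact: (Lh i).1.
Qed.

Lemma L0plus_series h : (forall i, L0plus (h i)) ->
  L0plus (fun w => \sum_(i <oo) h i w).
Proof.
move=> Lh; split=> [|w]; last by apply: nneseries_ge0 => i _ _; exact: (Lh i).2.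
by apply: ge0_emeasurable_sum => [i x _ _|i _]; [exact: (Lh i).2|exact: (Lh i).1].
Qed.

Lemma eq_fnorm f g : f =1 g -> rho f = rho g.
Proof. by move=> fg; congr (fnorm rho _); exact/funext. Qed.

Lemma fnorm0 : rho (fun=> 0) = 0.
Proof.
apply/fnorm_eq0; last exact: aeW.
by split => // w; exact: measurable_cst.
Qed.

Lemma fnorm_le_pointwise f g : L0plus f -> L0plus g -> (forall w, f w <= g w) ->
  rho f <= rho g.
Proof. by move=> Lf Lg fg; apply: fnorm_le => //; exact: aeW. Qed.

Lemma fnorm_sum h n : (forall i, L0plus (h i)) ->
  rho (fun w => \sum_(i < n) h i w) <= \sum_(i < n) rho (h i).
Proof.
move=> Lh; elim: n => [|n IH].
  by rewrite big_ord0 (@eq_fnorm _ (fun=> 0)) ?fnorm0// => w; rewrite big_ord0.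
rewrite big_ord_recr/= (@eq_fnorm _ ((fun w => \sum_(i < n) h i w) \+ h n)).
  apply: (le_trans (fnormD _ (L0plus_sum _ Lh) (Lh n))).
  by rewrite leeD2r.
by move=> w; rewrite big_ord_recr.
Qed.

(** Countable subadditivity: finite subadditivity and the Fatou property. *)
Lemma fnorm_series_le h (B : \bar R) : (forall i, L0plus (h i)) ->
  (forall n, \sum_(i < n) rho (h i) <= B) ->
  rho (fun w => \sum_(i <oo) h i w) <= B.
Proof.
move=> Lh hB.
have cv := @fnorm_cvg _ _ _ _ rho (fun n w => \sum_(i < n) h i w) _
  (fun n => L0plus_sum n Lh) (L0plus_series Lh) _ _.
have {}cv := cv (fun n => aeW _ (fun w => _)) (aeW _ (fun w => _)).
have {}cv : rho (fun w => \sum_(i < n) h i w) @[n --> \oo] -->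
    rho (fun w => \sum_(i <oo) h i w).
  apply: cv => [n w|w].
    by rewrite big_ord_recr/= leeDl// (Lh n).2.
  have := @is_cvg_nneseries R (fun i => h i w) xpredT 0%N.
  have -> : (fun n => \sum_(i < n) h i w) = (fun n => \sum_(0 <= i < n) h i w).
    by apply/funext => n; rewrite big_mkord.
  by apply => i _ _; exact: (Lh i).2.
have <- := cvg_lim (@ereal_hausdorff R) cv.
apply: lime_le; first by apply/cvg_ex; eexists; exact: cv.
by apply: nearW => n; exact: le_trans (fnorm_sum n Lh) (hB n).
Qed.

Lemma geometric_partial_le (c : R) n : (0 <= c)%R ->
  (\sum_(i < n) c * 2^-1 ^+ i <= 2 * c)%R.
Proof.
move=> c0; have -> : (\sum_(i < n) c * 2^-1 ^+ i = 2 * c - 2 * c * 2^-1 ^+ n)%R.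
  elim: n => [|n IH]; first by rewrite big_ord0 expr0 mulr1 subrr.
  by rewrite big_ord_recr/= IH exprS; field.
by rewrite gerBl !mulr_ge0// exprn_ge0.
Qed.

Lemma fnorm_geometric_series h (c : R) : (0 <= c)%R -> (forall i, L0plus (h i)) ->
  (forall i, rho (h i) <= (c * 2^-1 ^+ i)%:E) ->
  rho (fun w => \sum_(i <oo) h i w) <= (2 * c)%:E.
Proof.
move=> c0 Lh hc; apply: fnorm_series_le => // n.
apply: (@le_trans _ _ (\sum_(i < n) (c * 2^-1 ^+ i)%:E)).
  by apply: lee_sum => i _.
by rewrite sumEFin lee_fin geometric_partial_le.
Qed.

Lemma L0plus_fin_measurable f : L0plus f ->
  measurable [set w | f w \is a fin_num].
Proof.
by move=> [mf _]; rewrite -[X in measurable X]setTI; exact: emeasurable_fin_num.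
Qed.

(** Every multiple of the indicator of the set where f is infinite lies below
    f. *)
Lemma fnorm_lty_ae_fin f : L0plus f -> rho f < +oo ->
  \forall w \ae mu, f w \is a fin_num.
Proof.
move=> Lf fy; pose A := ~` [set w | f w \is a fin_num].
have mA : measurable A by apply: measurableC; exact: L0plus_fin_measurable.
have LA := L0plus_indic mA.
suff : rho (fun w => (\1_A w)%:E) = 0.
  move/(fnorm_eq0 _ LA); apply: filterS => w; rewrite indicE => -[] /eqP.
  by rewrite pnatr_eq0 eqb0 => /negP; rewrite inE => /contrapT.
have rA0 := fnorm_ge0 rho LA.
have leA n : n%:R%:E * rho (fun w => (\1_A w)%:E) <= rho f.
  rewrite -fnormZ//; apply: fnorm_le_pointwise => //.
    exact: L0plusZ.
  move=> w; rewrite indicE; case: (boolP (w \in A)) => wA; last first.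
    by rewrite mule0 (Lf.2 w).
  rewrite mule1; move: wA; rewrite inE /A /=; case: (f w) (Lf.2 w) => //=.
  by move=> _ _; rewrite leey.
have rf0 := fnorm_ge0 rho Lf.
have [r fE] : exists r : R, rho f = r%:E.
  by exists (fine (rho f)); rewrite fineK// ge0_fin_numE.
move: leA; rewrite fE; case: (rho _) rA0 => [s|_ /(_ 1%N)|//].
  rewrite lee_fin => s0 leA; congr EFin; apply/eqP.
  rewrite eq_le s0 andbT; rewrite leNgt; apply/negP => sp.
  have := leA (Num.truncn (r / s)).+1; rewrite -EFinM lee_fin.
  by apply/negP; rewrite -ltNge -ltr_pdivrMr// truncnS_gt.
by rewrite mul1e leye_eq.
Qed.

End fnorm_facts.

Section Lrho_facts.
Context {R : realType} {k : scalar_kind}.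
Context {d : measure_display} {T : measurableType d}.
Context {mu : {measure set T -> \bar R}} (rho : function_norm mu).
Local Notation K := (scalars R k).
Local Notation Lf := (Lrho_fun k rho).
Implicit Types f g : Lf.

Lemma Lrho_fun_L0 f : L0 k (f : T -> K).
Proof. exact: (Lrho_funP f).1. Qed.

Lemma Lrho_fun_plus f : L0plus (abs_fun f).
Proof. exact/L0plus_abs/Lrho_fun_L0. Qed.

Lemma rnorm_Lrho_class f : (rnorm (Lrho_class f))%:E = rho (abs_fun f).
Proof.
have [L0f fy] := Lrho_funP f.
have r0 := fnorm_ge0 rho (L0plus_abs L0f).
rewrite /rnorm Lrho_norm_class modulus_of_real ?fine_ge0//.
by rewrite fineK// ge0_fin_numE.
Qed.

Lemma rnorm_Lrho (u : Lrho k rho) : (rnorm u)%:E = rho (abs_fun (repr u)).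
Proof. by rewrite -{1}(Lrho_classE u) rnorm_Lrho_class. Qed.

Lemma Lrho_class0 : Lrho_class (0 : Lf) = 0.
Proof. by rewrite -(scale0r (0 : Lf)) Lrho_classZ scale0r. Qed.

Lemma Lrho_classB f g : Lrho_class (f - g) = Lrho_class f - Lrho_class g.
Proof. by rewrite -scaleN1r Lrho_classD Lrho_classZ scaleN1r. Qed.

Lemma Lrho_class_sum n (c : 'I_n -> K) (f : 'I_n -> Lf) :
  Lrho_class (\sum_(i < n) c i *: f i) = \sum_(i < n) c i *: Lrho_class (f i).
Proof.
elim: n c f => [|n IH] c f; first by rewrite !big_ord0 Lrho_class0.
by rewrite !big_ord_recr/= Lrho_classD Lrho_classZ IH.
Qed.

Lemma Lrho_fun_sumE n (c : 'I_n -> K) (f : 'I_n -> Lf) w :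
  (\sum_(i < n) c i *: f i : Lf) w = \sum_(i < n) c i * f i w.
Proof.
elim: n c f => [|n IH] c f; first by rewrite !big_ord0.
by rewrite !big_ord_recr/= -IH.
Qed.

Lemma rnorm_Lrho_le f g : (forall w, modulus (f w) <= modulus (g w)) ->
  rnorm (Lrho_class f) <= rnorm (Lrho_class g).
Proof.
move=> fg; rewrite -lee_fin !rnorm_Lrho_class.
by apply: fnorm_le_pointwise; [exact: Lrho_fun_plus..|move=> w; rewrite lee_fin].
Qed.

Lemma Lrho_fun_of (h : T -> K) : L0 k h -> (rho (abs_fun h) < +oo)%E ->
  exists f, (f : T -> K) = h.
Proof.
move=> Lh hy; have hP : h \in Lrho_pred k rho by apply/asboolP.
by exists (MkLrhoFun hP).
Qed.

End Lrho_facts.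

(** * Completeness and bounded inclusions *)

(** u and the partial sums V of v have u + V nondecreasing and bounded. *)
Lemma summable_variation_cvg {R : realType} (u v : nat -> R) (B : R) :
  (forall n, `|u n.+1 - u n| <= v n) -> (forall n, \sum_(i < n) v i <= B) ->
  cvgn u.
Proof.
move=> uv vB; pose V n := \sum_(i < n) v i.
have v0 n : 0 <= v n by exact: le_trans (normr_ge0 _) (uv n).
have VS n : V n.+1 = V n + v n by rewrite /V big_ord_recr.
have cV : cvgn V.
  apply: nondecreasing_is_cvgn.
    by apply/nondecreasing_seqP => n; rewrite VS lerDl.
  by exists B => _ [n _ <-]; exact: vB.
have cuV : cvgn (u \+ V).
  apply: nondecreasing_is_cvgn.
    apply/nondecreasing_seqP => n /=; rewrite VS.
    by have := uv n; rewrite ler_norml; lra.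
  exists (u 0%N + 2 * B) => _ [n _ <-] /=.
  have : u n <= u 0%N + V n.
    elim: n => [|n IH]; first by rewrite /V big_ord0 addr0.
    by rewrite VS; have := uv n; rewrite ler_norml; lra.
  by have := vB n; rewrite -/(V n); lra.
have -> : u = (u \+ V) \- V by apply/funext => n /=; rewrite addrK.
exact: is_cvgB.
Qed.

Section completeness.
Context {R : realType} {k : scalar_kind}.
Context {d : measure_display} {T : measurableType d}.
Context {mu : {measure set T -> \bar R}} (rho : function_norm mu).
Local Notation K := (scalars R k).
Local Notation Lf := (Lrho_fun k rho).

Lemma L0_mk_scalar (p q : T -> R) : measurable_fun setT p ->
  measurable_fun setT q -> L0 k (fun w => mk_scalar (p w) (q w)).
Proof.
rewrite /L0 /mk_scalar; by case: k => //= mp mq; split.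
Qed.

(** Multiplied by the indicator of the measurable set where the series
    converges, real and imaginary parts converge everywhere, which makes their
    limits measurable. *)
Lemma L0_limit (f : nat -> T -> K) : (forall n, L0 k (f n)) ->
  exists g : T -> K, L0 k g /\ forall w,
    (\sum_(n <oo) abs_fun (f n.+1 - f n)%R w)%E \is a fin_num ->
    forall e : R, 0 < e -> exists N, forall n, (N <= n)%N ->
      modulus (g w - f n w) < e.
Proof.
move=> Lf; pose h n := abs_fun (f n.+1 - f n).
have Ldf n : L0 k (f n.+1 - f n).
  by rewrite addrC -scaleN1r; exact: L0_linear.
have Lh n : L0plus (h n) by exact: L0plus_abs.
pose A := [set w | (\sum_(n <oo) h n w)%E \is a fin_num].
have mA : measurable A by exact: L0plus_fin_measurable (L0plus_series Lh).
have h0 n w : (0 <= h n w)%E by exact: (Lh n).2.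
have cvgA (F : K -> R) : (forall z, `|F z| <= modulus z) ->
    (forall y z, F (y - z) = F y - F z) ->
    forall w, cvgn (fun n => \1_A w * F (f n w)).
  move=> F1 FB w; rewrite indicE; case: (boolP (w \in A)) => [|_]; last first.
    by under eq_fun do rewrite mul0r; exact: is_cvg_cst.
  under eq_fun do rewrite mul1r.
  rewrite inE /A/= => fin.
  apply: (@summable_variation_cvg _ _ (fun n => modulus ((f n.+1 - f n) w))
    (fine (\sum_(n <oo) h n w)%E)) => n.
    by rewrite -FB; exact: F1.
  rewrite -lee_fin fineK// -sumEFin -(big_mkord xpredT (fun i => h i w)).
  exact: nneseries_lim_ge.
have cre := cvgA (@re_part R k) (@re_part_le _ _) _.
have {}cre : forall w, cvgn (fun n => \1_A w * re_part (f n w)).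
  by apply: cre => y z; rewrite re_partD re_partN.
have cim := cvgA (@im_part R k) (@im_part_le _ _) _.
have {}cim : forall w, cvgn (fun n => \1_A w * im_part (f n w)).
  by apply: cim => y z; rewrite im_partD im_partN.
pose p w := limn (fun n => \1_A w * re_part (f n w)).
pose q w := limn (fun n => \1_A w * im_part (f n w)).
exists (fun w => mk_scalar (p w) (q w)); split.
  apply: L0_mk_scalar.
    apply: (@measurable_fun_cvg _ _ _ _ (fun n w => \1_A w * re_part (f n w))).
      move=> n; apply: measurable_funM; first exact: measurable_indic.
      exact: (Lf n).1.
    by move=> w _; exact: cre.
  apply: (@measurable_fun_cvg _ _ _ _ (fun n w => \1_A w * im_part (f n w))).
    move=> n; apply: measurable_funM; first exact: measurable_indic.
    exact: (Lf n).2.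
  by move=> w _; exact: cim.
move=> w fin e e0.
have Aw : \1_A w = 1 :> R by rewrite indicE mem_set.
have e2 : 0 < e / 2 by rewrite divr_gt0.
have /cvgrPdist_lt/(_ _ e2)[N1 _ P1] := cre w.
have /cvgrPdist_lt/(_ _ e2)[N2 _ P2] := cim w.
exists (maxn N1 N2) => n; rewrite geq_max => /andP[/P1 h1 /P2 h2].
have E (z : R) : \1_A w * z = z by rewrite Aw mul1r.
rewrite /= E in h1; rewrite /= E in h2.
apply: (le_lt_trans (modulus_mk_scalar_sub _ _ _)).
by rewrite [e]splitr ltrD.
Qed.

(** The Riesz-Fischer argument: the series of the moduli of the increments has
    finite norm, hence is finite almost everywhere, and its tails H n dominate
    the distance from f n to the pointwise limit. *)
Lemma Lrho_fast_complete : fast_complete (Lrho k rho).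
Proof.
move=> u uS; pose f n : Lf := repr (u n).
have fE n : Lrho_class (f n) = u n by exact: Lrho_classE.
pose h n : T -> \bar R := abs_fun (f n.+1 - f n : Lf).
have Lh n : L0plus (h n) by exact: Lrho_fun_plus.
have hn n : (rho (h n) <= (2^-1 ^+ n)%:E)%E.
  by rewrite -rnorm_Lrho_class Lrho_classB !fE lee_fin.
pose H n w := (\sum_(i <oo) h (n + i)%N w)%E.
have LH n : L0plus (H n) by apply: L0plus_series.
have Hn n : (rho (H n) <= (2 * 2^-1 ^+ n)%:E)%E.
  apply: fnorm_geometric_series => // i.
  by rewrite -exprD.
have [g [Lg gP]] := L0_limit (fun n => Lrho_fun_L0 (f n)).
have H0fin : \forall w \ae mu, H 0%N w \is a fin_num.
  by apply: (fnorm_lty_ae_fin (LH 0%N)); exact: le_lt_trans (Hn 0%N) (ltry _).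
have Lgf n : L0 k (g - f n).
  by rewrite addrC -scaleN1r; apply: L0_linear => //; exact: Lrho_fun_L0.
have gH n : (rho (abs_fun (g - (f n : T -> K))%R) <= rho (H n))%E.
  apply: fnorm_le => //; first exact: L0plus_abs (Lgf n).
  apply: filterS H0fin => w fin; apply/lee_addgt0Pr => e e0.
  have [|N NP] := gP w _ e e0; first exact: fin.
  have le_i i : modulus (g w - f n w) <= modulus (g w - f (n + i)%N w) +
      \sum_(j < i) modulus ((f (n + j).+1 - f (n + j)%N : Lf) w).
    elim: i => [|i IH]; first by rewrite big_ord0 addr0 addn0.
    apply: (le_trans IH); rewrite big_ord_recr/= addrA addnS.
    rewrite addrAC lerD2r; apply: le_trans (modulusD _ _).
    have <- : g w - f (n + i).+1 w + (f (n + i).+1 - f (n + i)%N : Lf) w =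
        g w - f (n + i)%N w by exact: subrKA.
    by [].
  have := le_i N; have := NP (n + N)%N (leq_addl _ _) => h1 h2.
  apply: (@le_trans _ _ (e + \sum_(j < N)
      modulus ((f (n + j).+1 - f (n + j)%N : Lf) w))%:E).
    by rewrite lee_fin; apply: (le_trans h2); rewrite lerD2r ltW.
  rewrite EFinD addeC leeD2r// -sumEFin.
  rewrite -(big_mkord xpredT (fun j => h (n + j)%N w)).
  by apply: nneseries_lim_ge => i _ _; exact: (Lh _).2.
have [|g' g'E] := @Lrho_fun_of _ k _ _ _ rho g Lg.
  have := fnorm_absD rho (Lgf 0%N) (Lrho_fun_L0 (f 0%N)); rewrite subrK.
  move=> /le_lt_trans; apply; apply: lte_add_pinfty.
    exact: le_lt_trans (le_trans (gH _) (Hn _)) (ltry _).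
  exact: (Lrho_funP (f 0%N)).2.
exists (Lrho_class g'); apply/cvg_rnormP => e e0.
have dist n : rnorm (Lrho_class g' - u n) <= 2 * 2^-1 ^+ n.
  rewrite -fE -Lrho_classB -lee_fin rnorm_Lrho_class.
  apply: le_trans (Hn n); apply: le_trans (gH n).
  by rewrite -g'E.
have e2 : 0 < e / 2 by rewrite divr_gt0.
have [N _ NP] := near_infty_natSinv_expn_lt (PosNum e2).
exists N => n /NP /=; rewrite mul1r -exprVn => h1.
by apply: (le_lt_trans (dist n)); lra.
Qed.

End completeness.

Section inclusion.
Context {R : realType} {k : scalar_kind}.
Context {d : measure_display} {T : measurableType d}.
Context {mu : {measure set T -> \bar R}} (rho rho' : function_norm mu).
Local Notation K := (scalars R k).

(** An inclusion between two such spaces is bounded: otherwise the sum of a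
    rapidly convergent series of positive functions would lie in the first
    space but not in the second. *)
Lemma Lrho_inclusion_bounded : Lrho_set k rho `<=` Lrho_set k rho' ->
  exists2 D : R, 0 < D & forall f : Lrho_fun k rho,
    (rho' (abs_fun f) <= (D * rnorm (Lrho_class f))%:E)%E.
Proof.
move=> sub; apply: contrapT => unbounded.
have bad n : exists g : Lrho_fun k rho,
    rnorm (Lrho_class g) = 2^-1 ^+ n /\ ((2 ^+ n)%:E < rho' (abs_fun g))%E.
  apply: contrapT => good; apply: unbounded.
  (* 4^n = 2^n 2^n: one factor makes the norm of g equal to 2^-n, the other makes
     its second norm exceed 2^n. *)
  exists (4 ^+ n); first by rewrite exprn_gt0.
  move=> f; rewrite leNgt; apply/negP => h; apply: good.
  have r0 : 0 < rnorm (Lrho_class f).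
    rewrite lt_def rnorm_ge0 andbT; apply/negP => /eqP f0.
    move: h; rewrite f0 mulr0 => h; suff : rho' (abs_fun f) = 0%E.
      by move=> h'; rewrite h' ltxx in h.
    apply/(fnorm_eq0 rho' (Lrho_fun_plus f))/(fnorm_eq0 rho (Lrho_fun_plus f)).
    by rewrite -rnorm_Lrho_class f0.
  pose c : R := (2 ^+ n * rnorm (Lrho_class f))^-1.
  have c0 : 0 < c by rewrite invr_gt0 mulr_gt0// exprn_gt0.
  exists (of_real k c *: f); split.
    rewrite Lrho_classZ rnormZ modulus_of_real ?ltW// /c invfM.
    by rewrite mulfVK ?gt_eqF// exprVn.
  rewrite fnorm_absZ; last exact: Lrho_fun_L0.
  rewrite modulus_of_real ?ltW// muleC -lte_pdivrMr// -EFinM.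
  rewrite (le_lt_trans _ h)// lee_fin /c invrK.
  by rewrite mulrA -exprMn -natrM.
have [g gP] := choice bad.
pose h n := abs_fun (g n).
have Lh n : L0plus (h n) by exact: Lrho_fun_plus.
pose H w := (\sum_(n <oo) h n w)%E.
have LH : L0plus H by exact: L0plus_series.
have rH : (rho H < +oo)%E.
  apply: (@le_lt_trans _ _ (2 * 1)%:E); last exact: ltry.
  apply: fnorm_geometric_series => // n.
  by rewrite -rnorm_Lrho_class (gP n).1 mul1r.
pose F w : K := of_real k (fine (H w)).
have absF w : H w \is a fin_num -> abs_fun F w = H w.
  by move=> fin; rewrite /abs_fun modulus_of_real ?fineK// fine_ge0// LH.2.
have LF : L0 k F.
  have mH : measurable_fun setT (fine \o H) by exact: measurableT_comp LH.1.
  by rewrite /L0 /F; case: k => /=; split.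
have Hfin := fnorm_lty_ae_fin LH rH.
have : Lrho_set k rho F.
  split => //; apply: le_lt_trans rH; apply: fnorm_le => //.
    exact: L0plus_abs.
  by apply: filterS Hfin => w /absF ->.
move=> /sub[_ F'].
have leF n : (rho' (h n) <= rho' (abs_fun F))%E.
  apply: fnorm_le => //; first exact: L0plus_abs.
  apply: filterS Hfin => w /absF ->.
  apply: le_trans (@nneseries_lim_ge _ (fun n => h n w) xpredT 0%N n.+1 _).
    rewrite big_nat_recr//= leeDr// sume_ge0// => i _; exact: (Lh i).2.
  by move=> i _ _; exact: (Lh i).2.
have F0 := fnorm_ge0 rho' (L0plus_abs LF).
have [r FE] : exists r : R, rho' (abs_fun F) = r%:E.
  by exists (fine (rho' (abs_fun F))); rewrite fineK// ge0_fin_numE.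
have := leF (Num.truncn r).+1; rewrite leNgt => /negP; apply.
apply: le_lt_trans (gP _).2; rewrite FE lee_fin.
apply: (le_trans (ltW (truncnS_gt r))).
by rewrite -natrX ler_nat ltnW// ltn_expl.
Qed.

End inclusion.

(** * Absolute continuity of the norm *)

Section multiplication.
Context {R : realType} {k : scalar_kind}.
Context {d : measure_display} {T : measurableType d}.
Context {mu : {measure set T -> \bar R}} (rho : function_norm mu).
Local Notation K := (scalars R k).
Local Notation Lf := (Lrho_fun k rho).

Lemma L0_real_mul (s : T -> R) (f : T -> K) : measurable_fun setT s -> L0 k f ->
  L0 k (fun w => of_real k (s w) * f w).
Proof.
move=> ms [mre mim]; split.
  rewrite (_ : (fun=> _) = (fun w => s w * re_part (f w))).
    exact: measurable_funM.
  apply/funext => w; rewrite re_partM re_part_of_real.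
  by case: k (f w) => [z|z] /=; rewrite ?mulr0 ?mul0r subr0.
rewrite (_ : (fun=> _) = (fun w => s w * im_part (f w))).
  exact: measurable_funM.
apply/funext => w; rewrite im_partM re_part_of_real.
by case: k (f w) => [z|z] /=; rewrite ?mulr0 ?mul0r addr0.
Qed.

Lemma modulus_real_mul (s : R) (z : K) :
  modulus (of_real k s * z) = `|s| * modulus z.
Proof.
rewrite modulusM; congr (_ * _).
rewrite modulusE re_part_of_real; have -> : im_part (of_real k s) = 0.
  by case: k.
by rewrite expr0n addr0 sqrtr_sqr.
Qed.

Lemma Lrho_real_mul (s : T -> R) (f : Lf) : measurable_fun setT s ->
  (forall w, `|s w| <= 1) ->
  exists g : Lf, forall w, g w = of_real k (s w) * f w.
Proof.
move=> ms s1; have Lg := L0_real_mul ms (Lrho_fun_L0 f).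
have [|g gE] := @Lrho_fun_of _ k _ _ _ rho _ Lg; last first.
  by exists g => w; rewrite gE.
apply: le_lt_trans (Lrho_funP f).2; apply: fnorm_le_pointwise.
- exact: L0plus_abs.
- exact: Lrho_fun_plus.
- by move=> w; rewrite lee_fin modulus_real_mul ler_piMl ?modulus_ge0.
Qed.

Definition cut_off (A : set T) (f : T -> K) : T -> K :=
  fun w => of_real k (\1_A w) * f w.

Lemma cut_off_in A f w : A w -> cut_off A f w = f w.
Proof. by move=> Aw; rewrite /cut_off indicE mem_set// of_real1 mul1r. Qed.

Lemma cut_off_out A f w : ~ A w -> cut_off A f w = 0.
Proof. by move=> Aw; rewrite /cut_off indicE memNset// of_real_0 mul0r. Qed.

Lemma L0_cut_off A f : measurable A -> L0 k f -> L0 k (cut_off A f).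
Proof. by move=> mA; apply: L0_real_mul; exact: measurable_indic. Qed.

Lemma fnorm_cut_off_subset A B f : measurable A -> measurable B -> L0 k f ->
  A `<=` B -> (rho (abs_fun (cut_off A f)) <= rho (abs_fun (cut_off B f)))%E.
Proof.
move=> mA mB Lf AB; apply: fnorm_le_pointwise; [exact/L0plus_abs/L0_cut_off..|].
move=> w; rewrite /abs_fun lee_fin; have [Aw|Aw] := pselect (A w).
  by rewrite !cut_off_in//; exact: AB.
by rewrite cut_off_out// modulus0 modulus_ge0.
Qed.

End multiplication.

Section absolute_continuity.
Context {R : realType} {k : scalar_kind}.
Context {d : measure_display} {T : measurableType d}.
Context {mu : {measure set T -> \bar R}} (rho : function_norm mu).
Local Notation K := (scalars R k).
Local Notation Lf := (Lrho_fun k rho).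

Lemma sum_sqr_signs (n : nat) (e : 'I_n -> bool) :
  \sum_(i < n) (-1) ^+ e i * (-1) ^+ e i = n%:R :> R.
Proof.
under eq_bigr do rewrite -expr2 sqrr_sign.
by rewrite sumr_const card_ord.
Qed.

(** The sequence spanned by disjoint pieces of a fixed function behaves like the
    one of l_infty, which contains the spaces l_1^n uniformly: with 2^n pieces
    indexed by the signs, the n Rademacher-like combinations x_i of the pieces
    satisfy |sum_i eps_i x_i| = n |f| on the piece of index eps. *)
Lemma disjoint_pieces_small (f : Lf) (D : nat -> set T) (delta : R) :
  Rademacher_type2 (Lrho k rho) -> 0 < delta ->
  (forall j, measurable (D j)) ->
  (forall i j, (i < j)%N -> D i `&` D j = set0) ->
  ~ (forall j, (delta%:E <= rho (abs_fun (cut_off (D j) f)))%E).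
Proof.
move=> /Rademacher_type2_real[C C0 type2] delta0 mD disj big.
have disjE i j w : D i w -> D j w -> i = j.
  move=> iw jw; case: (ltngtP i j) => // ij.
    by have : (D i `&` D j) w by []; rewrite disj.
  by have : (D j `&` D i) w by []; rewrite disj.
have large n : n%:R * delta ^+ 2 <= C * rnorm (Lrho_class f) ^+ 2.
  case: n => [|n'].
    by rewrite mul0r mulr_ge0// exprn_ge0// rnorm_ge0.
  set n := n'.+1.
  pose I := {ffun 'I_n -> bool}.
  pose DI (e : I) := D (enum_rank e).
  have DI_disj (e e' : I) w : DI e w -> DI e' w -> e = e'.
    by move=> ew ew'; apply/enum_rank_inj/val_inj; exact: disjE ew ew'.
  pose s (i : 'I_n) w : R := \sum_(e : I) (-1) ^+ e i * \1_(DI e) w.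
  have s_in i e w : DI e w -> s i w = (-1) ^+ e i.
    move=> ew; rewrite /s (bigD1 e)//= indicE mem_set// mulr1 big1 ?addr0//.
    move=> e' e'e; rewrite indicE memNset ?mulr0// => ew'.
    by move: e'e; rewrite (DI_disj _ _ _ ew ew') eqxx.
  have s_out i w : (forall e, ~ DI e w) -> s i w = 0.
    by move=> nw; rewrite /s big1// => e _; rewrite indicE memNset ?mulr0.
  have s1 i w : `|s i w| <= 1.
    have [[e ew]|nw] := pselect (exists e, DI e w).
      by rewrite (s_in _ _ _ ew) normrX normrN1 expr1n.
    by rewrite s_out ?normr0// => e ew; apply: nw; exists e.
  have ms i : measurable_fun setT (s i).
    apply: measurable_sum => e; apply: measurable_funM.
      exact: measurable_cst.
    by apply: measurable_indic; exact: mD.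
  have ex_x i : exists g : Lf, forall w, g w = of_real k (s i w) * f w.
    exact: Lrho_real_mul.
  have [x xE] := choice ex_x.
  have xf i : rnorm (Lrho_class (x i)) <= rnorm (Lrho_class f).
    apply: rnorm_Lrho_le => w.
    by rewrite xE modulus_real_mul ler_piMl ?modulus_ge0.
  have lower (e : I) : n%:R * delta <=
      rnorm (\sum_(i < n) (-1) ^+ e i *: Lrho_class (x i)).
    rewrite -(Lrho_class_sum (fun i => (-1) ^+ e i) x).
    rewrite -lee_fin rnorm_Lrho_class EFinM.
    apply: (@le_trans _ _ (n%:R%:E * rho (abs_fun (cut_off (DI e) f)))%E).
      by apply: lee_wpmul2l; [rewrite lee_fin|exact: big].
    have Lc : L0 k (cut_off (DI e) f).
      by apply: L0_cut_off (Lrho_fun_L0 _); exact: mD.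
    rewrite -fnormZ//; last exact: L0plus_abs.
    apply: fnorm_le_pointwise; [exact/L0plusZ/L0plus_abs|exact: Lrho_fun_plus|].
    move=> w; rewrite /abs_fun -EFinM lee_fin.
    have [ew|ew] := pselect (DI e w); last first.
      by rewrite cut_off_out// modulus0 mulr0 modulus_ge0.
    rewrite cut_off_in// Lrho_fun_sumE.
    have -> : \sum_(i < n) (-1) ^+ e i * x i w = of_real k n%:R * f w.
      rewrite -(sum_sqr_signs e) of_real_sum mulr_suml; apply: eq_bigr => i _.
      rewrite xE (s_in _ _ _ ew) of_realM mulrA; congr (_ * _ * _).
      by rewrite of_realX of_realN of_real1.
    by rewrite modulus_real_mul normr_nat.
  have := type2 n (fun i => Lrho_class (x i)).
  set X := rnorm (Lrho_class f) in xf *.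
  have X0 : 0 <= X by exact: rnorm_ge0.
  move=> h; have h1 : \sum_(e : I) (n%:R * delta) ^+ 2 <=
      2 ^+ n * (C * \sum_(i < n) X ^+ 2).
    apply: (@le_trans _ _ (\sum_(e : I)
      rnorm (\sum_(i < n) (-1) ^+ e i *: Lrho_class (x i)) ^+ 2)).
      apply: ler_sum => e _; rewrite ler_pXn2r// ?nnegrE ?rnorm_ge0//.
      by rewrite mulr_ge0// ltW.
    apply: (le_trans h); rewrite ler_wpM2l ?exprn_ge0// ler_wpM2l//.
    by apply: ler_sum => i _; rewrite ler_pXn2r// nnegrE rnorm_ge0.
  move: h1; rewrite !sumr_const card_ffun card_bool card_ord.
  rewrite -[_ *+ (2 ^ n)]mulr_natl natrX ler_pM2l ?exprn_gt0//.
  have -> : C * (X ^+ 2 *+ n) = n%:R * (C * X ^+ 2) by rewrite -mulr_natl mulrCA.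
  have -> : (n%:R * delta) ^+ 2 = n%:R * (n%:R * delta ^+ 2).
    by rewrite exprMn [n%:R ^+ 2]expr2 mulrA.
  by rewrite ler_pM2l// ltr0n.
set B := C * _ in large.
have := large (Num.truncn (B / delta ^+ 2)).+1.
apply/negP; rewrite -ltNge -ltr_pdivrMr ?exprn_gt0//.
exact: truncnS_gt.
Qed.

(** Type 2 makes the norm absolutely continuous. Otherwise there would be sets
    of summable measure on which f stays large; their tail unions decrease to a
    null set, and the Fatou property extracts from them infinitely many disjoint
    pieces of f of large norm. *)
Lemma absolutely_continuous_norm (f : Lf) (e : R) :
  Rademacher_type2 (Lrho k rho) -> 0 < e ->
  exists2 delta : R, 0 < delta & forall A, measurable A ->
    (mu A < delta%:E)%E -> (rho (abs_fun (cut_off A f)) < e%:E)%E.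
Proof.
move=> type2 e0; apply: contrapT => nodelta.
have p0 n : 0 < 2^-1 ^+ n :> R by rewrite exprn_gt0.
have bad n : exists A, [/\ measurable A, (mu A < (2^-1 ^+ n)%:E)%E &
    (e%:E <= rho (abs_fun (cut_off A f)))%E].
  apply: contrapT => good; apply: nodelta; exists (2^-1 ^+ n) => // A mA muA.
  by rewrite ltNge; apply/negP => h; apply: good; exists A.
have [A AP] := choice bad.
have mA n : measurable (A n) by have [] := AP n.
pose B n := \bigcup_(m in [set m | (n <= m)%N]) A m.
have mB n : measurable (B n) by apply: bigcup_measurable => m _.
have BS m n : (m <= n)%N -> B n `<=` B m.
  by move=> mn w [j nj Aj]; exists j => //=; exact: leq_trans mn nj.
have null : mu (\bigcap_n B n) = 0%E.
  apply: lim_sup_set_cvg0 => //.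
  apply: (@le_lt_trans _ _ (2 * 1)%:E); last exact: ltry.
  apply: lime_le; first by apply: is_cvg_nneseries.
  apply: nearW => n; rewrite big_mkord.
  apply: (@le_trans _ _ (\sum_(i < n) (1 * 2^-1 ^+ i)%:E)%E).
    apply: lee_sum => i _; rewrite mul1r ltW//.
    by have [] := AP i.
  by rewrite sumEFin lee_fin geometric_partial_le.
have Be n : (e%:E <= rho (abs_fun (cut_off (B n) f)))%E.
  have [_ _ h] := AP n; apply: (le_trans h).
  apply: fnorm_cut_off_subset => //; first exact: Lrho_fun_L0.
  by move=> w Aw; exists n => /=.
have piece n : exists m, (n < m)%N /\
    ((e / 2)%:E <= rho (abs_fun (cut_off (B n `\` B m) f)))%E.
  have cv : rho (abs_fun (cut_off (B n `\` B m) f)) @[m --> \oo] -->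
      rho (abs_fun (cut_off (B n) f)).
    apply: fnorm_cvg.
    - move=> m; apply/L0plus_abs/L0_cut_off; first exact: measurableD.
      exact: Lrho_fun_L0.
    - by apply/L0plus_abs/L0_cut_off => //; exact: Lrho_fun_L0.
    - move=> m; apply: aeW => w; rewrite /abs_fun lee_fin.
      have [[w1 w2]|nw] := pselect ((B n `\` B m) w).
        by rewrite !cut_off_in//; split => // /(BS _ _ (leqnSn m)).
      by rewrite [X in modulus X <= _]cut_off_out// modulus0 modulus_ge0.
    - exists (\bigcap_n B n); split => //.
        by apply: bigcap_measurable.
      move=> w /=; apply: contra_notP => nBw.
      have [m Bm] : exists m, ~ B m w.
        apply: contrapT => h; apply: nBw => m _; apply: contrapT => hm.
        by apply: h; exists m.
      apply: cvg_near_cst; exists m => // j /= mj.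
      have nBj : ~ B j w by move=> /(BS _ _ mj).
      rewrite /abs_fun; have [Bn|Bn] := pselect (B n w).
        by rewrite !cut_off_in.
      by rewrite !cut_off_out// => -[].
  apply: contrapT => small.
  have : (rho (abs_fun (cut_off (B n) f)) <= (e / 2)%:E)%E.
    rewrite -(cvg_lim (@ereal_hausdorff R) cv); apply: lime_le.
      by apply/cvg_ex; eexists; exact: cv.
    exists n.+1 => // m /= nm; rewrite leNgt; apply/negP => h; apply: small.
    by exists m; split => //; exact: ltW.
  apply/negP; rewrite -ltNge; apply: lt_le_trans (Be n).
  by rewrite lte_fin ltr_pdivrMr// ltr_pMr// ltr1n.
have [m mP] := choice piece.
pose N := fix N j : nat := if j is i.+1 then m (N i) else 0%N.
have NS i j : (i < j)%N -> (N i.+1 <= N j)%N.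
  elim: j => // j IH; rewrite ltnS leq_eqVlt => /orP[/eqP ->//|/IH h].
  by apply: (leq_trans h); apply: ltnW; exact: (mP (N j)).1.
apply: (@disjoint_pieces_small f (fun j => B (N j) `\` B (N j.+1)) (e / 2) type2).
- by rewrite divr_gt0.
- by move=> j; exact: measurableD.
- move=> i j /NS ij; rewrite -subset0 => w [[_ h] [Bj _]].
  by apply: h; exact: BS ij _ Bj.
- by move=> j; exact: (mP (N j)).2.
Qed.

End absolute_continuity.

(** * Approximation by simple functions *)

Section finite_measure_facts.
Context {R : realType} {d : measure_display} {T : measurableType d}.
Context (mu : {finite_measure set T -> \bar R}) (rho : function_norm mu).
Local Open Scope ereal_scope.

Lemma measurable_superlevel (f : T -> \bar R) (t : R) : L0plus f ->
  measurable [set w | t%:E <= f w].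
Proof.
move=> [mf _]; rewrite -[X in measurable X]setTI.
exact: emeasurable_fun_c_infty.
Qed.

Lemma mu_setT_lty : mu setT < +oo.
Proof. by rewrite -ge0_fin_numE// fin_num_measure. Qed.

(** Markov's inequality, by comparison with a constant on the superlevel set. *)
Lemma superlevel_small : exists2 C : R, (0 < C)%R & forall f t, L0plus f ->
  (0 < t)%R -> t%:E * mu [set w | t%:E <= f w] <= C%:E * rho f.
Proof.
have [C CP] := fnorm_integral rho measurableT mu_setT_lty.
exists (`|C| + 1)%R; first by rewrite ltr_wpDl.
move=> f t Lf t0; set A := [set w | _].
have mA : measurable A by exact: measurable_superlevel.
pose g w := t%:E * (\1_A w)%:E.
have Lg : L0plus g by apply: L0plusZ (ltW t0) _; exact: L0plus_indic.
have -> : t%:E * mu A = \int[mu]_(w in setT) g w.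
  rewrite ge0_integralZl ?lee_fin ?ltW//.
  - by rewrite integral_indic// setIT.
  - exact: (L0plus_indic mA).1.
apply: (le_trans (CP g Lg)); have g0 := fnorm_ge0 rho Lg.
apply: (@le_trans _ _ ((`|C| + 1)%:E * rho g)).
  rewrite lee_wpmul2r// lee_fin; apply: le_trans (ler_norm C) _.
  by rewrite lerDl.
apply: lee_wpmul2l; first by rewrite lee_fin addr_ge0.
apply: fnorm_le_pointwise => // w; rewrite /g indicE.
case: (boolP (w \in A)) => [|_]; first by rewrite inE mule1.
by rewrite mule0 (Lf.2 w).
Qed.

Lemma superlevel_lt (t delta : R) : (0 < t)%R -> (0 < delta)%R ->
  exists2 eta : R, (0 < eta)%R & forall f, L0plus f -> rho f < eta%:E ->
    mu [set w | t%:E <= f w] < delta%:E.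
Proof.
move=> t0 delta0; have [C C0 CP] := superlevel_small.
exists (t * delta / C)%R; first by rewrite divr_gt0 ?mulr_gt0.
move=> f Lf fe; rewrite -(@lte_pmul2l _ t%:E)//.
apply: le_lt_trans (CP f t Lf t0) _.
apply: (@lt_le_trans _ _ (C%:E * (t * delta / C)%:E)).
  by rewrite lte_pmul2l.
by rewrite -!EFinM lee_fin mulrC divfK// gt_eqF.
Qed.

Lemma superlevel_eventually_lt f (delta : R) : L0plus f -> rho f < +oo ->
  (0 < delta)%R ->
  exists2 N : R, (0 < N)%R & mu [set w | N%:E <= f w] < delta%:E.
Proof.
move=> Lf fy delta0; have [C C0 CP] := superlevel_small.
have f0 := fnorm_ge0 rho Lf.
have [r fE] : exists r : R, rho f = r%:E.
  by exists (fine (rho f)); rewrite fineK// ge0_fin_numE.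
have r0 : (0 <= r)%R by rewrite -lee_fin -fE.
have N0 : (0 < (C * r + 1) / delta)%R.
  by rewrite divr_gt0// ltr_wpDl// mulr_ge0// ltW.
exists ((C * r + 1) / delta)%R => //.
rewrite -(@lte_pmul2l _ ((C * r + 1) / delta)%:E)//.
apply: le_lt_trans (CP _ _ Lf N0) _.
by rewrite fE -!EFinM lte_fin divfK ?gt_eqF// ltrDl.
Qed.

Lemma fnorm_cst_lty (c : R) : (0 <= c)%R -> rho (fun=> c%:E) < +oo.
Proof.
move=> c0; rewrite (@eq_fnorm _ _ _ _ _ _ (fun w => c%:E * (\1_[set: T] w)%:E)).
  rewrite fnormZ//; last exact: L0plus_indic.
  by rewrite lte_mul_pinfty// ?lee_fin// fnorm_indic// mu_setT_lty.
by move=> w; rewrite indicE in_setT mule1.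
Qed.

End finite_measure_facts.

Section simple_approximation.
Context {R : realType} {k : scalar_kind}.
Context {d : measure_display} {T : measurableType d}.
Context (mu : {finite_measure set T -> \bar R}) (rho : function_norm mu).
Local Notation K := (scalars R k).
Local Notation Lf := (Lrho_fun k rho).

Definition grid_floor (eta r : R) : R := eta * (Num.floor (r / eta))%:~R.

Lemma grid_floor_dist (eta r : R) : 0 < eta -> `|grid_floor eta r - r| <= eta.
Proof.
move=> eta0; have /andP[] := floor_itv (r / eta).
rewrite /grid_floor intrD ler_pdivlMr// ltr_pdivrMr// => h1 h2.
rewrite ler_norml; move: h1 h2; rewrite mulrDl mul1r mulrC; lra.
Qed.

Lemma measurable_grid_floor (eta : R) : 0 < eta ->
  measurable_fun setT (grid_floor eta).
Proof.
move=> eta0; apply: nondecreasing_measurable => // x y xy.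
by rewrite /grid_floor ler_pM2l// ler_int le_floor// ler_pM2r// invr_gt0.
Qed.

Lemma finite_grid (eta N : R) : 0 < eta ->
  finite_set [set grid_floor eta r | r in [set r | `|r| <= N]].
Proof.
move=> eta0; pose M := (Num.truncn (N / eta)).+2.
pose F (n : nat) := eta * (n%:R - M%:R).
apply: (@sub_finite_set _ _ [set F n | n in `I_(M + M).+1]); last first.
  exact/finite_image/finite_II.
move=> _ [r /= rN <-]; have /andP[h1 h2] := floor_itv (r / eta).
have hM : N / eta + 1 < M%:R.
  by rewrite /M -addn1 natrD ltrD2r truncnS_gt.
have rb : `|r / eta| <= N / eta.
  by rewrite normrM (gtr0_norm (_ : 0 < eta^-1)) ?ler_pM2r ?invr_gt0.
set z := Num.floor _ in h1 h2 *.
have zl : (- (M%:Z) <= z)%R.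
  rewrite -(ler_int R) -(lerD2r 1) mulrNz; rewrite intrD in h2.
  move: rb h2 hM; rewrite ler_norml => /andP[h3 h4] h2 hM.
  rewrite [(Posz M)%:~R](_ : _ = M%:R)//; lra.
have zu : (z <= M%:Z)%R.
  rewrite -(ler_int R) [(Posz M)%:~R](_ : _ = M%:R)//.
  by move: rb hM; rewrite ler_norml => /andP[h3 h4]; lra.
exists (absz (z + M%:Z)); first by rewrite /=; lia.
rewrite /F /grid_floor -/z; congr (_ * _).
have -> : (absz (z + M%:Z))%:R = (z + M%:Z)%:~R :> R.
  by rewrite -[LHS]/((Posz (absz (z + M%:Z)))%:~R) gez0_abs//; lia.
by rewrite intrD addrK.
Qed.

(** Discarding the set where f is too large costs little by absolute continuity
    of the norm; elsewhere real and imaginary parts are rounded down to a fine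
    grid. *)
Lemma simple_approximation (f : Lf) (D : set T) (e : R) :
  Rademacher_type2 (Lrho k rho) -> measurable D -> 0 < e ->
  exists g : Lf, [/\ finitely_valued g, forall w, ~ D w -> g w = 0,
    forall w, g w != 0 -> modulus (f w) <= modulus (g w) + 1 &
    (rho (abs_fun (cut_off D f - (g : T -> K))%R) <= e%:E)%E].
Proof.
move=> type2 mD e0; have e2 : 0 < e / 2 by rewrite divr_gt0.
have Lf0 := Lrho_fun_L0 f; have Labs := Lrho_fun_plus f.
have [delta delta0 small] := absolutely_continuous_norm f type2 e2.
have [N N0 muN] := superlevel_eventually_lt Labs (Lrho_funP f).2 delta0.
pose A := [set w | (N%:E <= abs_fun f w)%E].
have mA : measurable A by exact: measurable_superlevel.
have one0 := fnorm_ge0 rho (f := fun=> 1%:E)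
  ltac:(by split => [|w]; [exact: measurable_cst|rewrite lee_fin]).
have oney := fnorm_cst_lty rho (@ler01 R).
pose r1 := fine (rho (fun=> 1%:E)).
have r1E : rho (fun=> 1%:E) = r1%:E by rewrite fineK// ge0_fin_numE.
have r10 : 0 <= r1 by rewrite -lee_fin -r1E.
(* eta <= 1/2 keeps the rounding error 2 eta at most 1. *)
pose eta := Num.min (1 / 2) (e / (4 * (r1 + 1))).
have r11 : 0 < r1 + 1 by rewrite ltr_wpDl.
have eta0 : 0 < eta by rewrite lt_min !divr_gt0// mulr_gt0.
have eta1 : eta <= 1 / 2 by rewrite ge_min lexx.
have eta2 : 2 * eta * r1 <= e / 2.
  apply: (@le_trans _ _ (2 * eta * (r1 + 1))).
    by rewrite ler_pM2l ?lerDl// mulr_gt0.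
  have : eta <= e / (4 * (r1 + 1)) by rewrite ge_min lexx orbT.
  by rewrite ler_pdivlMr ?mulr_gt0//; lra.
pose h w : K := mk_scalar (grid_floor eta (re_part (f w)))
  (grid_floor eta (im_part (f w))).
have Lh : L0 k h.
  by apply: L0_mk_scalar; apply: measurableT_comp (measurable_grid_floor eta0) _;
    [exact: Lf0.1|exact: Lf0.2].
have hf w : modulus (h w - f w) <= 2 * eta.
  apply: (le_trans (modulus_mk_scalar_sub _ _ _)).
  have := grid_floor_dist (re_part (f w)) eta0.
  by have := grid_floor_dist (im_part (f w)) eta0; lra.
pose E := D `\` A; have mE : measurable E by exact: measurableD.
have LE : L0 k (cut_off E h) by exact: L0_cut_off.
have E_N w : E w -> modulus (f w) < N.
  by move=> [_ nA]; rewrite ltNge; apply/negP => h'; apply: nA.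
have bnd : (rho (abs_fun (cut_off E h)) < +oo)%E.
  apply: (@le_lt_trans _ _ (rho (fun=> (N + 1)%:E))); last first.
    by apply: fnorm_cst_lty; rewrite addr_ge0// ltW.
  apply: fnorm_le_pointwise.
  - exact: L0plus_abs.
  - split=> [|w]; first exact: measurable_cst.
    by rewrite lee_fin addr_ge0// ltW.
  move=> w; rewrite /abs_fun lee_fin; have [Ew|Ew] := pselect (E w).
    rewrite cut_off_in//; have := hf w; have := E_N w Ew.
    have := modulusD (h w - f w) (f w); rewrite subrK.
    by lra.
  by rewrite cut_off_out// modulus0 addr_ge0// ltW.
have [g gE] := Lrho_fun_of LE bnd.
exists g; rewrite gE; split.
- pose G := [set grid_floor eta r | r in [set r | `|r| <= N]].
  apply: (@sub_finite_set _ _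
    ([set mk_scalar z.1 z.2 | z in G `*` G] `|` [set 0])); last first.
    rewrite finite_setU; split => //; apply/finite_image/finite_setX;
      exact: finite_grid.
  move=> _ [w _ <-]; have [Ew|Ew] := pselect (E w); last first.
    by right; rewrite /= cut_off_out.
  left; rewrite cut_off_in//.
  exists (grid_floor eta (re_part (f w)), grid_floor eta (im_part (f w))) => //.
  have fN := ltW (E_N w Ew).
  split => /=; [exists (re_part (f w))|exists (im_part (f w))] => //=.
    exact: le_trans (re_part_le _) fN.
  exact: le_trans (im_part_le _) fN.
- by move=> w Dw; rewrite cut_off_out// => -[].
- move=> w; have [Ew _|Ew] := pselect (E w); last by rewrite cut_off_out// eqxx.
  rewrite cut_off_in//; have := hf w.
  have := modulusD (f w - h w) (h w); rewrite subrK -(modulusN (f w - h w)) opprB.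
  by lra.
have LDg : L0 k (cut_off D f - cut_off E h).
  rewrite addrC -scaleN1r; apply: L0_linear => //; exact: L0_cut_off.
pose c2 (w : T) : \bar R := ((2 * eta)%:E * 1%:E)%E.
have L1 : L0plus (fun _ : T => 1%:E : \bar R).
  by split => [|w]; [exact: measurable_cst|rewrite lee_fin].
have Lc2 : L0plus c2 by apply: L0plusZ => //; rewrite mulr_ge0// ltW.
have LA : L0plus (abs_fun (cut_off A f)) by exact/L0plus_abs/L0_cut_off.
apply: (@le_trans _ _ (rho (abs_fun (cut_off A f) \+ c2)%E)).
  apply: fnorm_le_pointwise; [exact: L0plus_abs|exact: L0plusD|].
  move=> w; rewrite /c2 /= mule1 /abs_fun -EFinD lee_fin.
  have -> : (cut_off D f - cut_off E h) w = cut_off D f w - cut_off E h w by [].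
  have [Dw|Dw] := pselect (D w); last first.
    rewrite [cut_off D f w]cut_off_out// [cut_off E h w]cut_off_out; last by case.
    by rewrite subr0 modulus0 addr_ge0 ?modulus_ge0// mulr_ge0// ltW.
  have [Aw|Aw] := pselect (A w).
    rewrite [cut_off D f w]cut_off_in// [cut_off A f w]cut_off_in//.
    rewrite cut_off_out; last by case.
    by rewrite subr0 lerDl mulr_ge0// ltW.
  rewrite [cut_off D f w]cut_off_in// [cut_off E h w]cut_off_in//.
  rewrite [cut_off A f w]cut_off_out// modulus0 add0r.
  by rewrite -(modulusN (f w - h w)) opprB.
apply: (le_trans (fnormD _ LA Lc2)).
rewrite /c2 fnormZ//; last by rewrite mulr_ge0// ltW.
rewrite r1E -EFinM [e]splitr EFinD leeD// ?lee_fin//.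
by apply: ltW; exact: small.
Qed.

End simple_approximation.

(** * Sequences equivalent to the unit vectors of ell_2 *)

Section hilbert.
Context {R : realType} {k : scalar_kind}.
Context {d : measure_display} {T : measurableType d}.
Context (mu : {measure set T -> \bar R}).
Local Notation K := (scalars R k).
Local Notation L2f := (Lrho_fun k (L2_norm mu)).

Lemma modulus_parallelogram (y z : K) :
  modulus (y + z) ^+ 2 + modulus (y - z) ^+ 2 =
  2 * (modulus y ^+ 2 + modulus z ^+ 2).
Proof. by rewrite !modulus_sqr !re_partD !im_partD re_partN im_partN; ring. Qed.

Lemma measurable_sqr_abs (f : T -> K) : L0 k f ->
  measurable_fun setT (fun w => (modulus (f w) ^+ 2)%:E).
Proof.
move=> Lf; apply/measurable_EFinP; apply: measurable_funX.
exact/measurable_EFinP/(L0plus_abs Lf).1.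
Qed.

Lemma rnorm_L2 (f : L2f) :
  (rnorm (Lrho_class f) ^+ 2)%:E = (\int[mu]_w (modulus (f w) ^+ 2)%:E)%E.
Proof.
have sq (r : R) : 0 <= r -> (r ^+ 2)%:E = (r%:E `^ 2)%E.
  by move=> r0; rewrite poweR_EFin powR_mulrn.
rewrite sq ?rnorm_ge0// rnorm_Lrho_class /= poweR_Lnorm ?pnatr_eq0//.
apply: eq_integral => w _.
by rewrite /abs_fun gee0_abs ?lee_fin ?modulus_ge0// -sq ?modulus_ge0.
Qed.

Lemma L2_parallelogram (u v : Lrho k (L2_norm mu)) :
  rnorm (u + v) ^+ 2 + rnorm (u - v) ^+ 2 = 2 * (rnorm u ^+ 2 + rnorm v ^+ 2).
Proof.
rewrite -(Lrho_classE u) -(Lrho_classE v) -Lrho_classB -Lrho_classD.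
set f : L2f := repr u; set g : L2f := repr v.
have m (h : L2f) := measurable_sqr_abs (Lrho_fun_L0 h).
have p (h : L2f) w : [set: T] w -> (0 <= (modulus (h w) ^+ 2)%:E)%E.
  by move=> _; rewrite lee_fin exprn_ge0// modulus_ge0.
apply: EFin_inj; rewrite EFinD [in RHS]EFinM [X in (_ * X)%E]EFinD !rnorm_L2.
rewrite -(ge0_integralD mu measurableT (p (f + g)) (m _) (p (f - g)) (m _)).
rewrite -(ge0_integralD mu measurableT (p f) (m _) (p g) (m _)).
rewrite -ge0_integralZl//; last 2 first.
- exact: emeasurable_funD (m f) (m g).
- by move=> w _; rewrite adde_ge0// p.
apply: eq_integral => w _; rewrite -!EFinD -EFinM.
by rewrite -modulus_parallelogram.
Qed.

Lemma L2_pythagoras (f g : L2f) : (forall w, f w = 0 \/ g w = 0) ->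
  rnorm (Lrho_class f + Lrho_class g) ^+ 2 =
  rnorm (Lrho_class f) ^+ 2 + rnorm (Lrho_class g) ^+ 2.
Proof.
move=> fg; have m (h : L2f) := measurable_sqr_abs (Lrho_fun_L0 h).
have p (h : L2f) w : [set: T] w -> (0 <= (modulus (h w) ^+ 2)%:E)%E.
  by move=> _; rewrite lee_fin exprn_ge0// modulus_ge0.
rewrite -Lrho_classD; apply: EFin_inj; rewrite EFinD !rnorm_L2.
rewrite -(ge0_integralD mu measurableT (p f) (m _) (p g) (m _)).
apply: eq_integral => w _; rewrite -EFinD; congr EFin.
have -> : (f + g : L2f) w = f w + g w by [].
by case: (fg w) => ->; rewrite ?add0r ?addr0 modulus0 expr0n ?add0r ?addr0.
Qed.

End hilbert.

(** One of the two signs of each new vector increases the squared norm of the sum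
    by at least the squared norm of that vector. *)
Lemma signs_of_parallelogram {R : realType} {k : scalar_kind}
    {H : normedModType (scalars R k)} :
  (forall u v : H, rnorm (u + v) ^+ 2 + rnorm (u - v) ^+ 2 =
    2 * (rnorm u ^+ 2 + rnorm v ^+ 2)) ->
  forall (v : nat -> H) n, exists e : nat -> bool,
    \sum_(i < n) rnorm (v i) ^+ 2 <=
      rnorm (\sum_(i < n) (-1) ^+ e i *: v i) ^+ 2.
Proof.
move=> par v; elim=> [|n [e IH]].
  by exists (fun=> false); rewrite !big_ord0 exprn_ge0// rnorm_ge0.
set S := \sum_(i < n) (-1) ^+ e i *: v i in IH.
have key (b : bool) : rnorm S ^+ 2 + rnorm (v n) ^+ 2 <=
    rnorm (S + (-1) ^+ b *: v n) ^+ 2 ->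
    exists e : nat -> bool, \sum_(i < n.+1) rnorm (v i) ^+ 2 <=
      rnorm (\sum_(i < n.+1) (-1) ^+ e i *: v i) ^+ 2.
  move=> h; exists (fun i => if i == n then b else e i).
  rewrite !big_ord_recr/= eqxx.
  have -> : \sum_(i < n) (-1) ^+ (if i == n :> nat then b else e i) *: v i = S.
    by apply: eq_bigr => i _; rewrite ltn_eqF.
  by apply: le_trans h; rewrite lerD2r.
have := par S (v n) => p.
have [h|h] := leP (rnorm S ^+ 2 + rnorm (v n) ^+ 2) (rnorm (S + v n) ^+ 2).
  by apply: (key false); rewrite expr0 scale1r.
by apply: (key true); rewrite expr1 scaleN1r; lra.
Qed.

Section ell2_basis.
Context (R : realType) (k : scalar_kind).

Lemma lincomb_unit_vector (a : nat -> scalars R k) n :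
  rnorm (lincomb (unit_vector R k) a n) ^+ 2 = \sum_(i < n) modulus (a i) ^+ 2.
Proof.
pose e i : Lrho_fun k (ell2_norm R) := MkLrhoFun (unit_seq_Lrho R k i).
have lE m : lincomb (unit_vector R k) a m = Lrho_class (\sum_(i < m) a i *: e i).
  by rewrite (Lrho_class_sum (fun i => a i) (fun i => e i)).
have e1 i : rnorm (unit_vector R k i) = 1.
  apply/eqP; rewrite -(@eqrXn2 _ 2)// ?rnorm_ge0// expr1n; apply/eqP.
  apply: EFin_inj; rewrite /unit_vector rnorm_L2.
  transitivity (\int[@counting nat R]_w (\1_[set i] w)%:E)%E.
    apply: eq_integral => w _ /=; rewrite /unit_seq indicE; congr EFin.
    have -> : (w \in [set i]) = (w == i) by apply/idP/eqP => [|->]; rewrite inE.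
    by case: (w == i); rewrite ?modulus1 ?modulus0 ?expr1n ?expr0n.
  rewrite integral_indic// setIT.
  have : @counting nat R [set i] = 1%E by rewrite /counting asboolT// fset_set1
    finmap.cardfs1.
  by [].
elim: n => [|n IH].
  by rewrite /lincomb !big_ord0 rnorm0 expr0n.
rewrite lincombS big_ord_recr/= -IH lE.
have -> : a n *: unit_vector R k n = Lrho_class (a n *: e n).
  by rewrite Lrho_classZ.
rewrite L2_pythagoras; last first.
  move=> w; have [->|wn] := eqVneq w n.
    left; rewrite (Lrho_fun_sumE (fun i => a i) (fun i => e i)).
    rewrite big1// => i _; rewrite /e /= /unit_seq.
    by rewrite gtn_eqF// mulr0.
  right; have -> : (a n *: e n : Lrho_fun k (ell2_norm R)) w = a n * e n w by [].
  by rewrite /e /= /unit_seq (negbTE wn) mulr0.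
by rewrite Lrho_classZ rnormZ e1 mulr1.
Qed.

End ell2_basis.

Section hilbertian.
Context {R : realType} {k : scalar_kind}.
Local Notation K := (scalars R k).

Lemma dominatedW {E G : normedModType K} (x : nat -> E) (y : nat -> G) C C' :
  C <= C' -> dominated x y C -> dominated x y C'.
Proof.
move=> CC xy a n; apply: (le_trans (xy a n)).
by rewrite ler_wpM2r ?rnorm_ge0.
Qed.

(** The upper 2-estimate: averaging the unconditional inequality over all signs
    gives the quantity bounded by type 2. *)
Lemma type2_upper_estimate {E : normedModType K} (x : nat -> E) (U B : R) :
  Rademacher_type2 E -> 0 < U -> unconditional_bound x U ->
  (forall n, rnorm (x n) <= B) ->
  exists2 C : R, 0 < C & forall a n,
    rnorm (lincomb x a n) ^+ 2 <= C * \sum_(i < n) modulus (a i) ^+ 2.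
Proof.
move=> /Rademacher_type2_real[C C0 type2] U0 xU xB.
have B0 : 0 <= B by exact: le_trans (rnorm_ge0 _) (xB 0%N).
pose W := 1 + 2 * U.
have W0 : 0 < W by rewrite /W; lra.
exists (W ^+ 2 * (C * B ^+ 2) + 1).
  by rewrite ltr_wpDl// mulr_ge0 ?sqr_ge0// mulr_ge0 ?sqr_ge0.
move=> a n; set S := \sum_(i < n) _.
have S0 : 0 <= S by apply: sumr_ge0 => i _; rewrite exprn_ge0// modulus_ge0.
have := type2 n (fun i => a i *: x i).
have pos2 : 0 < 2 ^+ n :> R by rewrite exprn_gt0.
set L := rnorm (lincomb x a n).
have signed (e : {ffun 'I_n -> bool}) :
    L ^+ 2 <= W ^+ 2 * rnorm (\sum_(i < n) (-1) ^+ e i *: (a i *: x i)) ^+ 2.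
  pose eb i := if insub i is Some j then e j else false.
  have ebE (i : 'I_n) : eb i = e i by rewrite /eb valK.
  have -> : \sum_(i < n) (-1) ^+ e i *: (a i *: x i) =
      lincomb x (fun i => (-1) ^+ eb i * a i) n.
    by apply: eq_bigr => i _; rewrite ebE scalerA.
  have := sign_change_bound xU eb (fun i => (-1) ^+ eb i * a i) n.
  have -> : lincomb x (fun i => (-1) ^+ eb i * ((-1) ^+ eb i * a i)) n =
      lincomb x a n.
    by apply: eq_lincomb => i _; rewrite mulrA -expr2 sqrr_sign mul1r.
  rewrite -/W -/L => h; rewrite -exprMn ler_pXn2r// nnegrE ?rnorm_ge0//.
  by rewrite mulr_ge0 ?rnorm_ge0// ltW.
move=> h.
have : 2 ^+ n * L ^+ 2 <= W ^+ 2 * (2 ^+ n * (C * (B ^+ 2 * S))).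
  have -> : 2 ^+ n * L ^+ 2 = \sum_(e : {ffun 'I_n -> bool}) L ^+ 2.
    by rewrite sumr_const card_ffun card_bool card_ord -[RHS]mulr_natl natrX.
  apply: (@le_trans _ _ (\sum_(e : {ffun 'I_n -> bool})
    W ^+ 2 * rnorm (\sum_(i < n) (-1) ^+ e i *: (a i *: x i)) ^+ 2)).
    by apply: ler_sum.
  rewrite -mulr_sumr ler_pM2l ?exprn_gt0//; apply: (le_trans h).
  rewrite ler_pM2l//; apply: ler_wpM2l => //.
  rewrite /S mulr_sumr; apply: ler_sum => i _.
  rewrite rnormZ exprMn mulrC ler_wpM2r ?exprn_ge0 ?modulus_ge0//.
  by rewrite ler_pXn2r// nnegrE rnorm_ge0.
have -> : W ^+ 2 * (2 ^+ n * (C * (B ^+ 2 * S))) =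
    2 ^+ n * (W ^+ 2 * (C * B ^+ 2) * S) by ring.
by rewrite ler_pM2l// => h'; apply: (le_trans h'); rewrite mulrDl mul1r lerDl.
Qed.

Context {d : measure_display} {T : measurableType d}.
Context (mu : {measure set T -> \bar R}) (rho : function_norm mu).

(** The lower 2-estimate is obtained in L_2: for suitable signs the L_2 norm of
    a combination is at least that of orthogonal vectors, and the inclusion in
    L_2 is bounded. *)
Lemma equivalent_to_unit_vectors (x : nat -> Lrho k rho) (U B c : R) :
  Lrho_set k rho `<=` Lrho_set k (L2_norm mu) ->
  Rademacher_type2 (Lrho k rho) -> 0 < U -> unconditional_bound x U ->
  (forall n, rnorm (x n) <= B) -> 0 < c ->
  (forall n, (c%:E <= L2_norm mu (abs_fun (repr (x n) : Lrho_fun k rho)))%E) ->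
  equivalent_sequences x (unit_vector R k).
Proof.
move=> sub type2 U0 xU xB c0 xc.
have [C C0 upper] := type2_upper_estimate type2 U0 xU xB.
have [D D0 incl] := Lrho_inclusion_bounded sub.
pose W := 1 + 2 * U.
have W0 : 0 < W by rewrite /W; lra.
have ex_j (f : Lrho_fun k rho) :
    exists g : Lrho_fun k (L2_norm mu), (g : T -> K) = f.
  by have [Lf fy] := sub _ (Lrho_funP f); exact: Lrho_fun_of.
have [j jE] := choice ex_j.
pose f n : Lrho_fun k rho := repr (x n).
have fE n : Lrho_class (f n) = x n by exact: Lrho_classE.
pose v n := Lrho_class (j (f n)).
have vc n : c <= rnorm (v n).
  by rewrite -lee_fin rnorm_Lrho_class jE; exact: xc.
have vD b n : rnorm (lincomb v b n) <= D * rnorm (lincomb x b n).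
  rewrite -lee_fin.
  have -> : lincomb v b n = Lrho_class (\sum_(i < n) b i *: j (f i)).
    by rewrite (Lrho_class_sum (fun i => b i) (fun i => j (f i))).
  have -> : lincomb x b n = Lrho_class (\sum_(i < n) b i *: f i).
    rewrite (Lrho_class_sum (fun i => b i) (fun i => f i)).
    by apply: eq_bigr => i _; rewrite fE.
  rewrite rnorm_Lrho_class; apply: le_trans (incl _).
  rewrite le_eqVlt; apply/orP; left; apply/eqP; apply: eq_fnorm => w.
  rewrite /abs_fun (Lrho_fun_sumE (fun i => b i) (fun i => j (f i))).
  rewrite (Lrho_fun_sumE (fun i => b i) (fun i => f i)).
  by under eq_bigr do rewrite jE.
have lower (a : nat -> K) n : c ^+ 2 * \sum_(i < n) modulus (a i) ^+ 2 <=
    (D * W * rnorm (lincomb x a n)) ^+ 2.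
  have [e eP] := signs_of_parallelogram (@L2_parallelogram R k d T mu)
    (fun i => a i *: v i) n.
  apply: (@le_trans _ _ (\sum_(i < n) rnorm (a i *: v i) ^+ 2)).
    rewrite mulr_sumr; apply: ler_sum => i _.
    rewrite rnormZ exprMn mulrC ler_wpM2l ?exprn_ge0 ?modulus_ge0//.
    by rewrite ler_pXn2r// nnegrE ?rnorm_ge0// ltW.
  apply: (le_trans eP).
  have -> : \sum_(i < n) (-1) ^+ e i *: (a i *: v i) =
      lincomb v (fun i => (-1) ^+ e i * a i) n.
    by apply: eq_bigr => i _; rewrite scalerA.
  rewrite ler_pXn2r ?nnegrE ?rnorm_ge0//; last first.
    by rewrite !mulr_ge0 ?rnorm_ge0// ltW.
  apply: (le_trans (vD _ _)); rewrite -mulrA ler_pM2l//.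
  exact: sign_change_bound.
have one2 (r : R) : 0 <= r -> r <= (r + 1) ^+ 2.
  by move=> r0; rewrite sqrrD expr1n mulr1; have := sqr_ge0 r; lra.
have up : dominated (unit_vector R k) x (C + 1).
  move=> a n; rewrite -(@ler_pXn2r _ 2)// ?nnegrE ?rnorm_ge0//; last first.
    by rewrite mulr_ge0 ?rnorm_ge0// addr_ge0// ltW.
  apply: (le_trans (upper a n)); rewrite exprMn lincomb_unit_vector.
  apply: ler_wpM2r; last by exact/one2/ltW.
  by apply: sumr_ge0 => i _; rewrite exprn_ge0// modulus_ge0.
have low : dominated x (unit_vector R k) (D * W / c).
  move=> a n; rewrite -(@ler_pXn2r _ 2)// ?nnegrE ?rnorm_ge0//; last first.
    by rewrite mulr_ge0 ?rnorm_ge0// !mulr_ge0 ?invr_ge0// ltW.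
  rewrite lincomb_unit_vector -(@ler_pM2l _ (c ^+ 2)) ?exprn_gt0//.
  apply: (le_trans (lower a n)); rewrite -exprMn.
  rewrite le_eqVlt; apply/orP; left; apply/eqP; congr (_ ^+ 2).
  by field; rewrite gt_eqF.
have DW0 : 0 < D * W / c by rewrite divr_gt0// mulr_gt0.
apply: (@equivalent_of_dominated _ _ _ _ _ _ (D * W / c + (C + 1))).
- exact: Lrho_fast_complete.
- exact: Lrho_fast_complete.
- by rewrite addr_gt0// ltr_wpDl// ltW.
- by apply: dominatedW low; rewrite lerDl addr_ge0// ltW.
- by apply: dominatedW up; rewrite lerDr ltW.
Qed.

End hilbertian.

(** * Almost disjoint subsequences *)

Section disjointification.
Context {R : realType} {k : scalar_kind}.
Context {d : measure_display} {T : measurableType d}.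
Context (mu : {finite_measure set T -> \bar R}) (rho rho' : function_norm mu).
Local Notation K := (scalars R k).
Local Notation Lf := (Lrho_fun k rho).

Definition superlevel (f : T -> K) (M : R) : set T :=
  [set w | (M%:E <= abs_fun f w)%E].

Lemma superlevelE (f : T -> K) M w : superlevel f M w = (M <= modulus (f w)).
Proof. by rewrite /superlevel /abs_fun /= lee_fin. Qed.

(** Functions that are small for the second norm are small in measure, so that
    where they are bounded by M they are close to 0 except on a set A of small
    measure, on which M 1_A has small norm. *)
Lemma small_below_level (M t e : R) : Rademacher_type2 (Lrho k rho) ->
  0 < M -> 0 < t -> 0 < e ->
  exists2 eta : R, 0 < eta & forall f : Lf, (rho' (abs_fun f) < eta%:E)%E ->
    (mu (superlevel f M) < t%:E)%E /\
    (rho (abs_fun (cut_off (~` superlevel f M) f)) <= e%:E)%E.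
Proof.
move=> type2 M0 t0 e0.
have L1 : L0plus (fun _ : T => 1%:E : \bar R).
  by split => [|w]; [exact: measurable_cst|rewrite lee_fin].
have one0 := fnorm_ge0 rho L1.
have oney := fnorm_cst_lty rho (@ler01 R).
pose r1 := fine (rho (fun=> 1%:E)).
have r1E : rho (fun=> 1%:E) = r1%:E by rewrite fineK// ge0_fin_numE.
have r10 : 0 <= r1 by rewrite -lee_fin -r1E.
have [one oneE] : exists f : Lf, (f : T -> K) = fun=> 1.
  apply: Lrho_fun_of.
    by split; exact: measurable_cst.
  rewrite (@eq_fnorm _ _ _ _ _ _ (fun=> 1%:E))// => w.
  by rewrite /abs_fun modulus1.
have eM : 0 < e / (2 * M) by rewrite divr_gt0// mulr_gt0.
have [delta delta0 small] := absolutely_continuous_norm one type2 eM.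
(* The constant s has norm at most e / 2, and so has M 1_A when the norm of 1_A
   is at most e / (2 M). *)
pose s := e / (2 * (r1 + 1)).
have r11 : 0 < r1 + 1 by rewrite ltr_wpDl.
have s0 : 0 < s by rewrite divr_gt0// mulr_gt0.
have sr1 : s * r1 <= e / 2.
  have -> : e / 2 = s * (r1 + 1) by rewrite /s; field; rewrite gt_eqF.
  by rewrite ler_pM2l// lerDl.
have [eta1 eta10 P1] := superlevel_lt rho' M0 t0.
have [eta2 eta20 P2] := superlevel_lt rho' s0 delta0.
exists (Num.min eta1 eta2); first by rewrite lt_min eta10.
move=> f feta; have Labs := Lrho_fun_plus f; have Lf0 := Lrho_fun_L0 f.
have f1 : (rho' (abs_fun f) < eta1%:E)%E.
  by apply: lt_le_trans feta _; rewrite lee_fin ge_min lexx.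
have f2 : (rho' (abs_fun f) < eta2%:E)%E.
  by apply: lt_le_trans feta _; rewrite lee_fin ge_min lexx orbT.
split; first exact: P1.
pose A := superlevel f s.
have mA : measurable A by exact: measurable_superlevel.
have mM : measurable (~` superlevel f M).
  by apply: measurableC; exact: measurable_superlevel.
have LA : L0plus (abs_fun (cut_off A one)).
  exact/L0plus_abs/L0_cut_off/Lrho_fun_L0.
have LMA : L0plus (fun w => (M%:E * abs_fun (cut_off A one) w)%E).
  by apply: L0plusZ => //; exact: ltW.
have Ls : L0plus (fun w : T => (s%:E * 1%:E)%E).
  by apply: (L0plusZ (ltW s0) L1).
apply: (@le_trans _ _ (rho ((fun w => M%:E * abs_fun (cut_off A one) w) \+
    (fun w => s%:E * 1%:E))%E)).
  apply: fnorm_le_pointwise; [exact/L0plus_abs/L0_cut_off|exact: L0plusD|].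
  move=> w; rewrite /= mule1 /abs_fun -EFinM -EFinD lee_fin.
  have [Mw|Mw] := pselect ((~` superlevel f M) w); last first.
    rewrite cut_off_out// modulus0 addr_ge0 ?(ltW s0)//.
    by rewrite mulr_ge0 ?modulus_ge0// ltW.
  rewrite (cut_off_in _ Mw).
  move: Mw; rewrite /setC/= superlevelE => /negP; rewrite -ltNge => fM.
  have [Aw|Aw] := pselect (A w).
    by rewrite cut_off_in// oneE modulus1 mulr1; lra.
  rewrite cut_off_out// modulus0 mulr0 add0r.
  by move: Aw; rewrite /A superlevelE => /negP; rewrite -ltNge => /ltW.
apply: (le_trans (fnormD _ LMA Ls)).
rewrite fnormZ//; last exact: ltW.
rewrite (fnormZ rho (ltW s0) L1) r1E -EFinM [e]splitr EFinD leeD//.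
have Aone : (rho (abs_fun (cut_off A one)) <= (e / (2 * M))%:E)%E.
  by apply/ltW/small => //; exact: P2.
apply: (@le_trans _ _ (M%:E * (e / (2 * M))%:E)%E).
  by apply: lee_wpmul2l => //; rewrite lee_fin ltW.
rewrite -EFinM lee_fin le_eqVlt; apply/orP; left; apply/eqP.
by field; rewrite gt_eqF.
Qed.

(** The Kadec-Pelczynski subsequence: the sets where the chosen functions are
    large have measures so small, compared with the functions chosen before,
    that removing from each of them all later ones changes little. *)
Lemma disjoint_escaping_subsequence (x : nat -> Lrho k rho) (theta : R) :
  Rademacher_type2 (Lrho k rho) -> 0 < theta ->
  (forall (eta : R) N, 0 < eta -> exists2 n, (N <= n)%N &
    (rho' (abs_fun (repr (x n) : Lf)) < eta%:E)%E) ->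
  exists (phi : nat -> nat) (g : nat -> Lf),
    [/\ {homo phi : i j / (i < j)%N}, disjointly_supported g,
      forall n, finitely_valued (g n), escapes_to_infinity mu g &
      forall n, rnorm (x (phi n) - Lrho_class (g n)) <= theta * 2^-1 ^+ n].
Proof.
move=> type2 theta0 xsmall; pose f n : Lf := repr (x n).
pose M j : R := j.+1%:R.
pose e j : R := theta / 3 * 2^-1 ^+ j.
have e0 j : 0 < e j by rewrite mulr_gt0 ?exprn_gt0// divr_gt0.
(* A state (n, t) consists of the index chosen last and of a bound t on the
   measure of the next set. The bounds at least halve at each step, so that all
   later sets together have measure at most twice the next bound. *)
have step (s : nat * (nat * R)) : exists t : nat * R, 0 < s.2.2 ->
    [/\ (s.2.1 < t.1)%N, (mu (superlevel (f t.1) (M s.1)) < s.2.2%:E)%E,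
     (rho (abs_fun (cut_off (~` superlevel (f t.1) (M s.1)) (f t.1)))
       <= (e s.1)%:E)%E,
     0 < t.2 <= s.2.2 / 2 &
     forall A, measurable A -> (mu A <= (2 * t.2)%:E)%E ->
       (rho (abs_fun (cut_off A (f t.1))) <= (e s.1)%:E)%E].
  case: s => j [n t] /=; have [t0|t0] := ltP 0 t; last by exists (n, t).
  have M0 : 0 < M j by rewrite ltr0n.
  have [eta eta0 small] := small_below_level type2 M0 t0 (e0 j).
  have [m nm /small[h1 h2]] := xsmall eta n.+1 eta0.
  have [delta delta0 ac] := absolutely_continuous_norm (f m) type2 (e0 j).
  exists (m, Num.min (t / 2) (delta / 4)) => _; split => //=.
    by rewrite lt_min !divr_gt0//= ge_min lexx.
  move=> A mA muA; apply/ltW/ac => //; apply: le_lt_trans muA _.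
  have : Num.min (t / 2) (delta / 4) <= delta / 4 by rewrite ge_min lexx orbT.
  by rewrite lte_fin; lra.
have [F FP] := choice step.
pose st := fix st n : nat * R := if n is m.+1 then F (m, st m) else (0%N, 1).
have st0 j : 0 < (st j).2.
  by elim: j => [//|j IH]; have [_ _ _ /andP[]] := FP (j, st j) IH.
pose phi j := (st j.+1).1.
pose sigma j := superlevel (f (phi j)) (M j).
have stP j : [/\ ((st j).1 < phi j)%N, (mu (sigma j) < (st j).2%:E)%E,
     (rho (abs_fun (cut_off (~` sigma j) (f (phi j)))) <= (e j)%:E)%E,
     (st j.+1).2 <= (st j).2 / 2 &
     forall A, measurable A -> (mu A <= (2 * (st j.+1).2)%:E)%E ->
       (rho (abs_fun (cut_off A (f (phi j)))) <= (e j)%:E)%E].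
  by have [h1 h2 h3 /andP[_ h4] h5] := FP (j, st j) (st0 j); split.
have msigma j : measurable (sigma j).
  by apply: measurable_superlevel; exact: Lrho_fun_plus.
pose later j := \bigcup_i sigma (i + j.+1)%N.
have mlater j : measurable (later j) by exact: bigcup_measurable.
have tpow i j : (st (i + j)%N).2 <= (st j).2 * 2^-1 ^+ i.
  elim: i => [|i IH]; first by rewrite expr0 mulr1.
  have [_ _ _ h _] := stP (i + j)%N; apply: (le_trans h).
  by rewrite exprSr mulrA ler_wpM2r.
have mu_later j : (mu (later j) <= (2 * (st j.+1).2)%:E)%E.
  apply: le_trans (measure_sigma_subadditive mu (fun i => msigma (i + j.+1)%N)
    (mlater j) (@subset_refl _ _)) _.
  apply: lime_le; first by apply: is_cvg_nneseries.
  apply: nearW => n; rewrite big_mkord.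
  apply: (@le_trans _ _ (\sum_(i < n) ((st j.+1).2 * 2^-1 ^+ i)%:E)%E).
    apply: lee_sum => i _; have [_ h _ _ _] := stP (i + j.+1)%N.
    by apply: (le_trans (ltW h)); rewrite lee_fin tpow.
  by rewrite sumEFin lee_fin geometric_partial_le// ltW.
pose D j := sigma j `\` later j.
have mD j : measurable (D j) by exact: measurableD.
have ex_g j := simple_approximation (f (phi j)) type2 (mD j) (e0 j).
have [g gP] := choice ex_g.
have gD j w : g j w != 0 -> D j w.
  move=> gw; apply: contrapT => nD; have [_ h _ _] := gP j.
  by move: gw; rewrite h// eqxx.
have suppE j w : supp (g j) w -> g j w != 0 by move=> h; apply/eqP.
have D_disj i j w : (i < j)%N -> D i w -> ~ D j w.
  move=> ij [_ nl] [sj _]; apply: nl; exists (j - i.+1)%N => //.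
  by rewrite subnK.
exists phi, g; split.
- apply: homo_ltn => [? ? ?|j]; first exact: ltn_trans.
  by have [] := stP j.+1.
- move=> m n mn; rewrite -subset0 => w [/suppE/gD Dm /suppE/gD Dn].
  case: (ltngtP m n) mn => // [mn _|nm _]; first exact: D_disj mn Dm Dn.
  exact: D_disj nm Dn Dm.
- by move=> n; have [] := gP n.
- apply/cvgeyPge => A; exists (Num.truncn A).+1 => // n /= An.
  apply/ess_infP; apply: aeW => w; case: ifPn => [|_]; last exact: leey.
  rewrite inE => /suppE gw; rewrite /abs_fun lee_fin.
  have [_ _ /(_ w gw) h _] := gP n; have [sw _] := gD n w gw.
  move: sw; rewrite /sigma superlevelE /M => fM.
  have : A <= n%:R by apply: le_trans (ltW (truncnS_gt A)) _; rewrite ler_nat.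
  by move: fM; rewrite -addn1 natrD; lra.
- move=> j; have [_ _ h1 _ h2] := stP j; have [_ _ _ h3] := gP j.
  have {}h2 := h2 _ (measurableI _ _ (msigma j) (mlater j)).
  have {}h2 : (rho (abs_fun (cut_off (sigma j `&` later j) (f (phi j)))) <=
      (e j)%:E)%E.
    apply: h2; apply: le_trans (mu_later j).
    by apply: le_measure; rewrite ?inE//; exact: measurableI.
  have Lfj := Lrho_fun_L0 (f (phi j)).
  have La : L0plus (abs_fun (cut_off (~` sigma j) (f (phi j)))).
    by apply/L0plus_abs/L0_cut_off => //; exact: measurableC.
  have Lb : L0plus (abs_fun (cut_off (sigma j `&` later j) (f (phi j)))).
    by apply/L0plus_abs/L0_cut_off => //; exact: measurableI.
  have Lc : L0plus (abs_fun (cut_off (D j) (f (phi j)) - (g j : T -> K))).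
    apply: L0plus_abs; rewrite addrC -scaleN1r; apply: L0_linear.
      exact: Lrho_fun_L0.
    exact: L0_cut_off.
  rewrite -(Lrho_classE (x (phi j))) -Lrho_classB -lee_fin rnorm_Lrho_class.
  apply: (@le_trans _ _ (rho (abs_fun (cut_off (~` sigma j) (f (phi j))) \+
    (abs_fun (cut_off (sigma j `&` later j) (f (phi j))) \+
     abs_fun (cut_off (D j) (f (phi j)) - (g j : T -> K))%R))%E)).
    apply: fnorm_le_pointwise; first exact: Lrho_fun_plus.
      by apply: L0plusD => //; exact: L0plusD.
    move=> w; rewrite /= /abs_fun -!EFinD lee_fin.
    have -> : (cut_off (D j) (f (phi j)) - (g j : T -> K)) w =
      cut_off (D j) (f (phi j)) w - g j w by [].
    apply: (@le_trans _ _ (modulus (f (phi j) w - g j w))); first exact: lexx.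
    have -> : f (phi j) w - g j w = cut_off (~` sigma j) (f (phi j)) w
      + (cut_off (sigma j `&` later j) (f (phi j)) w +
         (cut_off (D j) (f (phi j)) w - g j w)).
      rewrite !addrA; congr (_ - _).
      have [sw|nsw] := pselect (sigma j w); last first.
        rewrite cut_off_in// cut_off_out; last by case.
        by rewrite cut_off_out ?addr0//; case.
      rewrite (@cut_off_out _ _ _ _ (~` sigma j)); last by move=> h; apply: h.
      have [lw|nlw] := pselect (later j w).
        rewrite cut_off_in// cut_off_out ?addr0 ?add0r//.
        by case.
      rewrite cut_off_out; last by case.
      by rewrite cut_off_in// !add0r.
    apply: (le_trans (modulusD _ _)); rewrite lerD2l.
    exact: modulusD.
  apply: (le_trans (fnormD _ La (L0plusD Lb Lc))).
  have -> : theta * 2^-1 ^+ j = e j + (e j + e j) by rewrite /e; field.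
  rewrite !EFinD; apply: leeD => //.
  by apply: (le_trans (fnormD _ Lb Lc)); exact: leeD.
Qed.

End disjointification.

Section subsequence.
Context {R : realType} {k : scalar_kind}.
Local Notation K := (scalars R k).
Context {E : normedModType K}.

(** The coefficients are extended by 0 outside the range of phi. *)
Lemma lincomb_subsequence (x : nat -> E) (phi : nat -> nat) (a : nat -> K) n :
  {homo phi : i j / (i < j)%N} ->
  exists b : nat -> K, (forall i, (i < n)%N -> b (phi i) = a i) /\
    lincomb x b (phi n) = lincomb (x \o phi) a n.
Proof.
move=> phiS.
have inj i j : phi i = phi j -> i = j.
  by case: (ltngtP i j) => // /phiS h e; rewrite e ltnn in h.
exists (fun m => \sum_(i < n) (m == phi i)%:R * a i); split.
  move=> i ni; rewrite (bigD1 (Ordinal ni))//= eqxx mul1r big1 ?addr0// => j ji.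
  case: eqP => [/inj ij|]; last by rewrite mul0r.
  by move: ji; rewrite -val_eqE /= ij eqxx.
rewrite /lincomb.
under eq_bigr do rewrite scaler_suml.
rewrite exchange_big/=; apply: eq_bigr => i _.
have ni : (phi i < phi n)%N by apply: phiS.
rewrite (bigD1 (Ordinal ni))//= eqxx mul1r big1 ?addr0// => j ji.
case: eqP => [jE|]; last by rewrite mul0r scale0r.
by move: ji; rewrite -val_eqE /= jE eqxx.
Qed.

Lemma positive_minimum (u : nat -> R) N : (forall n, 0 < u n) ->
  exists2 c, 0 < c & forall n, (n < N)%N -> c <= u n.
Proof.
move=> u0; elim: N => [|N [c c0 cP]]; first by exists 1.
exists (Num.min c (u N)); first by rewrite lt_min c0 u0.
move=> n; rewrite ltnS leq_eqVlt => /orP[/eqP ->|/cP h].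
  by rewrite ge_min lexx orbT.
by rewrite ge_min h.
Qed.

Lemma semi_normalized_real (x : nat -> E) : semi_normalized x ->
  exists c B : R, 0 < c /\ forall n, c <= rnorm (x n) <= B.
Proof.
move=> [c [B [c0 xcB]]].
have [c' c'0 cE] := pos_scalarE c0.
have B0 : 0 <= B.
  by have /andP[_] := xcB 0%N; apply: le_trans; exact: normr_ge0.
exists c', (re_part B); split => // n.
have := xcB n; rewrite rnormE cE of_real_le => /andP[-> /=].
by rewrite {1}(real_of_ge0 B0) of_real_le.
Qed.

End subsequence.

Theorem corollary4p3 (R : realType) (k : scalar_kind)
    (d : measure_display) (T : measurableType d)
    (mu : {finite_measure set T -> \bar R}) (rho : function_norm mu)
    (L2 : Lrho_set k rho `<=` Lrho_set k (L2_norm mu))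
    (type2 : Rademacher_type2 (Lrho k rho))
    (psi : nat -> Lrho k rho)
    (psi_sn : semi_normalized psi)
    (psi_ss : subsymmetric psi) :
  equivalent_sequences psi (unit_vector R k) \/
  exists g : nat -> Lrho_fun k rho,
    disjointly_supported g /\
    (forall n, finitely_valued (g n)) /\
    escapes_to_infinity mu g /\
    equivalent_sequences psi (fun n => Lrho_class (g n)).
Proof.
have complete := @Lrho_fast_complete R k d T mu rho.
have [uncond [basic spread]] := psi_ss.
have [c [B [c0 psicB]]] := semi_normalized_real psi_sn.
have [M M0 psiM] := basis_constant complete basic.
pose q n := L2_norm mu (abs_fun (repr (psi n) : Lrho_fun k rho)).
have [[c' c'0 qc]|small] := pselect (exists2 c' : R, 0 < c' &
    forall n, (c'%:E <= q n)%E).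
  left; have [U U0 psiU] := unconditional_constant complete uncond.
  apply: (equivalent_to_unit_vectors L2 type2 U0 psiU _ c'0 qc) => n.
  by have /andP[_] := psicB n; exact.
right.
have q0 n : exists r : R, 0 < r /\ q n = r%:E.
  have Lplus := Lrho_fun_plus (repr (psi n) : Lrho_fun k rho).
  have qn0 : (0 <= q n)%E := fnorm_ge0 _ Lplus.
  have [_ qfin] := L2 _ (Lrho_funP (repr (psi n))).
  exists (fine (q n)); split; last by rewrite fineK// ge0_fin_numE.
  rewrite fine_gt0// qfin andbT lt_def qn0 andbT; apply/negP => /eqP.
  move/(fnorm_eq0 _ Lplus)/(fnorm_eq0 rho Lplus); rewrite -rnorm_Lrho => -[h].
  by have := psicB n; rewrite h leNgt c0.
have [u uP] := choice q0.
have u0 n : 0 < u n by have [] := uP n.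
have uq n : q n = (u n)%:E by have [] := uP n.
have infinitely_small (eta : R) N : 0 < eta ->
    exists2 n, (N <= n)%N & (q n < eta%:E)%E.
  move=> eta0; have [m m0 mP] := positive_minimum N u0.
  apply: contrapT => none; apply: small.
  exists (Num.min eta m); first by rewrite lt_min eta0.
  move=> n; have [nN|nN] := leqP N n.
    rewrite leNgt; apply/negP => h; apply: none; exists n => //.
    by apply: lt_le_trans h _; rewrite lee_fin ge_min lexx.
  by rewrite uq lee_fin ge_min mP ?orbT.
pose b := 2 * M / c.
(* b bounds the coefficient functionals of all subsequences of psi. *)
have b0 : 0 < b by rewrite divr_gt0// mulr_gt0.
have theta0 : 0 < (4 * b)^-1 by rewrite invr_gt0 mulr_gt0.
(* The perturbations add up to at most 2 / (4 b) = 1 / (2 b). *)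
have [phi [g [phiS disj fin esc close]]] :=
  disjoint_escaping_subsequence type2 theta0 infinitely_small.
exists g; do 3!split => //.
apply: equivalent_trans (spread phi phiS) _.
have coef a i n : (i < n)%N ->
    modulus (a i) <= b * rnorm (lincomb (psi \o phi) a n).
  move=> ni; have [a' [a'E <-]] := lincomb_subsequence psi a n phiS.
  have := coefficient_bound psiM a' (phiS _ _ ni); rewrite a'E// => h.
  rewrite /b mulrAC ler_pdivlMr//; apply: le_trans h.
  by rewrite ler_wpM2l ?modulus_ge0//; have /andP[] := psicB (phi i).
have [|h1 h2] := perturbation_dominated b0 coef close.
  move=> n; apply: (le_trans (geometric_partial_le _ (ltW theta0))).
  by rewrite le_eqVlt; apply/orP; left; apply/eqP; field; rewrite gt_eqF.
exact: (@equivalent_of_dominated _ _ _ _ _ _ 2).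

Qed.
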